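(* Let $d\ge 1$, let $\sigma_W>0$ and $\sigma_Z>0$ be fixed constants, and let $\tilde m_n$ be the privatised partitioning regression estimate defined in the context, with sequences $h_n>0$, $c_n>0$, $0<M_n\le\infty$ and spheres (balls) $S_n\subset\mathbb{R}^d$ centred at the origin. If $S_n\uparrow \mathbb{R}^d$, $c_n\to 0$, $h_n\to 0$, $M_n\to\infty$ and $$\frac{(\log n)^3}{n\, c_n^2\, h_n^{2d}}\to 0 \qquad (n\to\infty),$$ then $$\lim_{n\to\infty}\int \{m(x)-\tilde m_n(x)\}^2\,\mu(dx)=0\quad\text{almost surely}$$ for any distribution of $(X,Y)$ on $\mathbb{R}^d\times\mathbb{R}$ with $\mathbb{E}[Y^2]<\infty$.
   Context: $(X,Y)$ is a random vector with values in $\mathbb{R}^d\times\mathbb{R}$ and $\mathbb{E}[Y^2]<\infty$; $\mu$ is the distribution of $X$, and $m(x)=\mathbb{E}[Y\mid X=x]$ is the regression function (defined for $\mu$-almost all $x$). The raw data $(X_1,Y_1),(X_2,Y_2),\ldots$ are i.i.d. copies of $(X,Y)$. For $h>0$, $\mathcal{P}_h=\{A_{h,1},A_{h,2},\ldots\}$ is a cubic partition of $\mathbb{R}^d$, i.e. the (Borel measurable, pairwise disjoint) cells $A_{h,j}$ are cubes of volume $h^d$. For each $n$, with $h=h_n$ and $S_n$ a sphere (ball) centred at the origin, the cells are numbered so that $A_{h,j}\cap S_n\neq\emptyset$ when $j\le N_n$ and $A_{h,j}\cap S_n=\emptyset$ when $j>N_n$, for some integer $N_n>0$. Privacy mechanism: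 $\{\epsilon_{i,j}\}_{i,j\ge1}$ and $\{\zeta_{i,j}\}_{i,j\ge1}$ are double arrays of i.i.d. random variables with the centred, unit-variance Laplace distribution (density $x\mapsto \exp(-\sqrt2|x|)/\sqrt2$); the two arrays and the raw data sequence are mutually independent. For $0<M<\infty$ put $[y]_{-M}^{M}=\min\{M,\max(y,-M)\}$, and put $[y]_{-\infty}^{\infty}=y$. For $i=1,\ldots,n$ and $j\le N_n$, with $h=h_n$, $$Z_{i,j}=[Y_i]_{-M_n}^{M_n}\,\mathbb{I}_{\{X_i\in A_{h,j}\}}+\sigma_Z\epsilon_{i,j},\qquad W_{i,j}=\mathbb{I}_{\{X_i\in A_{h,j}\}}+\sigma_W\zeta_{i,j},$$ where $\mathbb{I}$ denotes an indicator. Define $$\tilde\nu_n(A_{h,j})=\frac1n\sum_{i=1}^n Z_{i,j}\,\mathbb{I}_{\{j\le N_n\}},\qquad \tilde\mu_n(A_{h,j})=\frac1n\sum_{i=1}^n W_{i,j}\,\mathbb{I}_{\{j\le N_n\}}$$ (both equal to $0$ when $j>N_n$). Estimator: for $x\in A_{h_n,j}$, $$\tilde m_n(x)=\frac{\tilde\nu_n(A_{h_n,j})}{\tilde\mu_n(A_{h_n,j})}\,\mathbb{I}_{\{\tilde\mu_n(A_{h_n,j})\ge c_nh_n^d\}}\,\mathbb{I}_{\{j\le N_n\}},$$ understood as $0$ whenever one of the indicators is $0$. *)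

(* Defs.v *)
From HB Require Import structures.
From mathcomp Require Import all_boot all_order all_algebra finmap.
From mathcomp Require Import all_classical all_reals all_analysis.

Set Implicit Arguments.
Unset Strict Implicit.
Unset Printing Implicit Defensive.
Import Order.TTheory GRing.Theory Num.Theory.
Import numFieldTopology.Exports.

Local Open Scope classical_set_scope.
Local Open Scope ring_scope.

(* R^d is [d.-tuple R] with its product sigma-algebra, which is the Borel
   sigma-algebra. Samples, noise arrays and cells are numbered from 0: the index
   i (or j) below is the mathematical index minus one, so "j <= N_n" reads
   [j < N n]. *)

Section geometry.
Context (R : realType) (d : nat).
Implicit Types (x : d.-tuple R) (A S : set (d.-tuple R)) (h r : R).

Definition euclid_norm x : R := Num.sqrt (\sum_(k < d) tnth x k ^+ 2).

Definition origin_ball S : Prop :=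
  exists2 r : R, 0 < r &
    S = [set x | euclid_norm x < r] \/ S = [set x | euclid_norm x <= r].

Definition frame_coord (U : 'M[R]_d) x (k : 'I_d) : R :=
  \sum_(l < d) U k l * tnth x l.

(* A cube of edge length [h], hence of volume h^d: [a] is a corner in the
   coordinates of the orthonormal frame given by the rows of [U]. Any part of
   the boundary may belong to the cube. *)
Definition is_cube h A : Prop :=
  exists (U : 'M[R]_d) (a : 'I_d -> R),
    [/\ U *m U^T = 1%:M,
        [set x | forall k, a k < frame_coord U x k < a k + h] `<=` A &
        A `<=` [set x | forall k, a k <= frame_coord U x k <= a k + h]].

Definition cubic_partition h (Q : set (set (d.-tuple R))) : Prop :=
  [/\ forall A, Q A -> measurable A /\ is_cube h A,
      trivIset Q id &
      \bigcup_(A in Q) A = [set: d.-tuple R]].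

End geometry.

Section independence.
Context (R : realType) (dO : measure_display) (Omega : measurableType dO).
Variable P : probability Omega R.

Definition mutually_independent (I : choiceType) (dT : measure_display)
    (T : measurableType dT) (f : I -> Omega -> T) : Prop :=
  forall (J : {fset I}) (B : I -> set T), (forall i, measurable (B i)) ->
    P (\bigcap_(i in [set` J]) (f i @^-1` B i)) =
    (\prod_(i <- J) P (f i @^-1` B i))%E.

Definition sigma_of_family (I : Type) (dT : measure_display)
    (T : measurableType dT) (f : I -> Omega -> T) : set (set Omega) :=
  <<s \bigcup_i preimage_set_system setT (f i) measurable >>.

(* Since each of [F], [G], [H] contains [setT], the product rule for triples
   also yields the product rule for pairs. *)
Definition independent3 (F G H : set (set Omega)) : Prop :=
  forall A B C, F A -> G B -> H C ->
    P (A `&` B `&` C) = (P A * P B * P C)%E.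

End independence.

Section laws.
Context (R : realType) (dO : measure_display) (Omega : measurableType dO).
Variable P : probability Omega R.

Definition laplace_pdf (x : R) : R :=
  expR (- (Num.sqrt 2 * `|x|)) / Num.sqrt 2.

Definition laplace_distributed (X : {RV P >-> R}) : Prop :=
  forall B : set R, measurable B ->
    distribution P X B = (\int[lebesgue_measure]_(x in B) (laplace_pdf x)%:E)%E.

Definition same_law (dT : measure_display) (T : measurableType dT)
    (X Y : Omega -> T) : Prop :=
  forall B, measurable B -> P (X @^-1` B) = P (Y @^-1` B).

(* [m] is a version of x |-> E[Y | X = x]. *)
Definition is_regression_function (dT : measure_display)
    (T : measurableType dT) (X : {RV P >-> T}) (Y : {RV P >-> R})
    (m : T -> R) : Prop :=
  [/\ measurable_fun [set: T] m,
      (distribution P X).-integrable [set: T] (EFin \o m) &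
      forall B, measurable B ->
        (\int[distribution P X]_(x in B) (m x)%:E =
         \int[P]_(w in X @^-1` B) (Y w)%:E)%E].

End laws.

(* [y]_{-M}^{M} for 0 < M <= +oo; the value at [-oo] is irrelevant. *)
Definition truncation (R : realType) (M : \bar R) (y : R) : R :=
  if M is r%:E then Num.min r (Num.max y (- r)) else y.

Section private_estimate.
Context (R : realType) (d : nat) (Omega : Type).
Variables (X : nat -> Omega -> d.-tuple R) (Y : nat -> Omega -> R).
Variables (eps zeta : nat -> nat -> Omega -> R) (sigmaZ sigmaW : R).
Variables (h c : nat -> R) (M : nat -> \bar R).
Variables (A : nat -> nat -> set (d.-tuple R)) (N : nat -> nat).

Definition private_Z (n i j : nat) (w : Omega) : R :=
  truncation (M n) (Y i w) * \1_(A n j) (X i w) + sigmaZ * eps i j w.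

Definition private_W (n i j : nat) (w : Omega) : R :=
  \1_(A n j) (X i w) + sigmaW * zeta i j w.

Definition nu_tilde (n j : nat) (w : Omega) : R :=
  n%:R^-1 * \sum_(i < n) private_Z n i j w * (j < N n)%:R.

Definition mu_tilde (n j : nat) (w : Omega) : R :=
  n%:R^-1 * \sum_(i < n) private_W n i j w * (j < N n)%:R.

Definition m_tilde (n : nat) (w : Omega) (x : d.-tuple R) : R :=
  (* the number of the cell containing [x] *)
  let j := xget 0%N [set j | A n j x] in
  if (c n * h n ^+ d <= mu_tilde n j w) && (j < N n)%N
  then nu_tilde n j w / mu_tilde n j w else 0.

End private_estimate.

(* Main.v *)
Require Import Defs.
From HB Require Import structures.
From mathcomp Require Import all_boot all_order all_algebra finmap.
From mathcomp Require Import all_classical all_reals all_analysis.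
From mathcomp Require Import measurable_realfun.
From mathcomp Require Import ring lra.

(** Why the private estimate is consistent.

On a cell [B] the estimate is a ratio of two averages of independent terms, up to
the truncation of the responses: the numerator is near the integral of the
response over [X \in B], the denominator near the mass of [B], and Laplace noise
is added to both. Where the estimate is not zero, the denominator is at least the
threshold [t = c * h ^ d]. The hypothesis on the rate says that [n * t ^ 2] grows
faster than [ln n], and variables with exponential moments deviate from their
mean by a fraction of [t] with probability at most [2 * expR (- k * n * t ^ 2)]
([laplace_average], [bounded_average]). So each cell fails to be precise with a
probability below any power of [n] ([prob_bad_set]). The number of cells is
not controlled, but the error is an integral, in which the cells are weighted by
their masses: the expected contribution of the imprecise cells is summable over
[n], and it tends to zero almost surely ([bad_weight_cvg0]).

On a precise cell the algebra is deterministic. If the denominator misses the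
threshold, then the mass of the cell is at most [2 * t]. Such light cells carry
little of the integral of [m ^ 2]: a packing argument shows that at most a
constant times [h ^- d] cells meet a given box ([card_cells_meeting_box]), so that
the light ones have a total mass of order [c], apart from the mass outside of the
box ([int_light_cells_cvg0]). If the denominator reaches the threshold, then the
precision is relative, and the estimate is close to the mean of [m] over the cell
([selected_cell_error]). Cell means converge to [m] in mean square because they
are the best approximations constant on cells, and uniformly continuous functions
are dense ([sum_cell_variance_cvg0], [square_integrable_approximable]). That [m]
is square-integrable comes from the second moment of the response, level set by
level set ([regression_sqr_integrable]). The part of the space outside of the
numbered cells vanishes in the limit ([int_uncovered_cvg0]).

The responses are not bounded, whereas the concentration bound for them needs a
bounded variable. In the analysis they are split at a fixed level into a
truncation and a residual. The residual contributes, by Cauchy-Schwarz, at most a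
multiple of the empirical mean of its square, and that mean is almost surely at
most about twice its expectation: [average_ae_bounded] is a law of large numbers up
to a factor, which suffices since the expectation tends to zero with the level
([mean_residual2_cvg0]). The level is sent to infinity after the sample size.

Independence enters through one rule only, the expectation of a product of
nonnegative functions of independent variables ([int_prod_independent]). The
deviations of the data and of the two noise arrays are bounded separately and
combined by the union bound. *)

Set Implicit Arguments.
Unset Strict Implicit.
Unset Printing Implicit Defensive.
Import Order.TTheory GRing.Theory Num.Theory.
Import numFieldTopology.Exports.
Import numFieldNormedType.Exports.
Import HBNNSimple.

Local Open Scope classical_set_scope.
Local Open Scope ring_scope.

(** * Integrals of nonnegative functions *)

Section nonneg_integral.
Context (d : measure_display) (T : measurableType d) (R : realType).
Variable mu : {measure set T -> \bar R}.
Implicit Types f g : T -> R.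

Lemma int_le f g : (forall x, 0 <= f x) -> measurable_fun setT f ->
  measurable_fun setT g -> (forall x, f x <= g x) ->
  (\int[mu]_x (f x)%:E <= \int[mu]_x (g x)%:E)%E.
Proof.
move=> f0 mf mg fg; apply: ge0_le_integral => //.
- by move=> x _; rewrite lee_fin.
- exact/measurable_EFinP.
- exact/measurable_EFinP.
- by move=> x _; rewrite lee_fin.
Qed.

Lemma int_add f g : (forall x, 0 <= f x) -> (forall x, 0 <= g x) ->
  measurable_fun setT f -> measurable_fun setT g ->
  (\int[mu]_x (f x + g x)%:E = \int[mu]_x (f x)%:E + \int[mu]_x (g x)%:E)%E.
Proof.
move=> f0 g0 mf mg; rewrite -ge0_integralD//.
- by move=> x _; rewrite lee_fin.
- exact/measurable_EFinP.
- by move=> x _; rewrite lee_fin.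
- exact/measurable_EFinP.
Qed.

Lemma int_scale f (k : R) : 0 <= k -> (forall x, 0 <= f x) ->
  measurable_fun setT f ->
  (\int[mu]_x (k * f x)%:E = k%:E * \int[mu]_x (f x)%:E)%E.
Proof.
move=> k0 f0 mf; rewrite -ge0_integralZl_EFin//.
- by move=> x _; rewrite lee_fin.
- exact/measurable_EFinP.
Qed.

Lemma int_sum (I : Type) (s : seq I) (f : I -> T -> R) :
  (forall i x, 0 <= f i x) -> (forall i, measurable_fun setT (f i)) ->
  (\int[mu]_x (\sum_(i <- s) f i x)%:E =
   \sum_(i <- s) \int[mu]_x (f i x)%:E)%E.
Proof.
move=> f0 mf; rewrite -ge0_integral_sum//.
- by apply: eq_integral => x _; rewrite sumEFin.
- by move=> i; exact/measurable_EFinP.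
- by move=> i x _; rewrite lee_fin.
Qed.

Lemma int_ge0 f : (forall x, 0 <= f x) -> (0 <= \int[mu]_x (f x)%:E)%E.
Proof. by move=> f0; apply: integral_ge0 => x _; rewrite lee_fin. Qed.

Lemma int_indic (A : set T) : measurable A ->
  (\int[mu]_x (\1_A x)%:E)%E = mu A.
Proof. by move=> mA; rewrite integral_indic// setIT. Qed.

(** Indicator weights bring integrals over a set within reach of the rules above,
which concern the whole space. *)
Lemma int_setE (A : set T) f :
  (\int[mu]_(x in A) (f x)%:E = \int[mu]_x (\1_A x * f x)%:E)%E.
Proof.
rewrite integral_mkcond; apply: eq_integral => x _.
by rewrite patchE indicE; case: (x \in A); rewrite ?mul1r ?mul0r.
Qed.

End nonneg_integral.

Lemma measurable_indicT (d : measure_display) (T : measurableType d)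
  (R : realType) (A : set T) :
  measurable A -> measurable_fun setT (\1_A : T -> R).
Proof. by move=> mA; exact: measurable_indic. Qed.

Ltac nneg := repeat first
  [ done | exact: sqr_ge0 | exact: expR_ge0 | exact: ltW | apply: exprn_ge0
  | apply: mulr_ge0 | apply: addr_ge0 | apply: divr_ge0 | rewrite invr_ge0
  | (apply: sumr_ge0 => ? _) ].

Section from_indicators.
Context (R : realType) (dO dO' : measure_display).
Context (Omega : measurableType dO) (Omega' : measurableType dO').
Variables (P : {measure set Omega -> \bar R}) (P' : {measure set Omega' -> \bar R}).

(** Both sides, as functionals of [f], are integrals; so it suffices that they
agree on indicators. This is the step that replaces, one factor at a time,
indicators by functions in a product of independent factors. *)
Lemma int_mul_comp_from_indic (dT : measure_display) (T : measurableType dT)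
    (V : Omega -> T) (V' : Omega' -> T) (G : Omega -> R) (k : R) (f : T -> R) :
  measurable_fun setT V -> measurable_fun setT V' -> measurable_fun setT G ->
  (forall w, 0 <= G w) ->
  0 <= k ->
  (forall B, measurable B ->
    (\int[P]_w (G w * \1_B (V w))%:E = k%:E * P' (V' @^-1` B))%E) ->
  measurable_fun setT f -> (forall x, 0 <= f x) ->
  (\int[P]_w (G w * f (V w))%:E = k%:E * \int[P']_w (f (V' w))%:E)%E.
Proof.
move=> mV mV' mG G0 k0 H mf f0.
have mEf : measurable_fun [set: T] (EFin \o f) by exact/measurable_EFinP.
pose phi := nnsfun_approx (@measurableT _ T) mEf.
have mphiV n : measurable_fun setT (fun w => phi n (V w)).
  by apply: (measurableT_comp _ mV).
have mphiV' n : measurable_fun setT (fun w => phi n (V' w)).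
  by apply: (measurableT_comp _ mV').
have phi0 n x : 0 <= phi n x by exact: fun_ge0.
have mGphi n : measurable_fun setT (fun w => G w * phi n (V w)).
  exact: measurable_funM.
have step n : (\int[P]_w (G w * phi n (V w))%:E =
               k%:E * \int[P']_w (phi n (V' w))%:E)%E.
  have mlev y : measurable (phi n @^-1` [set y]) by [].
  have mB y : measurable_fun setT
      (fun w : Omega => (\1_(phi n @^-1` [set y]) (V w) : R)).
    by apply: (measurableT_comp _ mV); exact: measurable_indicT.
  have mB' y : measurable_fun setT
      (fun w : Omega' => (\1_(phi n @^-1` [set y]) (V' w) : R)).
    by apply: (measurableT_comp _ mV'); exact: measurable_indicT.
  have ynn y w : 0 <= y * \1_(phi n @^-1` [set y]) (V w).
    rewrite indicE; case: (boolP (V w \in _)) => [|_]; last by rewrite mulr0.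
    by rewrite inE/= => <-; rewrite mulr1.
  have ynn' y w : 0 <= y * \1_(phi n @^-1` [set y]) (V' w).
    rewrite indicE; case: (boolP (V' w \in _)) => [|_]; last by rewrite mulr0.
    by rewrite inE/= => <-; rewrite mulr1.
  have E1 : (\int[P']_w (phi n (V' w))%:E = \sum_(y \in range (phi n))
      (\int[P']_w (y * \1_(phi n @^-1` [set y]) (V' w))%:E))%E.
    rewrite -ge0_integral_fsum//.
    - by apply: eq_integral => w _; rewrite fimfunE -fsumEFin.
    - by move=> y; apply/measurable_EFinP/measurable_funM.
    - by move=> y w _; rewrite lee_fin.
  have E2 : (\int[P]_w (G w * phi n (V w))%:E = \sum_(y \in range (phi n))
      (\int[P]_w (G w * (y * \1_(phi n @^-1` [set y]) (V w)))%:E))%E.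
    rewrite -ge0_integral_fsum//.
    - apply: eq_integral => w _; rewrite fimfunE mulr_fsumr//.
      by rewrite -fsumEFin.
    - by move=> y; apply/measurable_EFinP/measurable_funM => //;
        exact: measurable_funM.
    - by move=> y w _; rewrite lee_fin mulr_ge0.
  rewrite E1 E2 ge0_mule_fsumr; last first.
    by move=> y; apply: int_ge0 => w.
  apply: eq_fsbigr => y /[!inE] -[x _ <-].
  set yy := phi n x; have y0 : 0 <= yy by exact: fun_ge0.
  rewrite int_scale//.
  transitivity (\int[P]_w
      (yy * (G w * \1_(phi n @^-1` [set yy]) (V w)))%:E)%E.
    by apply: eq_integral => w _; rewrite mulrCA.
  rewrite int_scale//; last 2 first.
    by move=> w; rewrite mulr_ge0// indicE.
    exact: measurable_funM.
  rewrite H// muleCA; congr (_ * (_ * _))%E.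
  rewrite [RHS](_ : _ =
    \int[P']_w (\1_(V' @^-1` (phi n @^-1` [set yy])) w)%:E)%E//.
  by rewrite int_indic// -[X in measurable X]setTI; exact: mV'.
have ndphi x : {homo (fun n => phi n x) : n m / (n <= m)%N >-> n <= m}.
  by move=> n m nm; move/lefP: (nd_nnsfun_approx measurableT mEf nm); exact.
have cvphi x : (fun n => (phi n x)%:E) @ \oo --> (f x)%:E.
  by apply: (cvg_nnsfun_approx measurableT mEf) => // y _; rewrite lee_fin.
have c1 : (fun n => (\int[P']_w (phi n (V' w))%:E)%E) @ \oo -->
          (\int[P']_w (f (V' w))%:E)%E.
  have -> : (\int[P']_w (f (V' w))%:E =
             \int[P']_w limn (fun n => (phi n (V' w))%:E))%E.
    by apply: eq_integral => w _; apply/esym/cvg_lim => //; exact: cvphi.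
  apply: cvg_monotone_convergence => //.
  - by move=> n; exact/measurable_EFinP.
  - by move=> n w _; rewrite lee_fin.
  - by move=> w _ n m nm; rewrite lee_fin ndphi.
have c2 : (fun n => (\int[P]_w (G w * phi n (V w))%:E)%E) @ \oo -->
          (\int[P]_w (G w * f (V w))%:E)%E.
  have -> : (\int[P]_w (G w * f (V w))%:E =
             \int[P]_w limn (fun n => (G w * phi n (V w))%:E))%E.
    apply: eq_integral => w _; apply/esym/cvg_lim => //.
    rewrite EFinM; under eq_fun do rewrite EFinM.
    by apply: cvgeZl => //; exact: cvphi.
  apply: cvg_monotone_convergence => //.
  - by move=> n; exact/measurable_EFinP.
  - by move=> n w _; rewrite lee_fin mulr_ge0.
  - by move=> w _ n m nm; rewrite lee_fin ler_wpM2l// ndphi.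
apply/esym; apply: (cvg_unique _ _ c2) => //.
rewrite (_ : (fun n => _) = (fun n => k%:E * \int[P']_w (phi n (V' w))%:E)%E); last first.
  exact/funext.
by apply: cvgeZl.
Qed.

End from_indicators.

Lemma int_cst (R : realType) (d : measure_display) (T : measurableType d)
  (P : probability T R) (c : R) : (\int[P]_x c%:E = c%:E)%E.
Proof.
rewrite integral_cst// -[RHS]mule1; congr (_ * _)%E; exact: probability_setT.
Qed.

(** * Independence *)

Section independence_product.
Context (R : realType) (dO : measure_display) (Omega : measurableType dO).
Variable P : probability Omega R.
Context (I : choiceType) (dT : measure_display) (T : measurableType dT).
Variable V : I -> Omega -> T.
Hypothesis mV : forall i, measurable_fun setT (V i).
Hypothesis indV : mutually_independent P V.

Let mpre i B : measurable B -> measurable (V i @^-1` B).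
Proof. by move=> mB; rewrite -[X in measurable X]setTI; exact: mV. Qed.

(** One factor at a time moves from the indicators ([s2]) to the functions
([s1]); while [s1] is empty this is the product rule for events. *)
Let int_prod_mixed (s1 s2 : seq I) (g : I -> T -> R) (a : I -> R)
    (B : I -> set T) :
  uniq (s1 ++ s2) ->
  (forall i, measurable_fun setT (g i)) -> (forall i x, 0 <= g i x) ->
  (forall i, \int[P]_w (g i (V i w))%:E = (a i)%:E)%E ->
  (forall i, measurable (B i)) ->
  (\int[P]_w ((\prod_(i <- s1) g i (V i w)) *
              (\prod_(i <- s2) \1_(B i) (V i w)))%:E =
   ((\prod_(i <- s1) a i) * \prod_(i <- s2) fine (P (V i @^-1` B i)))%:E)%E.
Proof.
move=> us mg g0 ga; elim: s1 s2 B us => [|k s1 IH] s2 B us mB.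
  rewrite big_nil mul1r.
  have -> : (\prod_(i <- s2) fine (P (V i @^-1` B i)))%:E =
            (\prod_(i <- s2) P (V i @^-1` B i))%E.
    elim: s2 {us} => [|i s2 IH]; first by rewrite !big_nil.
    by rewrite !big_cons EFinM IH fineK// fin_num_measure//; exact: mpre.
  have -> : (\prod_(i <- s2) P (V i @^-1` B i) =
             \prod_(i <- [fset x in s2]%fset) P (V i @^-1` B i))%E.
    by apply: perm_big; apply: uniq_perm => // x; rewrite inE.
  rewrite -indV// -(int_indic P); last first.
    apply: fin_bigcap_measurable; first exact: finite_fset.
    by move=> i _; exact: mpre.
  apply: eq_integral => w _; rewrite big_nil mul1r; congr EFin.
  rewrite [RHS]indicE; case: (boolP (w \in _)) => [|].
    rewrite inE /= => H; rewrite big_seq big1// => i si.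
    by rewrite indicE mem_set//; apply: H; rewrite /= !inE.
  move=> H; have [i si Bi] : exists2 i, i \in s2 & ~ B i (V i w).
    apply: contrapT => K; move/negP: H; apply; rewrite inE/= => i /=.
    rewrite !inE => si; apply: contrapT => Bi; apply: K; by exists i.
  by rewrite (big_rem i)//= indicE memNset// mul0r.
have a0 i : 0 <= a i by rewrite -lee_fin -ga; exact: int_ge0.
have us' : uniq (s1 ++ k :: s2).
  by move: us; rewrite -cat1s -[k :: s2]cat1s uniq_catCA.
have ks2 : k \notin s2.
  by move: us'; rewrite cat_uniq /= => /and3P[_ _ /andP[]].
pose G w := (\prod_(i <- s1) g i (V i w)) * (\prod_(i <- s2) \1_(B i) (V i w)).
pose b := (\prod_(i <- s1) a i) * \prod_(i <- s2) fine (P (V i @^-1` B i)).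
transitivity (\int[P]_w (G w * g k (V k w))%:E)%E.
  by apply: eq_integral => w _; rewrite /G big_cons [in RHS]mulrC mulrA.
rewrite (@int_mul_comp_from_indic _ _ _ _ _ P P _ _ (V k) (V k) G b (g k))//.
- by rewrite ga -EFinM /b big_cons mulrC mulrA.
- apply: measurable_funM.
    by apply: measurable_prod => i _; exact: measurableT_comp.
  by apply: measurable_prod => i _; apply: measurableT_comp => //;
    exact: measurable_indicT.
- by move=> w; rewrite mulr_ge0// prodr_ge0.
- by rewrite mulr_ge0// prodr_ge0// => i _; exact: fine_ge0.
- move=> C mC; pose B' i := if i == k then C else B i.
  have B'E i : i \in s2 -> B' i = B i.
    by rewrite /B'; case: eqP => // -> H; move: ks2; rewrite H.
  have := IH (k :: s2) B' us'.
  rewrite !big_cons.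
  have -> : B' k = C by rewrite /B' eqxx.
  have -> : \prod_(i <- s2) fine (P (V i @^-1` B' i)) =
            \prod_(i <- s2) fine (P (V i @^-1` B i)).
    by apply: eq_big_seq => i si; rewrite B'E.
  move=> H; transitivity (\int[P]_w ((\prod_(i <- s1) g i (V i w)) *
     \prod_(i <- k :: s2) \1_(B' i) (V i w))%:E)%E.
    apply: eq_integral => w _; congr EFin; rewrite big_cons {1}/B' eqxx /G -mulrA.
    congr (_ * _); rewrite mulrC; congr (_ * _).
    by apply: eq_big_seq => i si; rewrite B'E.
  rewrite H.
    transitivity (b%:E * (fine (P (V k @^-1` C)))%:E)%E.
      by rewrite -EFinM; congr EFin; rewrite /b; ring.
    congr (_ * _)%E; apply: fineK; apply: fin_num_measure; exact: mpre.
  by move=> i; rewrite /B'; case: ifP.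
Qed.

Lemma int_prod_independent (s : seq I) (g : I -> T -> R) (a : I -> R) :
  uniq s ->
  (forall i, measurable_fun setT (g i)) -> (forall i x, 0 <= g i x) ->
  (forall i, \int[P]_w (g i (V i w))%:E = (a i)%:E)%E ->
  (\int[P]_w (\prod_(i <- s) g i (V i w))%:E = (\prod_(i <- s) a i)%:E)%E.
Proof.
move=> us mg g0 ga.
have := @int_prod_mixed s [::] g a (fun=> setT).
rewrite cats0 big_nil mulr1 => <-//.
by apply: eq_integral => w _; rewrite big_nil mulr1.
Qed.

End independence_product.

(** * Exponential moments *)

Section laws_and_moments.
Context (R : realType) (dO : measure_display) (Omega : measurableType dO).
Variable P : probability Omega R.

Lemma int_same_law (dT : measure_display) (T : measurableType dT)
    (V W : Omega -> T) (g : T -> R) :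
  measurable_fun setT V -> measurable_fun setT W -> same_law P V W ->
  measurable_fun setT g -> (forall x, 0 <= g x) ->
  (\int[P]_w (g (V w))%:E = \int[P]_w (g (W w))%:E)%E.
Proof.
move=> mV mW VW mg g0.
have E Z : measurable_fun setT Z ->
    (\int[P]_w (g (Z w))%:E = \int[pushforward P Z]_x (g x)%:E)%E.
  move=> mZ; rewrite ge0_integral_pushforward//.
    exact/measurable_EFinP.
  by move=> y _; rewrite lee_fin.
rewrite !E//; apply: eq_measure_integral => B mB _.
by rewrite /pushforward; exact: VW.
Qed.

(** From [1 + y <= expR y], used at [y] and at [- y]. *)
Lemma expR_le_quadratic (y : R) : expR y <= 1 + y + y ^+ 2 * expR `|y|.
Proof.
have B1 := @expR_ge1Dx R y.
have B2 := @expR_ge1Dx R (- y).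
have E : expR y * expR (- y) = 1 by rewrite -expRD subrr expR0.
have P1 := expR_gt0 y; have P2 := expR_gt0 (- y).
have [y0|y0] := ger0P y; nra.
Qed.

(** The linear term of the exponential integrates to zero, and what remains is of
order [s ^ 2] as long as [s] stays away from the end [a] of the range where the
exponential moment is finite. *)
Lemma mgf_quadratic (V : Omega -> R) (a K s : R) :
  measurable_fun setT V -> 0 < a ->
  P.-integrable setT (EFin \o V) -> (\int[P]_w (V w)%:E = 0)%E ->
  (\int[P]_w (expR (a * `|V w|))%:E <= K%:E)%E ->
  `|s| <= a / 2 ->
  (\int[P]_w (expR (s * V w))%:E <= (expR (16 * K / a ^+ 2 * s ^+ 2))%:E)%E.
Proof.
move=> mV a0 iV V0 HK sa.
have mE c : measurable_fun setT (fun w => expR (c * V w)).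
  by apply: measurableT_comp => //; exact: measurable_funM.
have mEa : measurable_fun setT (fun w => expR (a * `|V w|)).
  by apply: measurableT_comp => //; apply: measurable_funM => //;
    exact: measurableT_comp.
have pt w : expR (s * V w) <=
    1 + s * V w + 16 / a ^+ 2 * s ^+ 2 * expR (a * `|V w|).
  apply: (le_trans (expR_le_quadratic _)); rewrite lerD2l.
  have v2 : V w ^+ 2 <= 16 / a ^+ 2 * expR (a / 2 * `|V w|).
    have q : (a * `|V w|) / 4 <= expR (a * `|V w| / 4).
      by apply: le_trans (expR_ge1Dx _); lra.
    have q0 : 0 <= a * `|V w| / 4 by rewrite divr_ge0// mulr_ge0// ltW.
    have := ler_pM q0 q0 q q; rewrite -expRD => H.
    rewrite (_ : a / 2 * `|V w| = a * `|V w| / 4 + a * `|V w| / 4); last lra.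
    rewrite -mulrA [_^-1 * _]mulrC mulrA ler_pdivlMr ?exprn_gt0//.
    rewrite -(real_normK (num_real (V w))).
    by apply: le_trans (_ : 16 * (a * `|V w| / 4 * (a * `|V w| / 4)) <= _);
      [rewrite le_eqVlt; apply/orP; left; apply/eqP; field|rewrite ler_pM2l].
  have eM : expR `|s * V w| <= expR (a / 2 * `|V w|).
    by rewrite ler_expR normrM ler_wpM2r.
  have -> : expR (a * `|V w|) = expR (a / 2 * `|V w|) * expR (a / 2 * `|V w|).
    by rewrite -expRD; congr expR; field.
  rewrite exprMn.
  have -> : 16 / a ^+ 2 * s ^+ 2 * (expR (a / 2 * `|V w|) * expR (a / 2 * `|V w|)) =
    (s ^+ 2 * (16 / a ^+ 2 * expR (a / 2 * `|V w|))) * expR (a / 2 * `|V w|).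
    by ring.
  apply: ler_pM => //.
  - by apply: mulr_ge0; exact: sqr_ge0.
  - by rewrite ler_wpM2l// sqr_ge0.
have I0 : (0 <= \int[P]_w (expR (a * `|V w|))%:E)%E.
  by apply: int_ge0 => w; exact: expR_ge0.
have iEa : P.-integrable setT (EFin \o (fun w => expR (a * `|V w|))).
  apply/integrableP; split; first exact/measurable_EFinP.
  under eq_integral do rewrite /= ger0_norm ?expR_ge0//.
  exact: le_lt_trans HK (ltry _).
have K0 : 0 <= K by rewrite -lee_fin; exact: le_trans HK.
pose C := 16 / a ^+ 2 * s ^+ 2.
have C0 : 0 <= C by rewrite /C mulr_ge0 ?sqr_ge0// divr_ge0// sqr_ge0.
have i1 : P.-integrable setT (EFin \o (fun w => 1 + s * V w)).
  apply: (@integrableD _ _ _ P setT measurableT (cst 1%E)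
    (fun w => s%:E * (V w)%:E)%E).
    exact: finite_measure_integrable_cst.
  exact: integrableZl.
have i2 : P.-integrable setT (EFin \o (fun w => C * expR (a * `|V w|))).
  exact: (integrableZl measurableT C iEa).
apply: (@le_trans _ _ (\int[P]_w (1 + s * V w + C * expR (a * `|V w|))%:E)%E).
  apply: le_integral => //.
  - apply: (le_integrable measurableT _ _ (integrableD measurableT i1 i2)).
      exact/measurable_EFinP.
    move=> w _ /=; rewrite lee_fin ger0_norm ?expR_ge0//.
    by apply: le_trans (ler_norm _); exact: pt.
  - exact: (integrableD measurableT i1 i2).
  - by move=> w _; rewrite lee_fin; exact: pt.
have -> : (\int[P]_w (1 + s * V w + C * expR (a * `|V w|))%:E =
    1 + C%:E * \int[P]_w (expR (a * `|V w|))%:E)%E.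
  rewrite (integralD_EFin measurableT i1 i2); congr (_ + _)%E.
    transitivity (\int[P]_w ((1 : \bar R) + s%:E * (V w)%:E))%E => //.
    rewrite integralD//; last 2 first.
    - exact: finite_measure_integrable_cst.
    - exact: integrableZl.
    by rewrite integralZl// V0 mule0 adde0; exact: int_cst.
  by rewrite int_scale.
apply: (@le_trans _ _ (1 + C * K)%:E).
  rewrite (_ : (1 + C * K)%:E = 1 + C%:E * K%:E)%E//.
  by apply: leeD2l; apply: lee_wpmul2l; rewrite ?lee_fin.
rewrite lee_fin; apply: (le_trans (expR_ge1Dx _)).
by rewrite ler_expR le_eqVlt; apply/orP; left; apply/eqP; rewrite /C; ring.
Qed.

(** Markov's inequality for [expR (s * S)] and [expR (- s * S)] at the optimal
[s = u / (2 * C)]; the upper bound on [u] keeps this [s] in the range of the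
hypothesis. *)
Lemma chernoff_two_sided (S : Omega -> R) (n : nat) (C s0 u : R) :
  measurable_fun setT S -> 0 < C -> 0 < u -> u <= 2 * C * s0 ->
  (forall s, `|s| <= s0 ->
     (\int[P]_w (expR (s * S w))%:E <= (expR (n%:R * (C * s ^+ 2)))%:E)%E) ->
  (P [set w | (n%:R * u < `|S w|)%R] <=
    (2 * expR (- (n%:R * u ^+ 2 / (4 * C))))%:E)%E.
Proof.
move=> mS C0 u0 us H.
pose s := u / (2 * C).
have C20 : 0 < 2 * C by lra.
have s0' : 0 < s by rewrite divr_gt0.
have ss0 : s <= s0 by rewrite ler_pdivrMr// mulrC.
have mset : measurable [set w | (n%:R * u < `|S w|)%R].
  rewrite -[X in measurable X]setTI.
  have mN : measurable_fun setT (fun w => `|S w|) by exact: measurableT_comp.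
  have := mN measurableT `]n%:R * u, +oo[%classic (measurable_itv _).
  by congr measurable; apply/seteqP; split => w /=; rewrite in_itv/= andbT.
have mE c : measurable_fun setT (fun w => expR (c * S w)).
  by apply: measurableT_comp => //; exact: measurable_funM.
rewrite -int_indic//.
pose k := expR (- (s * (n%:R * u))).
have k0 : 0 <= k by exact: expR_ge0.
apply: (@le_trans _ _
  (\int[P]_w (k * (expR (s * S w) + expR (- s * S w)))%:E)%E).
  apply: int_le => //.
    by apply: measurable_funM => //; exact: measurable_funD.
  move=> w; rewrite indicE; case: (boolP (w \in _)) => [|_]; last first.
    by rewrite mulr_ge0// addr_ge0// expR_ge0.
  rewrite inE/= => H'; rewrite /k mulrDr -!expRD.
  move: H'; case: (ger0P (S w)) => Sw H'.
    apply: (@le_trans _ _ (expR (- (s * (n%:R * u)) + s * S w))); last first.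
      by rewrite lerDl expR_ge0.
    rewrite -[leLHS]expR0 ler_expR -mulrN -mulrDr; apply: mulr_ge0; first exact: ltW.
    by rewrite addrC subr_ge0 ltW.
  apply: (@le_trans _ _ (expR (- (s * (n%:R * u)) + - s * S w))); last first.
    by rewrite lerDr expR_ge0.
  rewrite -[leLHS]expR0 ler_expR mulNr -opprD -mulrDr oppr_ge0.
  apply: mulr_ge0_le0; first exact: ltW.
  lra.
rewrite int_scale//; last exact: measurable_funD.
rewrite int_add//; try by move=> w; exact: expR_ge0.
have Hs := H s; have Hns := H (- s).
rewrite normrN in Hns; rewrite gtr0_norm// in Hs Hns.
have {}Hs := Hs ss0; have {}Hns := Hns ss0.
apply: (@le_trans _ _ (k%:E * ((expR (n%:R * (C * s ^+ 2)))%:E + (expR (n%:R * (C * s ^+ 2)))%:E))%E).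
  by apply: lee_wpmul2l => //; apply: leeD => //; rewrite -[in leRHS](sqrrN s).
rewrite -EFinD -EFinM lee_fin.
rewrite (_ : k * _ = 2 * (k * expR (n%:R * (C * s ^+ 2)))); last by ring.
rewrite ler_wpM2l// /k -expRD ler_expR le_eqVlt; apply/orP; left; apply/eqP.
by rewrite /s; field; lra.
Qed.

End laws_and_moments.

(** * The Laplace distribution *)

Section laplace_moments.
Context (R : realType) (dO : measure_display) (Omega : measurableType dO).
Variable P : probability Omega R.
Local Notation leb := (@lebesgue_measure R).

Lemma laplace_pdf_ge0 (x : R) : 0 <= laplace_pdf x.
Proof. by rewrite /laplace_pdf divr_ge0// ?expR_ge0// sqrtr_ge0. Qed.

Lemma continuous_expR_normr (k : R) :
  continuous (fun x : R => expR (k * `|x|)).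
Proof.
move=> x; apply: continuous_comp; last exact: continuous_expR.
apply: cvgM; first exact: cvg_cst.
exact: norm_continuous.
Qed.

Lemma laplace_pdfE (x : R) :
  laplace_pdf x = (Num.sqrt 2)^-1 * expR (- Num.sqrt 2 * `|x|).
Proof. by rewrite /laplace_pdf mulNr mulrC. Qed.

Lemma continuous_laplace_pdf : continuous (@laplace_pdf R).
Proof.
have -> : @laplace_pdf R =
    (fun x => (Num.sqrt 2)^-1 * expR (- Num.sqrt 2 * `|x|)).
  by apply/funext => x; exact: laplace_pdfE.
move=> x; apply: cvgM; first exact: cvg_cst.
exact: continuous_expR_normr.
Qed.

Lemma measurable_laplace_pdf : measurable_fun setT (@laplace_pdf R).
Proof. exact: continuous_measurable_fun continuous_laplace_pdf. Qed.

Lemma int_laplace (Z : {RV P >-> R}) (g : R -> R) :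
  laplace_distributed Z -> measurable_fun setT g -> (forall x, 0 <= g x) ->
  (\int[P]_w (g (Z w))%:E = \int[leb]_x (laplace_pdf x * g x)%:E)%E.
Proof.
move=> lZ mg g0.
rewrite -[LHS]mul1e; apply/esym.
apply: (@int_mul_comp_from_indic _ _ _ _ _ leb P _ (R : measurableType _) idfun Z) => //.
- exact: measurable_id.
- exact: measurable_laplace_pdf.
- exact: laplace_pdf_ge0.
- move=> B mB; rewrite mul1e.
  transitivity (distribution P Z B) => //.
  rewrite lZ// [RHS]int_setE; apply: eq_integral => x _.
  by rewrite mulrC.
Qed.

Lemma sqrt2_gt1 : 1 < Num.sqrt 2 :> R.
Proof. by rewrite -[ltLHS]sqrtr1 ltr_sqrt// ltr1n. Qed.

(** The rate [sqrt 2] of the density exceeds 1: against [expR `|x|] there remains,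
on each half-line, a multiple of the exponential density of rate
[sqrt 2 - 1]. *)
Lemma laplace_exp_moment : exists K : R, forall Z : {RV P >-> R},
  laplace_distributed Z -> (\int[P]_w (expR (1 * `|Z w|))%:E <= K%:E)%E.
Proof.
pose r : R := Num.sqrt 2 - 1.
have r0 : 0 < r by rewrite subr_gt0 sqrt2_gt1.
pose k : R := (Num.sqrt 2)^-1.
have k0 : 0 <= k by rewrite invr_ge0 sqrtr_ge0.
exists (2 * (k / r)) => Z lZ.
have mexp (c : R) : measurable_fun setT (fun x : R => expR (c * `|x|)).
  exact: continuous_measurable_fun (@continuous_expR_normr c).
rewrite (@int_laplace Z (fun x => expR (1 * `|x|)))//.
have -> : (\int[leb]_x (laplace_pdf x * expR (1 * `|x|))%:E =
           \int[leb]_x (k * expR (- r * `|x|))%:E)%E.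
  apply: eq_integral => x _; congr EFin; rewrite laplace_pdfE -mulrA -expRD.
  by congr (_ * expR _); rewrite /r; ring.
rewrite ge0_symfun_integralT; last 3 first.
- by move=> x; rewrite mulr_ge0// expR_ge0.
- by move=> x; apply: cvgM; [exact: cvg_cst|exact: continuous_expR_normr].
- by move=> x /=; rewrite normrN.
rewrite EFinM; apply: lee_wpmul2l; first by rewrite lee_fin.
rewrite int_setE.
apply: (@le_trans _ _ (\int[leb]_x (k / r * exponential_pdf r x)%:E)%E).
  have r0' := ltW r0.
  apply: int_le.
  - by move=> x; rewrite mulr_ge0// mulr_ge0// expR_ge0.
  - apply: measurable_funM.
      apply: measurable_indicT; rewrite -set_itvcy; exact: measurable_itv.
    by apply: measurable_funM => //; exact: mexp.
  - by apply: measurable_funM => //; exact: measurable_exponential_pdf.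
  move=> x; rewrite indicE; case: (boolP (x \in _)) => [|_]; last first.
    rewrite mul0r mulr_ge0//; first by rewrite divr_ge0.
    exact: exponential_pdf_ge0.
  rewrite inE/= => x0; rewrite mul1r exponential_pdfE// ger0_norm//.
  by rewrite mulrA divfK ?lt0r_neq0.
rewrite int_scale//.
- by rewrite integral_exponential_pdf// mule1.
- by rewrite divr_ge0// ltW.
- by move=> x; apply: exponential_pdf_ge0; exact: ltW.
- exact: measurable_exponential_pdf.
Qed.

(** The substitution of [- x] for [x] exchanges [`|x| + x] and [`|x| - x], which
are continuous, nonnegative, and zero on a half-line. As their difference is
[2 * x], this equality says that the mean is zero. *)
Lemma laplace_symmetric (Z : {RV P >-> R}) : laplace_distributed Z ->
  (\int[P]_w (`|Z w| + Z w)%:E = \int[P]_w (`|Z w| - Z w)%:E)%E.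
Proof.
move=> lZ.
have cp : continuous (fun x : R => `|x| + x).
  by move=> x; apply: cvgD; [exact: norm_continuous|exact: cvg_id].
have cm : continuous (fun x : R => `|x| - x).
  by move=> x; apply: cvgB; [exact: norm_continuous|exact: cvg_id].
have p0 (x : R) : 0 <= `|x| + x by have := ler_norm (- x); rewrite normrN; lra.
have m0 (x : R) : 0 <= `|x| - x by have := ler_norm x; lra.
rewrite (@int_laplace Z (fun x => `|x| + x))//; last first.
  exact: continuous_measurable_fun.
rewrite (@int_laplace Z (fun x => `|x| - x))//; last first.
  exact: continuous_measurable_fun.
have sub := @ge0_integration_by_substitutionNy R
  (fun x => laplace_pdf x * (`|x| - x)) 0.
transitivity (\int[leb]_(x in `[0%R, +oo[)
   (((fun y : R => laplace_pdf y * (`|y| - y)) \o -%R) x)%:E)%E.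
  rewrite [RHS]integral_mkcond; apply: eq_integral => x _.
  rewrite patchE; case: (boolP (x \in _)).
    move=> _ /=; congr (_ * _)%:E; last by rewrite opprK normrN.
    by rewrite /laplace_pdf normrN.
  move=> /negP; rewrite inE/= in_itv/= andbT => /negP; rewrite -ltNge => x0.
  by rewrite ltr0_norm// addNr mulr0.
rewrite -sub; last 2 first.
- apply: continuous_subspaceT => x; apply: cvgM.
    exact: continuous_laplace_pdf.
  exact: cm.
- by move=> x _; rewrite mulr_ge0 ?laplace_pdf_ge0.
rewrite [LHS]integral_mkcond; apply: eq_integral => x _.
rewrite patchE; case: (boolP (x \in _)) => //.
move=> /negP; rewrite inE/= in_itv/= oppr0 => /negP; rewrite -ltNge => x0.
by rewrite gtr0_norm// subrr mulr0.
Qed.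

Lemma laplace_centred (Z : {RV P >-> R}) : laplace_distributed Z ->
  P.-integrable setT (EFin \o Z) /\ (\int[P]_w (Z w)%:E = 0)%E.
Proof.
move=> lZ; have [K HK] := laplace_exp_moment.
have iZ : P.-integrable setT (EFin \o Z).
  apply/integrableP; split; first exact/measurable_EFinP.
  apply: le_lt_trans (ltry K); apply: le_trans (HK Z lZ).
  apply: int_le => //.
  - by apply: measurableT_comp.
  - apply: measurableT_comp => //; apply: measurable_funM => //.
    exact: measurableT_comp.
  - move=> w; rewrite mul1r; apply: le_trans (expR_ge1Dx _).
    by rewrite lerDr.
have iN : P.-integrable setT (EFin \o (fun w => `|Z w|)).
  exact: (integrable_norm iZ).
have := laplace_symmetric lZ.
have -> : (\int[P]_w (`|Z w| + Z w)%:E =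
    \int[P]_w (`|Z w|)%:E + \int[P]_w (Z w)%:E)%E.
  exact: (integralD_EFin measurableT iN iZ).
have -> : (\int[P]_w (`|Z w| - Z w)%:E =
    \int[P]_w (`|Z w|)%:E - \int[P]_w (Z w)%:E)%E.
  exact: (integralB_EFin measurableT iN iZ).
have f1 := integrable_fin_num measurableT iN.
have f2 := integrable_fin_num measurableT iZ.
move: f1 f2; rewrite /comp.
case: (\int[P]_w (`|Z w|)%:E)%E => // a _.
case: (\int[P]_w (Z w)%:E)%E => // b _ H.
split=> //; case: H => H.
by congr EFin; lra.
Qed.

End laplace_moments.

(** * Concentration of averages *)

Section concentration.
Context (R : realType) (dO : measure_display) (Omega : measurableType dO).
Variable P : probability Omega R.
Context (I : choiceType) (dT : measure_display) (T : measurableType dT).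
Variables (V : I -> Omega -> T) (g : T -> R) (a K : R).
Hypothesis mV : forall i, measurable_fun setT (V i).
Hypothesis indV : mutually_independent P V.
Hypothesis mg : measurable_fun setT g.
Hypothesis a_gt0 : 0 < a.
Hypothesis intV : forall i, P.-integrable setT (EFin \o (fun w => g (V i w))).
Hypothesis V0 : forall i, (\int[P]_w (g (V i w))%:E = 0)%E.
Hypothesis HK : forall i, (\int[P]_w (expR (a * `|g (V i w)|))%:E <= K%:E)%E.

(** The injection [phi] selects the variables of one sum from a larger family, for
instance a column of a double array. *)
Lemma sum_mgf (phi : nat -> I) (n : nat) (s : R) : injective phi ->
  `|s| <= a / 2 ->
  (\int[P]_w (expR (s * \sum_(i < n) g (V (phi i) w)))%:E <=
   (expR (n%:R * (16 * K / a ^+ 2 * s ^+ 2)))%:E)%E.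
Proof.
move=> phiI sa.
have mgV i : measurable_fun setT (fun w => g (V i w)).
  exact: measurableT_comp.
have mE : measurable_fun setT (fun x => expR (s * g x)).
  by apply: measurableT_comp => //; exact: measurable_funM.
have B i := mgf_quadratic (mgV i) a_gt0 (intV i) (V0 i) (HK i) sa.
pose al i := fine (\int[P]_w (expR (s * g (V i w)))%:E)%E.
have Eal i : (\int[P]_w (expR (s * g (V i w)))%:E = (al i)%:E)%E.
  rewrite fineK// ge0_fin_numE; first exact: le_lt_trans (B i) (ltry _).
  by apply: int_ge0 => w; exact: expR_ge0.
pose sq := [seq phi i | i <- iota 0 n].
have usq : uniq sq by rewrite map_inj_uniq// iota_uniq.
have := @int_prod_independent _ _ _ P I _ _ V mV indV sq
  (fun _ x => expR (s * g x)) al usq (fun=> mE) (fun _ _ => expR_ge0 _) Eal.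
have E1 w : \prod_(i <- sq) expR (s * g (V i w)) =
    expR (s * \sum_(i < n) g (V (phi i) w)).
  rewrite /sq big_map -(big_mkord xpredT (fun i => g (V (phi i) w))).
  rewrite /index_iota subn0 mulr_sumr.
  by rewrite (big_morph expR (@expRD R) (@expR0 R)).
move=> H; rewrite (_ : (\int[P]_w _)%E = (\prod_(i <- sq) al i)%:E); last first.
  by rewrite -H; apply: eq_integral => w _; rewrite E1.
rewrite lee_fin.
apply: (@le_trans _ _ (\prod_(i <- sq) expR (16 * K / a ^+ 2 * s ^+ 2))).
  apply: ler_prod => i _; apply/andP; split.
    by rewrite -lee_fin -Eal; apply: int_ge0 => w; exact: expR_ge0.
  by rewrite -lee_fin -Eal; exact: B.
by rewrite big_const_seq count_predT size_map size_iota iter_mulr_1 -expRM_natl mulr_natl.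
Qed.

Lemma sum_concentration (phi : nat -> I) (n : nat) (u : R) : injective phi ->
  0 < K -> 0 < u -> u <= 16 * K / a ->
  (P [set w | (n%:R * u < `|\sum_(i < n) g (V (phi i) w)|)%R] <=
   (2 * expR (- (n%:R * u ^+ 2 * (a ^+ 2 / (64 * K)))))%:E)%E.
Proof.
move=> phiI K0 u0 ub.
have a2 : 0 < a ^+ 2 by rewrite exprn_gt0.
have := @chernoff_two_sided _ _ _ P (fun w => \sum_(i < n) g (V (phi i) w))
  n (16 * K / a ^+ 2) (a / 2) u.
rewrite (_ : n%:R * u ^+ 2 / _ = n%:R * u ^+ 2 * (a ^+ 2 / (64 * K))); last first.
  by field; rewrite !lt0r_neq0//; lra.
apply.
- by apply: measurable_sum => i; exact: measurableT_comp.
- by rewrite divr_gt0// mulr_gt0.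
- exact: u0.
- rewrite (_ : 2 * _ * _ = 16 * K / a)//.
  by field; rewrite lt0r_neq0.
- by move=> s sa; exact: sum_mgf.
Qed.

End concentration.

(** * Almost sure convergence and averages *)

Section almost_sure.
Context (R : realType) (dO : measure_display) (Omega : measurableType dO).
Variable P : probability Omega R.

(** The sum of the variables has a finite expectation, hence is finite almost
surely, and the terms of a convergent series tend to zero. *)
Lemma ae_cvg0_summable (G : nat -> Omega -> R) (B : R) :
  (forall n, measurable_fun setT (G n)) -> (forall n w, 0 <= G n w) ->
  (forall n, (\sum_(k < n) \int[P]_w (G k w)%:E <= B%:E)%E) ->
  {ae P, forall w, (fun n => G n w) @ \oo --> (0 : R)}.
Proof.
move=> mG G0 HB.
pose F w := (\sum_(0 <= k <oo) (G k w)%:E)%E.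
have mF : measurable_fun setT F.
  apply: ge0_emeasurable_sum => //; last by move=> k _; exact/measurable_EFinP.
  by move=> k w _ _; rewrite lee_fin.
have F0 w : (0 <= F w)%E by apply: nneseries_ge0 => k _ _; rewrite lee_fin.
have IF : (\int[P]_w F w <= B%:E)%E.
  rewrite integral_nneseries//; last 2 first.
  - by move=> k; exact/measurable_EFinP.
  - by move=> k w _; rewrite lee_fin.
  apply: lime_le.
    by apply: is_cvg_nneseries => k _ _; exact: int_ge0.
  by apply: nearW => n; rewrite /= big_mkord.
have iF : P.-integrable setT F.
  apply/integrableP; split=> //.
  under eq_integral do rewrite gee0_abs//.
  exact: le_lt_trans IF (ltry _).
have := integrable_ae measurableT iF.
apply: filterS => w /(_ I) Ffin.
apply: cvg_series_cvg_0.
apply: nondecreasing_is_cvgn.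
  by apply: nondecreasing_series => k _ _; exact: G0.
exists (fine (F w)) => _ [n _ <-].
rewrite -lee_fin fineK// /F.
rewrite /series/= -sumEFin.
apply: nneseries_lim_ge => k _ _; by rewrite lee_fin.
Qed.

Lemma sum_inv_sq_le (n : nat) : \sum_(k < n) (k.+1%:R ^- 2 : R) <= 2.
Proof.
suff : \sum_(k < n) (k.+1%:R ^- 2 : R) <= 2 - n%:R^-1.
  by move/le_trans; apply; rewrite gerBl invr_ge0.
elim: n => [|n IH]; first by rewrite big_ord0 invr0; lra.
case: n IH => [|n] IH.
  by rewrite big_ord_recr big_ord0 /= expr1n !invr1; lra.
rewrite big_ord_recr /=; apply: (le_trans (lerD IH (lexx _))).
set x : R := n.+1%:R; have x0 : 0 < x by rewrite ltr0n.
rewrite (_ : n.+2%:R = x + 1); last by rewrite -natr1.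
clearbody x.
rewrite -subr_ge0.
have -> : 2 - (x + 1)^-1 - (2 - x^-1 + (x + 1) ^- 2) = (x * (x + 1) ^+ 2)^-1.
  have x1 : 0 < x + 1 by lra.
  by field; rewrite (lt0r_neq0 x0) (lt0r_neq0 x1).
by rewrite invr_ge0 mulr_ge0// ?sqr_ge0// ltW.
Qed.

(** The inverse squares are summable, and finitely many indices have no influence
on a limit. *)
Lemma ae_cvg0_inv_sq (G : nat -> Omega -> R) (C : R) (n0 : nat) :
  (forall n, measurable_fun setT (G n)) -> (forall n w, 0 <= G n w) ->
  0 <= C ->
  (forall n, (n0 <= n)%N -> (\int[P]_w (G n w)%:E <= (C / n%:R ^+ 2)%:E)%E) ->
  {ae P, forall w, (fun n => G n w) @ \oo --> (0 : R)}.
Proof.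
move=> mG G0 C0 H.
have := @ae_cvg0_summable (fun k => G (k + n0.+1)%N) (C * 2)
  (fun k => mG _) (fun k => G0 _).
move=> A; have {A} : {ae P, forall w, (fun k => G (k + n0.+1)%N w) @ \oo --> (0 : R)}.
  apply: A => n.
  apply: (@le_trans _ _ (\sum_(k < n) (C * k.+1%:R ^- 2)%:E)%E).
    apply: lee_sum => k _; apply: (le_trans (H _ _)).
      by rewrite (leq_trans (leqnSn n0))// leq_addl.
    rewrite lee_fin ler_wpM2l// lef_pV2 ?posrE ?exprn_gt0 ?ltr0n//; last first.
      by rewrite addnS.
    by rewrite lerXn2r ?nnegrE// ler_nat addnS ltnS leq_addr.
  by rewrite sumEFin lee_fin -mulr_sumr ler_wpM2l// sum_inv_sq_le.
apply: filterS => w; by rewrite (cvg_shiftn n0.+1 (fun n => G n w)).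
Qed.

End almost_sure.

(** In the law of large numbers below, [2 ^ k] is both the number of summands and
the level at which they are truncated; this pointwise inequality makes the
variances summable as soon as the mean is finite. *)
Lemma dyadic_truncation_sum (R : realType) (x : R) (n : nat) : 0 <= x ->
  \sum_(k < n) (2 ^- k * Num.min x (2 ^+ k) ^+ 2) <= 4 * x.
Proof.
move=> x0.
(* Terms with 2 ^ k <= x form a geometric series that ends near x, the others
   one that starts near x. *)
suff : (2 ^+ n <= x -> \sum_(k < n) (2 ^- k * Num.min x (2 ^+ k) ^+ 2) <= 2 ^+ n)
  /\ (x < 2 ^+ n -> \sum_(k < n) (2 ^- k * Num.min x (2 ^+ k) ^+ 2) <=
        4 * x - 2 * (x ^+ 2 * 2 ^- n)).
  move=> [A B]; have [xn|xn] := lerP (2 ^+ n) x.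
    by apply: (le_trans (A xn)); lra.
  apply: (le_trans (B xn)); rewrite gerBl; nneg.
elim: n => [|n [IH1 IH2]].
  rewrite big_ord0 expr0 invr1; split => // x1; nra.
set q : R := 2 ^+ n in IH1 IH2 *.
have q0 : 0 < q by rewrite exprn_gt0.
have qE : 2 ^+ n.+1 = 2 * q by rewrite exprS.
rewrite qE big_ord_recr /= -/q.
have qV : q * q^-1 = 1 by rewrite divff// lt0r_neq0.
have qi : 0 < q^-1 by rewrite invr_gt0.
split=> xq.
  have qx : q <= x by lra.
  rewrite min_r//; have := IH1 qx.
  have -> : q^-1 * q ^+ 2 = q by rewrite expr2 mulrA mulVf ?mul1r ?lt0r_neq0.
  lra.
have iE : 2 * (x ^+ 2 * (2 * q)^-1) = x ^+ 2 * q^-1.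
  by rewrite invfM; field; rewrite lt0r_neq0.
rewrite iE; have [qx|qx] := lerP q x.
  have := IH1 qx.
  have -> : q^-1 * q ^+ 2 = q by rewrite expr2 mulrA mulVf ?mul1r ?lt0r_neq0.
  have : x ^+ 2 * q^-1 <= 2 * x.
    rewrite ler_pdivrMr//; nra.
  lra.
have := IH2 qx.
have -> : q^-1 * x ^+ 2 = x ^+ 2 * q^-1 by rewrite mulrC.
lra.
Qed.

Section averages.
Context (R : realType) (dO : measure_display) (Omega : measurableType dO).
Variable P : probability Omega R.
Context (dT : measure_display) (T : measurableType dT).
Variables (V : nat -> Omega -> T) (W : Omega -> T).
Hypothesis mV : forall i, measurable_fun setT (V i).
Hypothesis mW : measurable_fun setT W.
Hypothesis indV : mutually_independent P V.
Hypothesis lawV : forall i, same_law P (V i) W.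

(** Independence is available for expectations of nonnegative functions, so the
square is expanded and its negative cross term moved to the other side. *)
Lemma variance_sum_le (f : T -> R) (N : nat) (v t : R) :
  measurable_fun setT f -> (forall x, 0 <= f x) ->
  (\int[P]_w (f (W w))%:E = v%:E)%E ->
  (\int[P]_w (f (W w) ^+ 2)%:E = t%:E)%E ->
  (\int[P]_w ((\sum_(i < N) f (V i w) - N%:R * v) ^+ 2)%:E <= (N%:R * t)%:E)%E.
Proof.
move=> mf f0 Ev Et.
have mfV i : measurable_fun setT (fun w => f (V i w)) by exact: measurableT_comp.
have mS : measurable_fun setT (fun w => \sum_(i < N) f (V i w)).
  by apply: measurable_sum.
have EvV i : (\int[P]_w (f (V i w))%:E = v%:E)%E.
  by rewrite -Ev; exact: (int_same_law (mV i) mW (lawV i)).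
have mf2 : measurable_fun setT (fun x => f x ^+ 2) by exact: measurable_funX.
have EtV i : (\int[P]_w (f (V i w) ^+ 2)%:E = t%:E)%E.
  rewrite -Et; apply: (int_same_law (mV i) mW (lawV i) mf2).
  by move=> x; exact: sqr_ge0.
have v0 : 0 <= v by rewrite -lee_fin -Ev; apply: int_ge0.
have t0 : 0 <= t by rewrite -lee_fin -Et; apply: int_ge0 => w; exact: sqr_ge0.
have cross i j : (\int[P]_w (f (V i w) * f (V j w))%:E <=
    (if i == j then t + v ^+ 2 else v ^+ 2)%:E)%E.
  case: eqP => [->|/eqP ij].
    rewrite [X in (X <= _)%E](_ : _ = t%:E) ?lee_fin ?lerDl ?sqr_ge0//.
    by rewrite -(EtV j); apply: eq_integral => w _; rewrite expr2.
  have := @int_prod_independent _ _ _ P _ _ _ V mV indV [:: i; j]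
    (fun=> f) (fun=> v).
  rewrite !big_cons big_nil mulr1 -expr2 => <- //.
    apply: int_le => //.
    - by move=> w; rewrite mulr_ge0.
    - exact: measurable_funM.
    - by apply: measurable_prod => k _.
    - by move=> w; rewrite !big_cons big_nil mulr1.
  by rewrite /= inE ij.
have ES : (\int[P]_w (\sum_(i < N) f (V i w))%:E = (N%:R * v)%:E)%E.
  rewrite int_sum//; under eq_bigr do rewrite EvV.
  by rewrite sumEFin sumr_const card_ord mulr_natl.
have ES2 : (\int[P]_w ((\sum_(i < N) f (V i w)) ^+ 2)%:E <=
            (N%:R * t + N%:R ^+ 2 * v ^+ 2)%:E)%E.
  apply: (@le_trans _ _ (\sum_(i < N) \sum_(j < N)
      \int[P]_w (f (V i w) * f (V j w))%:E)%E).
    rewrite le_eqVlt; apply/orP; left; apply/eqP.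
    transitivity (\int[P]_w (\sum_(i < N) \sum_(j < N) f (V i w) * f (V j w))%:E)%E.
      apply: eq_integral => w _; rewrite expr2 big_distrlr//.
    rewrite int_sum//; last 2 first.
    - by move=> i w; apply: sumr_ge0 => j _; exact: mulr_ge0.
    - by move=> i; apply: measurable_sum => j; exact: measurable_funM.
    apply: eq_bigr => i _; rewrite int_sum//.
    - by move=> j w; exact: mulr_ge0.
    - by move=> j; exact: measurable_funM.
  apply: (@le_trans _ _ (\sum_(i < N) \sum_(j < N)
      (if (i : nat) == j then t + v ^+ 2 else v ^+ 2)%:E)%E).
    by apply: lee_sum => i _; apply: lee_sum => j _; exact: cross.
  under eq_bigr do rewrite sumEFin.
  rewrite sumEFin lee_fin.
  have inner (i : 'I_N) : \sum_(j < N) (if (i : nat) == j then t + v ^+ 2 else v ^+ 2) =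
      t + N%:R * v ^+ 2.
    transitivity (\sum_(j < N) ((if j == i then t else 0) + v ^+ 2)).
      apply: eq_bigr => j _; rewrite eq_sym -[(j : nat) == _]/(j == i).
      by case: (j == i); rewrite ?add0r.
    by rewrite big_split/= -big_mkcond big_pred1_eq sumr_const card_ord mulr_natl.
  under eq_bigr do rewrite inner.
  rewrite sumr_const card_ord -mulr_natl le_eqVlt; apply/orP; left; apply/eqP.
  by ring.
have key : (\int[P]_w ((\sum_(i < N) f (V i w) - N%:R * v) ^+ 2)%:E +
    (2 * (N%:R * v) ^+ 2)%:E <= (N%:R * t)%:E + (2 * (N%:R * v) ^+ 2)%:E)%E.
  have S0 w : 0 <= \sum_(i < N) f (V i w) by apply: sumr_ge0.
  have k0 : 0 <= 2 * (N%:R * v) by rewrite !mulr_ge0.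
  have -> : (2 * (N%:R * v) ^+ 2)%:E =
      (\int[P]_w (2 * (N%:R * v) * \sum_(i < N) f (V i w))%:E)%E.
    by rewrite int_scale// ES -EFinM; congr EFin; ring.
  rewrite -int_add//; last 4 first.
  - by move=> w; exact: sqr_ge0.
  - by move=> w; exact: mulr_ge0.
  - by apply: measurable_funX; exact: measurable_funB.
  - exact: measurable_funM.
  rewrite int_scale// ES.
  apply: (@le_trans _ _ (\int[P]_w ((\sum_(i < N) f (V i w)) ^+ 2 + (N%:R * v) ^+ 2)%:E)%E).
    rewrite le_eqVlt; apply/orP; left; apply/eqP.
    by apply: eq_integral => w _; congr EFin; ring.
  rewrite int_add//; last 3 first.
  - by move=> w; exact: sqr_ge0.
  - by move=> w; exact: sqr_ge0.
  - exact: measurable_funX.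
  rewrite (_ : \int[P]_w ((N%:R * v) ^+ 2)%:E = ((N%:R * v) ^+ 2)%:E)%E; last first.
    exact: int_cst.
  apply: (le_trans (leeD ES2 (lexx _))).
  rewrite -EFinD -EFinM -EFinD lee_fin le_eqVlt; apply/orP; left; apply/eqP.
  by ring.
by rewrite leeD2rE in key.
Qed.

(** A law of large numbers up to a factor 2. Chebyshev's inequality for the
truncation at [2 ^ k] controls the sums of length [2 ^ k], with summable error
probabilities as the mean is finite; monotonicity fills in the other lengths at
the price of the factor. *)
Lemma average_ae_bounded (g : T -> R) (v a : R) :
  measurable_fun setT g -> (forall x, 0 <= g x) -> 0 < a ->
  (\int[P]_w (g (W w))%:E = v%:E)%E ->
  {ae P, forall w, \forall n \near \oo,
    n%:R^-1 * \sum_(i < n) g (V i w) <= 2 * (v + a)}.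
Proof.
move=> mg g0 a0 Ev.
have v0 : 0 <= v by rewrite -lee_fin -Ev; apply: int_ge0.
have mgV i : measurable_fun setT (fun w => g (V i w)) by exact: measurableT_comp.
pose b k : R := 2 ^+ k.
have b0 k : 0 < b k by rewrite exprn_gt0.
pose f k x := Num.min (g x) (b k).
have f0 k x : 0 <= f k x by rewrite le_min g0 ltW.
have mf k : measurable_fun setT (f k) by exact: measurable_minr.
have fb k x : f k x <= b k by rewrite ge_min lexx orbT.
have fg k x : f k x <= g x by rewrite ge_min lexx.
have mfW k : measurable_fun setT (fun w => f k (W w)) by exact: measurableT_comp.
have mgW : measurable_fun setT (fun w => g (W w)) by exact: measurableT_comp.
have mfV k i : measurable_fun setT (fun w => f k (V i w)) by exact: measurableT_comp.
have mf2 k : measurable_fun setT (fun x => f k x ^+ 2) by exact: measurable_funX.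
have mf2W k : measurable_fun setT (fun w => f k (W w) ^+ 2).
  exact: measurable_funX.
have /choice[vb Evb] k : exists r, (\int[P]_w (f k (W w))%:E = r%:E)%E.
  exists (fine (\int[P]_w (f k (W w))%:E)%E).
  rewrite fineK// ge0_fin_numE; last exact: int_ge0.
  by apply: (@le_lt_trans _ _ v%:E) (ltry _); rewrite -Ev; apply: int_le.
have vbv k : vb k <= v by rewrite -lee_fin -Evb -Ev; apply: int_le.
have /choice[t Et] k : exists r, (\int[P]_w (f k (W w) ^+ 2)%:E = r%:E)%E.
  exists (fine (\int[P]_w (f k (W w) ^+ 2)%:E)%E).
  rewrite fineK// ge0_fin_numE; last by apply: int_ge0 => w; exact: sqr_ge0.
  apply: (@le_lt_trans _ _ (b k ^+ 2)%:E) (ltry _).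
  apply: (@le_trans _ _ (\int[P]_w (b k ^+ 2)%:E)%E).
    apply: int_le => //; first by move=> w; exact: sqr_ge0.
    by move=> w; rewrite lerXn2r ?nnegrE// ltW.
  by rewrite int_cst.
have t0 k : 0 <= t k.
  by rewrite -lee_fin -Et; apply: int_ge0 => w; exact: sqr_ge0.
pose N k := (2 ^ k)%N.
have NE k : (N k)%:R = b k :> R by rewrite /N natrX.
pose E k := [set w | b k * (v + a) < \sum_(i < N k) g (V i w)].
have mE k : measurable (E k).
  have mS : measurable_fun setT (fun w => \sum_(i < N k) g (V i w)).
    exact: measurable_sum.
  have := mS measurableT `]b k * (v + a), +oo[%classic (measurable_itv _).
  by rewrite setTI; congr measurable; apply/seteqP; split => w /=; rewrite in_itv/= andbT.
have PE k : (\int[P]_w (\1_(E k) w)%:E <= ((1 + a ^- 2) * (2 ^- k * t k))%:E)%E.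
  pose S w := \sum_(i < N k) f k (V i w).
  have mS : measurable_fun setT S by exact: measurable_sum.
  pose F1 w := b k ^- 2 * \sum_(i < N k) f k (V i w) ^+ 2.
  pose F2 w := (b k * a) ^- 2 * (S w - (N k)%:R * vb k) ^+ 2.
  have b2 : 0 <= b k ^- 2 by rewrite invr_ge0 sqr_ge0.
  have ba2 : 0 <= (b k * a) ^- 2 by rewrite invr_ge0 sqr_ge0.
  have F10 w : 0 <= F1 w.
    by rewrite mulr_ge0// sumr_ge0// => i _; exact: sqr_ge0.
  have F20 w : 0 <= F2 w by rewrite mulr_ge0// sqr_ge0.
  have mfV2 i : measurable_fun setT (fun w => f k (V i w) ^+ 2).
    exact: measurable_funX.
  have mFS : measurable_fun setT (fun w => \sum_(i < N k) f k (V i w) ^+ 2).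
    exact: measurable_sum.
  have mFB : measurable_fun setT (fun w => (S w - (N k)%:R * vb k) ^+ 2).
    by apply: measurable_funX; exact: measurable_funB.
  have mF1 : measurable_fun setT F1 by exact: measurable_funM.
  have mF2 : measurable_fun setT F2 by exact: measurable_funM.
  apply: (@le_trans _ _ (\int[P]_w (F1 w + F2 w)%:E)%E).
    apply: int_le => //; first exact: measurable_funD.
    move=> w; rewrite indicE; case: (boolP (w \in _)) => [|_]; last first.
      exact: addr_ge0.
    rewrite inE /E/= => Ew.
    have [big|small] := pselect (exists i : 'I_(N k), b k < g (V i w)).
      have [i bi] := big.
      have F11 : 1 <= F1 w.
        rewrite /F1 mulrC ler_pdivlMr ?exprn_gt0// mul1r (bigD1 i)//=.
        have -> : f k (V i w) = b k by rewrite /f min_r// ltW.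
        by rewrite lerDl sumr_ge0// => j _; exact: sqr_ge0.
      by apply: (le_trans F11); rewrite lerDl.
    have SE : S w = \sum_(i < N k) g (V i w).
      apply: eq_bigr => i _; rewrite /f min_l// leNgt; apply/negP => bi.
      by apply: small; exists i.
    have F21 : 1 <= F2 w.
      rewrite /F2 mulrC ler_pdivlMr ?exprn_gt0 ?mulr_gt0// mul1r.
      have h : b k * a <= S w - (N k)%:R * vb k.
        rewrite SE NE lerBrDr; apply: (le_trans _ (ltW Ew)).
        by rewrite mulrDr addrC lerD2r ler_pM2l.
      by rewrite lerXn2r ?nnegrE//; [rewrite mulr_ge0// ltW|apply: le_trans h; rewrite mulr_ge0// ltW].
    by apply: (le_trans F21); rewrite lerDr.
  rewrite int_add// int_scale//; last first.
    by move=> w; apply: sumr_ge0 => i _; exact: sqr_ge0.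
  rewrite int_scale//; last by move=> w; exact: sqr_ge0.
  rewrite mulrDl mul1r EFinD; apply: leeD.
    rewrite int_sum//; last by move=> i w; exact: sqr_ge0.
    rewrite (eq_bigr (fun=> (t k)%:E)); last first.
      move=> i _; rewrite -Et; apply: (int_same_law (mV i) mW (lawV i) (mf2 k)).
      by move=> x; exact: sqr_ge0.
    rewrite sumEFin sumr_const card_ord -EFinM lee_fin -[_ *+ N k]mulr_natl NE -/(b k).
    rewrite le_eqVlt; apply/orP; left; apply/eqP; field.
    by rewrite lt0r_neq0.
  apply: (@le_trans _ _ (((b k * a) ^- 2)%:E * ((N k)%:R * t k)%:E)%E).
    by apply: lee_wpmul2l => //; exact: variance_sum_le.
  rewrite -EFinM lee_fin NE -/(b k) le_eqVlt; apply/orP; left; apply/eqP.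
  by field; rewrite !lt0r_neq0.
have sumt n : \sum_(k < n) (2 ^- k * t k) <= 4 * v.
  rewrite -lee_fin -sumEFin.
  have -> : (\sum_(k < n) (2 ^- k * t k)%:E =
    \int[P]_w (\sum_(k < n) (2 ^- k * f k (W w) ^+ 2))%:E)%E.
    rewrite int_sum//; last 2 first.
    - by move=> k w; nneg.
    - by move=> k; exact: measurable_funM.
    apply: eq_bigr => k _; rewrite int_scale ?Et//.
    by move=> w; exact: sqr_ge0.
  apply: (@le_trans _ _ (\int[P]_w (4 * g (W w))%:E)%E).
    apply: int_le.
    - move=> w; apply: sumr_ge0 => k _.
      by nneg.
    - by apply: measurable_sum => k; exact: measurable_funM.
    - exact: measurable_funM.
    - by move=> w; exact: dyadic_truncation_sum.
  by rewrite int_scale// Ev.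
have := @ae_cvg0_summable _ _ _ P (fun k => \1_(E k)) ((1 + a ^- 2) * (4 * v)).
move=> H; have {H} := H (fun k => @measurable_indicT _ _ R _ (mE k)).
have ind0 k w : 0 <= \1_(E k) w :> R by rewrite indicE.
move=> /(_ ind0) H; have {}H : {ae P, forall w, \1_(E n) w @[n --> \oo] --> (0 : R)}.
  apply: H => n; apply: (@le_trans _ _ (\sum_(k < n) ((1 + a ^- 2) * (2 ^- k * t k))%:E)%E).
    by apply: lee_sum => k _; exact: PE.
  rewrite sumEFin lee_fin -mulr_sumr ler_wpM2l//.
  by rewrite addr_ge0// invr_ge0 sqr_ge0.
apply: filterS H => w Hw.
have [K _ HK] : \forall k \near \oo, ~ E k w.
  have /cvgrPdist_lt/(_ 1 ltr01) := Hw.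
  apply: filterS => k; rewrite sub0r normrN indicE.
  by case: (boolP (w \in _)) => [_|]; rewrite ?normr1 ?ltxx// notin_setE.
exists (2 ^ K)%N => // n /= Kn.
have n0 : (0 < n)%N by apply: leq_trans Kn; rewrite expn_gt0.
set k := trunc_log 2 n.
have /andP[kn nk] : (2 ^ k <= n < 2 ^ k.+1)%N.
  by apply: trunc_log_bounds.
have Kk : (K <= k.+1)%N.
  by apply: leqW; exact: trunc_log_max.
have := HK k.+1 Kk; rewrite /E/= => /negP; rewrite -leNgt => le1.
rewrite mulrC ler_pdivrMr ?ltr0n//.
apply: (@le_trans _ _ (\sum_(i < N k.+1) g (V i w))).
  rewrite -!(big_mkord xpredT (fun i => g (V i w))).
  rewrite (big_cat_nat (leq0n n) (ltnW nk))//= lerDl.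
  by apply: sumr_ge0.
apply: (le_trans le1); rewrite /b exprS -!mulrA ler_wpM2l// mulrC ler_wpM2l//.
  by rewrite addr_ge0// ltW.
by rewrite -natrX ler_nat.
Qed.

End averages.

Section averages_concentrate.
Context (R : realType) (dO : measure_display) (Omega : measurableType dO).
Variable P : probability Omega R.

(** The constants serve all columns [j] at once. The fourth moment, read off from
the moment generating function at [1 / n], measures the noise on the rare
columns whose average deviates. *)
Lemma laplace_average : exists kappa u0 C : R,
  [/\ 0 < kappa, 0 < u0 & forall eps : nat -> nat -> {RV P >-> R},
    (forall i j, laplace_distributed (eps i j)) ->
    mutually_independent P (fun ij : nat * nat => eps ij.1 ij.2) ->
    (forall j n u, 0 < u -> u <= u0 ->
      (P [set w | (n%:R * u < `|\sum_(i < n) eps i j w|)%R] <=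
       (2 * expR (- (n%:R * u ^+ 2 * kappa)))%:E)%E) /\
    (forall j n, (2 <= n)%N ->
      (\int[P]_w ((n%:R^-1 * \sum_(i < n) eps i j w) ^+ 4)%:E <= C%:E)%E)].
Proof.
have [K0 HK0] := laplace_exp_moment P.
pose K := Num.max K0 1.
have K1 : 0 < K by rewrite lt_max ltr01 orbT.
pose C := 24 * (2 * expR (16 * K)).
exists (1 ^+ 2 / (64 * K)), (16 * K / 1), C; split.
- by rewrite expr1n divr_gt0// mulr_gt0.
- by rewrite divr1 mulr_gt0.
move=> eps lap ind.
pose V (ij : nat * nat) : Omega -> R := eps ij.1 ij.2.
have mV ij : measurable_fun setT (V ij) by exact: measurable_funPT.
have iV ij := laplace_centred (lap ij.1 ij.2).
have HK ij : (\int[P]_w (expR (1 * `|V ij w|))%:E <= K%:E)%E.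
  by apply: (le_trans (HK0 _ (lap ij.1 ij.2))); rewrite lee_fin le_max lexx.
have inj (j : nat) : injective (fun i : nat => (i, j)) by move=> i i' [].
have conc j n u := @sum_concentration R _ _ P _ _ _ V idfun 1 K mV ind
  (@measurable_id _ _ setT) ltr01 (fun ij => (iV ij).1) (fun ij => (iV ij).2) HK
  (fun i => (i, j)) n u (inj j) K1.
have mgf j n s := @sum_mgf R _ _ P _ _ _ V idfun 1 K mV ind
  (@measurable_id _ _ setT) ltr01 (fun ij => (iV ij).1) (fun ij => (iV ij).2) HK
  (fun i => (i, j)) n s (inj j).
split; first by move=> j n u; exact: conc.
move=> j n n2.
have n0 : 0 < n%:R :> R by rewrite ltr0n; apply: leq_trans n2.
pose s : R := n%:R^-1.
have s0 : 0 < s by rewrite invr_gt0.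
have ss : `|s| <= 1 / 2.
  rewrite gtr0_norm// mul1r lef_pV2 ?posrE//; last by rewrite ler_nat.
pose S w := \sum_(i < n) eps i j w.
have mS : measurable_fun setT S by apply: measurable_sum => i.
have mE c : measurable_fun setT (fun w => expR (c * S w)).
  by apply: measurableT_comp => //; exact: measurable_funM.
have B c : `|c| = s -> (\int[P]_w (expR (c * S w))%:E <= (expR (16 * K))%:E)%E.
  move=> cs; apply: (le_trans (mgf j n c _)); first by rewrite cs -(gtr0_norm s0).
  rewrite lee_fin ler_expR expr1n divr1 -(real_normK (num_real c)) cs.
  rewrite mulrCA -[leRHS]mulr1 ler_wpM2l//; first by nneg.
  rewrite /s expr2 mulrA divff ?lt0r_neq0// mul1r invf_le1// ler1n.
  exact: leq_trans n2.
apply: (@le_trans _ _ (\int[P]_w (24 * (expR (s * S w) + expR (- s * S w)))%:E)%E).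
  apply: int_le.
  - by move=> w; rewrite exprn_even_ge0.
  - by apply: measurable_funX; exact: measurable_funM.
  - by apply: measurable_funM => //; exact: measurable_funD.
  move=> w; rewrite -/(S w) -/s.
  have h (x : R) : x ^+ 4 <= 24 * (expR x + expR (- x)).
    have e1 := expR_gt0 x; have e2 := expR_gt0 (- x).
    have -> : x ^+ 4 = `|x| ^+ 4 by rewrite -normrX ger0_norm// exprn_even_ge0.
    have := @expR_ge1Dxn R `|x| 3 (normr_ge0 x).
    rewrite -[(3.+1)`!%:R]/(24%:R) => e3.
    have {e3} : `|x| ^+ 4 <= 24 * expR `|x|.
      by rewrite mulrC -ler_pdivrMr//; apply: le_trans e3; rewrite lerDr.
    by case: (ger0P x) => x0 e3; apply: (le_trans e3); rewrite ler_wpM2l//; lra.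
  by rewrite mulNr; exact: h.
rewrite int_scale//; last exact: measurable_funD.
rewrite int_add// EFinM; apply: lee_wpmul2l => //.
rewrite mulr_natl mulr2n EFinD; apply: leeD; apply: B.
- by rewrite gtr0_norm.
- by rewrite normrN gtr0_norm.
Qed.

(** Hoeffding's inequality up to the constant, which depends on the bound [b]
alone and so is common to all cells of all partitions. *)
Lemma bounded_average (b : R) : 0 < b -> exists2 kappa : R, 0 < kappa &
  forall (dT : measure_display) (T : measurableType dT)
    (V : nat -> Omega -> T) (W : Omega -> T) (f : T -> R) (v : R),
  (forall i, measurable_fun setT (V i)) -> measurable_fun setT W ->
  mutually_independent P V -> (forall i, same_law P (V i) W) ->
  measurable_fun setT f -> (forall x, `|f x| <= b) ->
  (\int[P]_w (f (W w))%:E = v%:E)%E ->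
  forall n u, 0 < u -> u <= b ->
  (P [set w | (n%:R * u < `|\sum_(i < n) f (V i w) - n%:R * v|)%R] <=
     (2 * expR (- (n%:R * u ^+ 2 * kappa)))%:E)%E.
Proof.
move=> b0; pose K : R := expR 2.
have K1 : 1 <= K by rewrite -[leLHS]expR0 ler_expR.
have K0 : 0 < K by exact: expR_gt0.
exists (b^-1 ^+ 2 / (64 * K)).
  apply: divr_gt0; last exact: mulr_gt0.
  by rewrite exprn_gt0// invr_gt0.
move=> dT T V W f v mV mW ind law mf fb Ev n u u0 ub.
pose g x := f x - v.
have mg : measurable_fun setT g by exact: measurable_funB.
have ifb (Z : Omega -> T) : measurable_fun setT Z ->
    P.-integrable setT (EFin \o (fun w => f (Z w))).
  move=> mZ; apply: (@le_integrable _ _ _ P setT measurableT _ (cst b%:E)).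
  - by apply/measurable_EFinP; exact: measurableT_comp.
  - by move=> w _ /=; rewrite lee_fin (le_trans (fb _))// ler_norm.
  - exact: finite_measure_integrable_cst.
have b1 x : 0 <= f x + b by have := fb x; rewrite ler_norml; lra.
have mfb : measurable_fun setT (fun x => f x + b) by exact: measurable_funD.
have add (Z : Omega -> T) : measurable_fun setT Z ->
    (\int[P]_w (f (Z w) + b)%:E = \int[P]_w (f (Z w))%:E + b%:E)%E.
  move=> mZ; rewrite (integralD_EFin measurableT (ifb Z mZ)); last first.
    exact: finite_measure_integrable_cst.
  by congr (_ + _)%E; exact: int_cst.
have vb : `|v| <= b.
  have mfbW : measurable_fun setT (fun w => f (W w) + b).
    exact: measurableT_comp mfb mW.
  have h1 : (0 <= (v + b)%:E)%E.
    by rewrite EFinD -Ev -add//; apply: int_ge0.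
  have h2 : ((v + b)%:E <= (b + b)%:E)%E.
    rewrite EFinD -Ev -add//.
    apply: (@le_trans _ _ (\int[P]_w (b + b)%:E)%E).
      apply: int_le => //.
      by move=> w; rewrite lerD2r (le_trans _ (fb (W w)))// ler_norm.
    by rewrite int_cst.
  move: h1 h2; rewrite !lee_fin ler_norml => h1 h2.
  by apply/andP; split; lra.
have EvV i : (\int[P]_w (f (V i w))%:E = v%:E)%E.
  have := int_same_law (mV i) mW (law i) mfb b1.
  rewrite !add// Ev.
  have := integrable_fin_num measurableT (ifb _ (mV i)).
  rewrite /comp; case: (\int[P]_w (f (V i w))%:E)%E => // r _ [] H.
  by congr EFin; lra.
have gV i : P.-integrable setT (EFin \o (fun w => g (V i w))).
  apply: (@integrableB _ _ _ P setT measurableT _ (cst v%:E) (ifb _ (mV i))).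
  exact: finite_measure_integrable_cst.
have g0 i : (\int[P]_w (g (V i w))%:E = 0)%E.
  rewrite (integralB_EFin measurableT (ifb _ (mV i))); last first.
    exact: finite_measure_integrable_cst.
  rewrite [X in (X - _)%E](_ : _ = v%:E); last exact: EvV.
  by rewrite int_cst subee.
have gK i : (\int[P]_w (expR (b^-1 * `|g (V i w)|))%:E <= K%:E)%E.
  apply: (@le_trans _ _ (\int[P]_w K%:E)%E).
    apply: int_le => //.
    - apply: measurableT_comp => //; apply: measurable_funM => //.
      by apply: measurableT_comp => //; exact: (measurableT_comp mg (mV i)).
    - move=> w; rewrite ler_expR mulrC ler_pdivrMr//.
      apply: (le_trans (ler_normB _ _)).
      by have := fb (V i w); move: vb; lra.
  by rewrite int_cst.
have := @sum_concentration R _ _ P _ _ _ V g b^-1 K mV ind mg _ gV g0 gK id n u.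
rewrite invr_gt0 => /(_ b0 (fun _ _ => id) K0 u0) H.
rewrite (_ : [set w | _] = [set w | (n%:R * u < `|\sum_(i < n) g (V i w)|)%R]).
  apply: H; rewrite invrK; apply: (le_trans ub); rewrite ler_peMl//.
    exact: ltW.
  by move: K1; lra.
by apply: eq_set => w; rewrite sumrB sumr_const card_ord -[v *+ n]mulr_natl.
Qed.

End averages_concentrate.

(** * Square-integrable functions *)

Section square_integrable.
Context (R : realType) (d : measure_display) (T : measurableType d).
Variable mu : probability T R.

Lemma integrable_of_sqr (f : T -> R) : measurable_fun setT f ->
  mu.-integrable setT (fun x => (f x ^+ 2)%:E) ->
  mu.-integrable setT (EFin \o f).
Proof.
move=> mf i2.
have i1 : mu.-integrable setT (fun x => (1 + f x ^+ 2)%:E).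
  apply: (@integrableD _ _ _ mu setT measurableT (cst 1%E) _ _ i2).
  exact: finite_measure_integrable_cst.
apply: (le_integrable measurableT _ _ i1); first exact/measurable_EFinP.
move=> x _ /=; rewrite lee_fin.
rewrite [leRHS]ger0_norm; last by rewrite addr_ge0// sqr_ge0.
rewrite -(real_normK (num_real (f x))); have := sqr_ge0 (`|f x| - 1).
have := normr_ge0 (f x); nra.
Qed.

Variable f : T -> R.
Hypothesis mf : measurable_fun setT f.
Hypothesis i2 : mu.-integrable setT (fun x => (f x ^+ 2)%:E).

Lemma int_EFin_Rintegral (B : set T) (g : T -> R) : measurable B ->
  mu.-integrable setT (EFin \o g) ->
  (\int[mu]_(x in B) (g x)%:E = (\int[mu]_(x in B) g x)%:E)%E.
Proof.
move=> mB ig; rewrite /Rintegral fineK//.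
by apply: integrable_fin_num => //; exact: (integrableS measurableT).
Qed.

(** As a function of [c] this is a quadratic polynomial; that it is nonnegative
for every [c] is the form in which the Cauchy-Schwarz inequality is used. *)
Lemma int_sqr_sub (B : set T) (c : R) : measurable B ->
  (\int[mu]_(x in B) ((f x - c) ^+ 2)%:E =
   ((\int[mu]_(x in B) (f x ^+ 2)) - 2 * c * (\int[mu]_(x in B) f x)
      + c ^+ 2 * fine (mu B))%:E)%E.
Proof.
move=> mB; have i1 := integrable_of_sqr mf i2.
have i1B : mu.-integrable B (EFin \o f) by exact: (integrableS measurableT).
have i2B : mu.-integrable B (EFin \o (fun x => f x ^+ 2)).
  exact: (integrableS measurableT).
have icB r : mu.-integrable B (EFin \o cst r).
  apply: (integrableS measurableT) => //.
  exact: finite_measure_integrable_cst.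
have iZ : mu.-integrable B (EFin \o (fun x => 2 * c * f x)).
  exact: (integrableZl mB (2 * c) i1B).
have iB : mu.-integrable B (EFin \o (fun x => f x ^+ 2 - 2 * c * f x)).
  exact: (integrableB mB i2B iZ).
have iD : mu.-integrable B (EFin \o (fun x => f x ^+ 2 - 2 * c * f x + c ^+ 2)).
  exact: (integrableD mB iB (icB _)).
transitivity (\int[mu]_(x in B) (f x ^+ 2 - 2 * c * f x + c ^+ 2)%:E)%E.
  by apply: eq_integral => x _; congr EFin; ring.
transitivity (\int[mu]_(x in B) (f x ^+ 2 - 2 * c * f x + c ^+ 2))%:E.
  by rewrite /Rintegral fineK//; exact: integrable_fin_num.
congr EFin; rewrite (RintegralD mB iB (icB _)) (RintegralB mB i2B iZ).
by rewrite (RintegralZl _ mB i1B) Rintegral_cst.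
Qed.

Lemma Rintegral_sqr_sub_ge0 (B : set T) (c : R) : measurable B ->
  0 <= (\int[mu]_(x in B) (f x ^+ 2)) - 2 * c * (\int[mu]_(x in B) f x)
      + c ^+ 2 * fine (mu B).
Proof.
move=> mB; rewrite -lee_fin -int_sqr_sub//.
by apply: integral_ge0 => x _; rewrite lee_fin sqr_ge0.
Qed.

(** Absolute continuity of the integral of [f ^ 2]. *)
Lemma int_sqr_small (e : R) : 0 < e -> exists2 r, 0 < r &
  forall B, measurable B -> (mu B < r%:E)%E ->
    (\int[mu]_(x in B) (f x ^+ 2)%:E <= e%:E)%E.
Proof.
move=> e0; have [r [r0 H]] := @integral_normr_continuous _ _ _ mu
  (fun x => f x ^+ 2) i2 e e0.
exists r => // B mB Br; have := H B mB Br => /ltW.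
rewrite (int_EFin_Rintegral (g := fun x => f x ^+ 2))// lee_fin.
by congr (_ <= _); apply: eq_Rintegral => x _; rewrite ger0_norm// sqr_ge0.
Qed.

End square_integrable.

Section regression_square_integrable.
Context (R : realType) (dO : measure_display) (Omega : measurableType dO).
Variable P : probability Omega R.
Context (dT : measure_display) (T : measurableType dT).
Variables (X : {RV P >-> T}).
Local Notation mu := (distribution P X).

Lemma measurable_preRV (B : set T) : measurable B -> measurable (X @^-1` B).
Proof.
by move=> mB; rewrite -[X in measurable X]setTI; exact: (@measurable_funPT _ _ _ _ X).
Qed.

(** On a level set of [f] of height about [a], the averages of [Y] are about
[a], and the square of an average is at most the average of the squares. *)
Let int_sqr_ge1 (Y : Omega -> R) (f : T -> R) : measurable_fun setT Y ->
  P.-integrable setT (fun w => (Y w ^+ 2)%:E) ->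
  measurable_fun setT f ->
  (forall B, measurable B ->
    (\int[mu]_(x in B) (f x)%:E = \int[P]_(w in X @^-1` B) (Y w)%:E)%E) ->
  (\int[mu]_(x in [set x | (1 <= f x)%R]) (f x ^+ 2)%:E <=
   4%:E * \int[P]_w (Y w ^+ 2)%:E)%E.
Proof.
move=> mY iY2 mf H.
pose B k := [set x | k.+1%:R <= f x < k.+2%:R].
have mB k : measurable (B k).
  have := mf measurableT `[k.+1%:R, k.+2%:R[%classic (measurable_itv _).
  by rewrite setTI; congr measurable; apply/seteqP; split => x /=; rewrite in_itv.
have step k : (\int[mu]_(x in B k) (f x ^+ 2)%:E <=
    4%:E * \int[P]_(w in X @^-1` B k) (Y w ^+ 2)%:E)%E.
  set a : R := k.+1%:R; have a1 : 1 <= a by rewrite ler1n.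
  have mXB := measurable_preRV (mB k).
  pose p := fine (P (X @^-1` B k)).
  have pE : mu (B k) = p%:E by rewrite /p fineK// fin_num_measure.
  have p0 : 0 <= p by apply: fine_ge0.
  have ge := Rintegral_sqr_sub_ge0 mY iY2 a mXB.
  have iY := integrable_of_sqr mY iY2.
  have le1 : a * p <= \int[P]_(w in X @^-1` B k) Y w.
    rewrite -lee_fin -int_EFin_Rintegral// -H// EFinM -pE.
    rewrite -integral_cst//; apply: ge0_le_integral => //.
    - by move=> x _; rewrite lee_fin; lra.
    - by apply/measurable_EFinP; exact: measurable_funTS.
    - by move=> x; rewrite /B/= => /andP[h _]; rewrite lee_fin.
  have -> : (\int[P]_(w in X @^-1` B k) (Y w ^+ 2)%:E =
      (\int[P]_(w in X @^-1` B k) (Y w ^+ 2))%:E)%E.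
    exact: (int_EFin_Rintegral (g := fun w => Y w ^+ 2)).
  apply: (@le_trans _ _ (((2 * a) ^+ 2)%:E * mu (B k))%E).
    rewrite -integral_cst//; apply: ge0_le_integral => //.
    - by move=> x _; rewrite lee_fin sqr_ge0.
    - by apply/measurable_EFinP/measurable_funTS; exact: measurable_funX.
    - move=> x; rewrite /B/= => /andP[h1 h2]; rewrite lee_fin lerXn2r ?nnegrE//.
      + lra.
      + by rewrite mulr_ge0//; lra.
      + by rewrite -natr1 in h2; apply: (le_trans (ltW h2)); rewrite -/a; lra.
  by rewrite pE -!EFinM lee_fin; move: ge le1; rewrite -/p; nra.
have tB : trivIset setT B.
  apply/trivIsetP => i j _ _ ij; apply/eqP/negPn/negP => /set0P[x []].
  rewrite /B/= => /andP[i1 i2] /andP[j1 j2].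
  have := le_lt_trans i1 j2; have := le_lt_trans j1 i2.
  rewrite !ltr_nat !ltnS => h1 h2; move/eqP: ij; apply.
  by apply/eqP; rewrite eqn_leq h1 h2.
have BU : [set x | 1 <= f x] = \bigcup_k B k.
  apply/seteqP; split => x /=.
    move=> f1; have f0 : 0 <= f x by lra.
    have /andP[h1 h2] := truncn_itv f0.
    have t1 : (0 < Num.truncn (f x))%N.
      rewrite lt0n; apply/eqP => t0; move: h2; rewrite t0; lra.
    by exists (Num.truncn (f x)).-1 => //; rewrite /B/= prednK// h1 h2.
  move=> [k _]; rewrite /B/= => /andP[h _]; apply: le_trans h.
  by rewrite ler1n.
rewrite BU ge0_integral_bigcup//; last 2 first.
- by apply/measurable_EFinP/measurable_funTS; exact: measurable_funX.
- by move=> x _; rewrite lee_fin sqr_ge0.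
apply: (@le_trans _ _ (\sum_(0 <= k <oo)
    (4%:E * \int[P]_(w in X @^-1` B k) (Y w ^+ 2)%:E))%E).
  apply: lee_nneseries => k _ *; last exact: step.
  by apply: integral_ge0 => x _; rewrite lee_fin sqr_ge0.
rewrite nneseriesZl; last first.
  by move=> k _; apply: integral_ge0 => x _; rewrite lee_fin sqr_ge0.
apply: lee_wpmul2l => //.
rewrite -ge0_integral_bigcup//; last 4 first.
- by move=> k; exact: measurable_preRV.
- by apply/measurable_EFinP/measurable_funTS; exact: measurable_funX.
- by move=> x _; rewrite lee_fin sqr_ge0.
- apply/trivIsetP => i j _ _ ij.
  by rewrite -preimage_setI; move/trivIsetP: tB => ->.
apply: ge0_subset_integral => //.
- by apply: bigcup_measurable => k _; exact: measurable_preRV.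
- by apply/measurable_EFinP; exact: measurable_funX.
- by move=> x _; rewrite lee_fin sqr_ge0.
Qed.

Lemma regression_sqr_integrable (Y : {RV P >-> R}) (m : T -> R) :
  P.-integrable setT (fun w => (Y w ^+ 2)%:E) ->
  is_regression_function X Y m ->
  mu.-integrable setT (fun x => (m x ^+ 2)%:E).
Proof.
move=> iY2 [mm im H].
have mY : measurable_fun setT Y by exact: measurable_funPT.
have mm2 : measurable_fun setT (fun x => m x ^+ 2) by exact: measurable_funX.
have mmN : measurable_fun setT (fun x => - m x) by exact: measurableT_comp.
have mYN : measurable_fun setT (fun w => - Y w) by exact: measurableT_comp.
have iYN : P.-integrable setT (fun w => ((- Y w) ^+ 2)%:E).
  by under eq_fun do rewrite sqrrN.
have iY := integrable_of_sqr mY iY2.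
have HN B : measurable B ->
    (\int[mu]_(x in B) (- m x)%:E = \int[P]_(w in X @^-1` B) (- Y w)%:E)%E.
  move=> mB.
  have e1 : (\int[mu]_(x in B) (- m x)%:E = - \int[mu]_(x in B) (m x)%:E)%E.
    rewrite -integralN//; apply: integrable_add_def => //.
    exact: (integrableS measurableT).
  have e2 : (\int[P]_(x in X @^-1` B) (- Y x)%:E =
             - \int[P]_(x in X @^-1` B) (Y x)%:E)%E.
    rewrite -integralN//; apply: integrable_add_def => //.
      exact: measurable_preRV.
    by apply: (integrableS measurableT) => //; exact: measurable_preRV.
  by rewrite e1 e2 H.
have h1 := int_sqr_ge1 mY iY2 mm H.
have h2 := int_sqr_ge1 mYN iYN mmN HN.
have mS (g : T -> R) : measurable_fun setT g -> measurable [set x | 1 <= g x].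
  move=> mg; have := mg measurableT `[1, +oo[%classic (measurable_itv _).
  by rewrite setTI; congr measurable; apply/seteqP; split => x /=; rewrite in_itv/= andbT.
have fin : (\int[P]_w (Y w ^+ 2)%:E)%E \is a fin_num by exact: integrable_fin_num.
apply/integrableP; split; first exact/measurable_EFinP.
rewrite (eq_integral (fun x => (m x ^+ 2)%:E)); last first.
  by move=> x _; rewrite /= ger0_norm// sqr_ge0.
have eN : (\int[P]_w ((- Y w) ^+ 2)%:E = \int[P]_w (Y w ^+ 2)%:E)%E.
  by apply: eq_integral => w _; rewrite sqrrN.
rewrite eN in h2; rewrite int_setE in h1; rewrite int_setE in h2.
pose F1 x : R := \1_[set x | 1 <= m x] x * m x ^+ 2.
pose F2 x : R := \1_[set x | 1 <= - m x] x * (- m x) ^+ 2.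
have F10 x : 0 <= F1 x by rewrite mulr_ge0// sqr_ge0.
have F20 x : 0 <= F2 x by rewrite mulr_ge0// sqr_ge0.
have mF1 : measurable_fun setT F1.
  by apply: measurable_funM => //; apply: measurable_indicT; exact: mS.
have mF2 : measurable_fun setT F2.
  apply: measurable_funM; first by apply: measurable_indicT; exact: mS.
  exact: measurable_funX.
have le : (\int[mu]_x (m x ^+ 2)%:E <= \int[mu]_x (F1 x + F2 x + 1)%:E)%E.
  apply: int_le => //; first by move=> x; exact: sqr_ge0.
    by apply: measurable_funD => //; exact: measurable_funD.
  move=> x; rewrite /F1 /F2 sqrrN -mulrDl; have s0 := sqr_ge0 (m x).
  set a := \1_[set x | 1 <= m x] x; set b := \1_[set x | 1 <= - m x] x.
  have a0 : 0 <= a by rewrite /a indicE.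
  have b0 : 0 <= b by rewrite /b indicE.
  have [m1|m1] := lerP 1 (m x).
    have -> : a = 1 by rewrite /a indicE mem_set.
    nra.
  have [m2|m2] := lerP 1 (- m x).
    have -> : b = 1 by rewrite /b indicE mem_set.
    nra.
  have := mulr_ge0 (addr_ge0 a0 b0) s0; nra.
apply: (le_lt_trans le).
rewrite int_add//; last 2 first.
- by move=> x; rewrite addr_ge0.
- exact: measurable_funD.
rewrite int_add// int_cst.
apply: (le_lt_trans (leeD (leeD h1 h2) (lexx _))).
by rewrite -(fineK fin) -!EFinM -!EFinD ltry.
Qed.

End regression_square_integrable.

(** * Density of the uniformly continuous functions *)

Section vanishing_sets.
Context (R : realType) (d : measure_display) (T : measurableType d).
Variable mu : probability T R.

Lemma small_of_decreasing (D : nat -> set T) (e : R) : 0 < e ->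
  (forall n, measurable (D n)) -> (forall m n, (m <= n)%N -> D n `<=` D m) ->
  \bigcap_n D n = set0 -> exists n, (mu (D n) <= e%:E)%E.
Proof.
move=> e0 mD niD D0.
have cv : (mu \o D) @ \oo --> mu (\bigcap_n D n).
  apply: nonincreasing_cvg_mu => //.
  - by apply: le_lt_trans (probability_le1 mu (mD 0%N)) (ltry _).
  - by rewrite D0.
  - by move=> m n mn; apply/subsetPset; exact: niD.
rewrite D0 measure0 in cv.
have /fine_cvgP[fin cvf] := cv.
have /cvgrPdist_le/(_ _ e0) near2 := cvf.
near \oo => n; exists n.
have fn : mu (D n) \is a fin_num by exact: fin_num_measure.
rewrite -(fineK fn) lee_fin.
have : `|0 - fine (mu (D n))| <= e by near: n.
by rewrite sub0r normrN ger0_norm// fine_ge0.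
Unshelve. all: by end_near. Qed.

(** The unions of the tails of the sequence decrease to the empty set. *)
Lemma eventually_small (E : nat -> set T) (e : R) : 0 < e ->
  (forall n, measurable (E n)) -> (forall x, \forall n \near \oo, ~ E n x) ->
  \forall n \near \oo, (mu (E n) <= e%:E)%E.
Proof.
move=> e0 mE HE.
pose D n := \bigcup_(k in [set k | (n <= k)%N]) E k.
have mD n : measurable (D n) by apply: bigcup_measurable => k _.
have niD a b : (a <= b)%N -> D b `<=` D a.
  by move=> ab; apply: bigcup_subset => k /= bk; exact: leq_trans bk.
have D0 : \bigcap_n D n = set0.
  apply/seteqP; split => // x Hx; have [n _ Hn] := HE x.
  by have [k /= nk Ek] := Hx n I; apply: (Hn k).
have [n Hn] := small_of_decreasing e0 mD niD D0.
exists n => // k /= nk; apply: le_trans Hn.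
by apply: le_measure; rewrite ?inE//; exact: (bigcup_sup (i := k)).
Qed.

End vanishing_sets.

Section uniform_approximation.
Context (R : realType) (d : nat).
Implicit Types (f g : d.-tuple R -> R) (A B : set (d.-tuple R)).

Definition coordwise_uniformly_continuous g : Prop :=
  forall e, 0 < e -> exists2 r, 0 < r & forall x y : d.-tuple R,
    (forall k, `|tnth x k - tnth y k| <= r) -> `|g x - g y| <= e.

Variable mu : probability (d.-tuple R) R.

(** Approximation is in mean for sets and in mean square for functions; with
approximants between 0 and 1 the former implies the latter for indicators. *)
Definition approximable_set A : Prop := measurable A /\
  forall e, 0 < e -> exists g, [/\ measurable_fun setT g,
    coordwise_uniformly_continuous g, forall x, 0 <= g x <= 1 &
    (\int[mu]_x (`|\1_A x - g x|)%:E <= e%:E)%E].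

Definition approximable_fun f : Prop := measurable_fun setT f /\
  forall e, 0 < e -> exists g, [/\ measurable_fun setT g,
    coordwise_uniformly_continuous g &
    (\int[mu]_x ((f x - g x) ^+ 2)%:E <= e%:E)%E].

Let mabs A g : measurable A -> measurable_fun setT g ->
  measurable_fun setT (fun x => `|\1_A x - g x|).
Proof.
move=> mA mg; apply: measurableT_comp => //; apply: measurable_funB => //.
Qed.

Lemma approximable_set0 : approximable_set set0.
Proof.
split=> // e e0; exists (fun=> 0); split => //.
- by move=> r r0; exists 1 => // x y _; rewrite subrr normr0 ltW.
- by move=> x; rewrite lexx ler01.
- rewrite (eq_integral (fun=> 0%E)); first by rewrite integral0 lee_fin ltW.
  by move=> x _; rewrite indic0 subrr normr0.
Qed.

Lemma approximable_setC A : approximable_set A -> approximable_set (~` A).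
Proof.
move=> [mA H]; split; first exact: measurableC.
move=> e /H[g [mg ucg g01 ig]]; exists (fun x => 1 - g x); split => //.
- exact: measurable_funB.
- move=> r /ucg[s s0 S]; exists s => // x y /S.
  have -> : 1 - g x - (1 - g y) = - (g x - g y) by ring.
  by rewrite normrN.
- by move=> x; have := g01 x; lra.
- rewrite (eq_integral (fun x => (`|\1_A x - g x|)%:E)) => // x _.
  congr EFin; rewrite -normrN; congr Num.norm.
  rewrite !indicE in_setC; case: (x \in A) => /=; lra.
Qed.

Lemma approximable_setI A B :
  approximable_set A -> approximable_set B -> approximable_set (A `&` B).
Proof.
move=> [mA HA] [mB HB]; split; first exact: measurableI.
move=> e e0; have e2 : 0 < e / 2 by rewrite divr_gt0.
have [g [mg ug g01 ig]] := HA _ e2; have [h [mh uh h01 ih]] := HB _ e2.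
exists (fun x => g x * h x); split.
- exact: measurable_funM.
- move=> r r0; have r2 : 0 < r / 2 by rewrite divr_gt0.
  have [s s0 Hs] := ug _ r2; have [t t0 Ht] := uh _ r2.
  exists (Num.min s t); first by rewrite lt_min s0 t0.
  move=> x y xy.
  have h1 : `|g x - g y| <= r / 2.
    by apply: Hs => k; apply: (le_trans (xy k)); rewrite ge_min lexx.
  have h2 : `|h x - h y| <= r / 2.
    by apply: Ht => k; apply: (le_trans (xy k)); rewrite ge_min lexx orbT.
  have := g01 x; have := g01 y; have := h01 x; have := h01 y.
  move: h1 h2; rewrite !ler_norml; nra.
- by move=> x; have := g01 x; have := h01 x; nra.
- apply: (@le_trans _ _
    (\int[mu]_x (`|\1_A x - g x| + `|\1_B x - h x|)%:E)%E).
    apply: int_le.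
    + by move=> x; exact: normr_ge0.
    + by apply: mabs; [exact: measurableI|exact: measurable_funM].
    + by apply: measurable_funD; exact: mabs.
    move=> x; rewrite indicI/=.
    have -> : \1_A x * \1_B x - g x * h x =
      (\1_A x - g x) * \1_B x + g x * (\1_B x - h x) by ring.
    apply: (le_trans (ler_normD _ _)); rewrite !normrM; apply: lerD.
      by rewrite ler_piMr// indicE ger0_norm// lern1 leq_b1.
    by have /andP[a b] := g01 x; rewrite ler_piMl// ger0_norm.
  rewrite int_add//; try by [apply: mabs|move=> x; exact: normr_ge0].
  by rewrite [e]splitr EFinD; apply: leeD.
Qed.

Lemma approximable_bigcup (A : nat -> set (d.-tuple R)) :
  (forall k, approximable_set (A k)) -> approximable_set (\bigcup_k A k).
Proof.
move=> HA.
have mA k : measurable (A k) by have [] := HA k.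
have HU n : approximable_set (\big[setU/set0]_(i < n) A i).
  elim: n => [|n IH]; first by rewrite big_ord0; exact: approximable_set0.
  rewrite big_ord_recr/= -[X in approximable_set X]setCK setCU.
  by apply: approximable_setC; apply: approximable_setI; exact: approximable_setC.
split; first by apply: bigcup_measurable => k _.
move=> e e0; have e2 : 0 < e / 2 by rewrite divr_gt0.
pose U := \bigcup_k A k; pose F n := \big[setU/set0]_(i < n) A i.
have mU : measurable U by apply: bigcup_measurable => k _.
have mF n : measurable (F n) by have [] := HU n.
have FU n : F n `<=` U.
  by rewrite /F -bigcup_mkord; apply: bigcup_sub => k /= _; exact: bigcup_sup.
pose D n := U `\` F n.
have mD n : measurable (D n) by exact: measurableD.
have D0 : \bigcap_n D n = set0.
  apply/seteqP; split => // x H.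
  have [[k _ Ak] _] := H 0%N I.
  have [_] := H k.+1 I; apply; rewrite /F -bigcup_mkord.
  by exists k => /=.
have [n Hn] : exists n, (mu (D n) <= (e / 2)%:E)%E.
  apply: small_of_decreasing => // m n mn; apply: setDS.
  by rewrite /F -!bigcup_mkord; apply: bigcup_subset => k /= km; exact: leq_trans mn.
have [_ /(_ _ e2)[g [mg ug g01 ig]]] := HU n.
exists g; split => //.
apply: (@le_trans _ _ (\int[mu]_x (\1_(D n) x + `|\1_(F n) x - g x|)%:E)%E).
  apply: int_le.
  - by move=> x; exact: normr_ge0.
  - exact: mabs.
  - by apply: measurable_funD; [exact: measurable_indicT|exact: mabs].
  move=> x; apply: (@le_trans _ _ (`|\1_(D n) x| + `|\1_(F n) x - g x|)).
    rewrite (_ : \1_U x - g x = \1_(D n) x + (\1_(F n) x - g x)).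
      exact: ler_normD.
    rewrite addrA; congr (_ - _); rewrite !indicE /D in_setD.
    have [xF|xF] := boolP (x \in F n); last by rewrite andbT addr0.
    by rewrite andbF add0r mem_set//; apply: (FU n); rewrite -in_setE.
  by rewrite lerD2r ger0_norm.
rewrite int_add//; try by [apply: mabs|move=> x; exact: normr_ge0].
by rewrite int_indic// [e]splitr EFinD; apply: leeD.
Qed.

(** A steep ramp differs from the indicator on a thin slab along the hyperplane
only, and these slabs shrink to the empty set. *)
Lemma approximable_halfspace (k : 'I_d) (a : R) :
  approximable_set [set x | a < tnth x k].
Proof.
pose H := [set x : d.-tuple R | a < tnth x k].
have mt : measurable_fun setT (fun x : d.-tuple R => tnth x k).
  exact: measurable_tnth.
have mH : measurable H.
  have := mt measurableT `]a, +oo[%classic (measurable_itv _).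
  by rewrite setTI; congr measurable; apply/seteqP; split => x /=; rewrite in_itv/= andbT.
split=> // e e0.
pose D (n : nat) := [set x : d.-tuple R | a < tnth x k < a + n.+1%:R^-1].
have mD n : measurable (D n).
  have := mt measurableT `]a, a + n.+1%:R^-1[%classic (measurable_itv _).
  by rewrite setTI; congr measurable; apply/seteqP; split => x /=; rewrite in_itv/=.
have D0 : \bigcap_n D n = set0.
  apply/seteqP; split => // x Hx.
  have /andP[ax _] := Hx 0%N I.
  have [n /ltW an] := ltr_add_invr ax.
  by have /andP[_] := Hx n I; rewrite ltNge an.
have [n Hn] : exists n, (mu (D n) <= e%:E)%E.
  apply: small_of_decreasing => // m n mn x /andP[x1 x2]; apply/andP; split => //.
  apply: (lt_le_trans x2); rewrite lerD2l lef_pV2 ?posrE ?ltr0n//.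
  by rewrite ler_nat ltnS.
pose p : R := n.+1%:R; have p0 : 0 < p by rewrite ltr0n.
pose g x : R := Num.min 1 (Num.max 0 (p * (tnth x k - a))).
have mg : measurable_fun setT g.
  apply: measurable_minr => //; apply: measurable_maxr => //.
  by apply: measurable_funM => //; exact: measurable_funB.
exists g; split => //.
- move=> r r0; exists (r / p); first by rewrite divr_gt0.
  move=> x y /(_ k); rewrite ler_pdivlMr// mulrC => H1.
  have H2 : `|p * (tnth x k - a) - p * (tnth y k - a)| <= r.
    by rewrite -mulrBr opprB addrA subrK normrM gtr0_norm.
  apply: le_trans H2; rewrite /g.
  move: (p * (tnth x k - a)) (p * (tnth y k - a)) => u v.
  have clip (z : R) : let c := Num.min 1 (Num.max 0 z) in
      (z <= 0 /\ c = 0) \/ (0 <= z /\ z <= 1 /\ c = z) \/ (1 <= z /\ c = 1).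
    rewrite /=; have [z0|z0] := lerP z 0.
      by left; rewrite min_r.
    have [z1|z1] := lerP 1 z.
      by right; right.
    by right; left; rewrite !ltW.
  have h1 := ler_norm (u - v); have h2 := ler_norm (v - u).
  rewrite distrC in h2.
  have := clip u; have := clip v => /=.
  move: (Num.min 1 (Num.max 0 u)) (Num.min 1 (Num.max 0 v)) => cu cv.
  by move=> [[? ->]|[[? [? ->]]|[? ->]]] [[? ->]|[[? [? ->]]|[? ->]]];
    rewrite ler_norml; apply/andP; split; lra.
- move=> x; rewrite /g le_min ler01 /= ge_min lexx /= andbT.
  by rewrite le_max lexx.
- apply: le_trans Hn; rewrite -int_indic//; apply: int_le => //.
    exact: mabs.
  move=> x; rewrite !indicE.
  have [xH|xH] := boolP (x \in H).
    have {}xH : a < tnth x k by move: xH; rewrite inE.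
    have [xD|xD] := boolP (x \in D n).
      have : 0 <= g x <= 1.
        by rewrite /g le_min ler01 /= ge_min lexx /= andbT le_max lexx.
      by rewrite ler_norml/=; lra.
    have ge : a + p^-1 <= tnth x k.
      rewrite leNgt; apply/negP => lt; move/negP: xD; apply.
      by rewrite inE /D/= xH.
    have -> : g x = 1.
      rewrite /g min_l// le_max; apply/orP; right.
      by rewrite mulrC -ler_pdivrMr// mul1r lerBrDl.
    by rewrite subrr normr0.
  have le : tnth x k <= a.
    by rewrite leNgt; apply/negP => lt; move/negP: xH; apply; rewrite inE.
  have -> : g x = 0.
    rewrite /g max_l; first by rewrite min_r.
    by rewrite pmulr_rle0// subr_le0.
  by rewrite subrr normr0.
Qed.

Lemma measurable_approximable A : measurable A -> approximable_set A.
Proof.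
apply: smallest_sub A; first split.
- exact: approximable_set0.
- by move=> A HA; rewrite setTD; exact: approximable_setC.
- exact: approximable_bigcup.
move=> A; rewrite -bigcup_seq => -[k _ [B mB]]; rewrite setTI => <-{A}.
have : <<s @RGenOInfty.G R>> B.
  have mB' : (@ocitv R).-sigma.-measurable B := mB.
  by rewrite RGenOInfty.measurableE in mB'.
apply: (@smallest_sub _ (sigma_algebra setT) _
  [set B | approximable_set ((fun x : d.-tuple R => tnth x k) @^-1` B)]).
  split.
  - exact: approximable_set0.
  - by move=> C /=; rewrite setTD preimage_setC; exact: approximable_setC.
  - by move=> C HC /=; rewrite preimage_bigcup; exact: approximable_bigcup.
move=> _ [a ->] /=.
rewrite [X in approximable_set X](_ : _ = [set x | a < tnth x k]).
  exact: approximable_halfspace.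
by apply/seteqP; split => x /=; rewrite in_itv/= andbT.
Qed.

Lemma approximable_indic A : measurable A -> approximable_fun (\1_A).
Proof.
move=> mA; split; first exact: measurable_indicT.
move=> e e0; have [_ /(_ _ e0)[g [mg ug g01 ig]]] := measurable_approximable mA.
exists g; split => //; apply: le_trans ig; apply: int_le.
- by move=> x; exact: sqr_ge0.
- by apply: measurable_funX; apply: measurable_funB => //; exact: measurable_indicT.
- exact: mabs.
move=> x; rewrite -[leLHS]ger0_norm ?sqr_ge0// normrX expr2.
rewrite ler_piMl// ler_norml; have := g01 x.
by rewrite indicE; case: (x \in A) => /=; lra.
Qed.

Let sqr_add_le (a b : R) : (a + b) ^+ 2 <= 2 * a ^+ 2 + 2 * b ^+ 2.
Proof. by have := sqr_ge0 (a - b); nra. Qed.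

Lemma approximable_limit f : measurable_fun setT f ->
  (forall e, 0 < e -> exists2 f', approximable_fun f' &
    (\int[mu]_x ((f x - f' x) ^+ 2)%:E <= e%:E)%E) ->
  approximable_fun f.
Proof.
move=> mf H; split => // e e0.
have e4 : 0 < e / 4 by rewrite divr_gt0.
have [f' [mf' /(_ _ e4)[g [mg ug ig]]] iff] := H _ e4.
exists g; split => //.
have m1 : measurable_fun setT (fun x => (f x - f' x) ^+ 2).
  by apply: measurable_funX; exact: measurable_funB.
have m2 : measurable_fun setT (fun x => (f' x - g x) ^+ 2).
  by apply: measurable_funX; exact: measurable_funB.
apply: (@le_trans _ _ (\int[mu]_x (2 * (f x - f' x) ^+ 2 + 2 * (f' x - g x) ^+ 2)%:E)%E).
  apply: int_le.
  - by move=> x; exact: sqr_ge0.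
  - by apply: measurable_funX; exact: measurable_funB.
  - by apply: measurable_funD; exact: measurable_funM.
  by move=> x; rewrite -[f x - g x](subrKA (f' x)); exact: sqr_add_le.
rewrite int_add; last 4 first.
- by move=> x; rewrite mulr_ge0// sqr_ge0.
- by move=> x; rewrite mulr_ge0// sqr_ge0.
- exact: measurable_funM.
- exact: measurable_funM.
rewrite !int_scale//; try by move=> x; exact: sqr_ge0.
rewrite [leRHS](_ : _ = 2%:E * (e / 4)%:E + 2%:E * (e / 4)%:E)%E.
  by apply: leeD; apply: lee_wpmul2l.
by rewrite -!EFinM -EFinD; congr EFin; field.
Qed.

Lemma approximable_add f f' : approximable_fun f -> approximable_fun f' ->
  approximable_fun (fun x => f x + f' x).
Proof.
move=> [mf H] [mf' H']; split; first exact: measurable_funD.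
move=> e e0; have e4 : 0 < e / 4 by rewrite divr_gt0.
have [g [mg ug ig]] := H _ e4; have [g' [mg' ug' ig']] := H' _ e4.
exists (fun x => g x + g' x); split; first exact: measurable_funD.
- move=> r r0; have r2 : 0 < r / 2 by rewrite divr_gt0.
  have [s s0 Hs] := ug _ r2; have [t t0 Ht] := ug' _ r2.
  exists (Num.min s t); first by rewrite lt_min s0 t0.
  move=> x y xy; rewrite opprD addrACA [r]splitr.
  apply: (le_trans (ler_normD _ _)); apply: lerD.
    by apply: Hs => k; apply: (le_trans (xy k)); rewrite ge_min lexx.
  by apply: Ht => k; apply: (le_trans (xy k)); rewrite ge_min lexx orbT.
have m1 : measurable_fun setT (fun x => (f x - g x) ^+ 2).
  by apply: measurable_funX; exact: measurable_funB.
have m2 : measurable_fun setT (fun x => (f' x - g' x) ^+ 2).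
  by apply: measurable_funX; exact: measurable_funB.
apply: (@le_trans _ _ (\int[mu]_x (2 * (f x - g x) ^+ 2 + 2 * (f' x - g' x) ^+ 2)%:E)%E).
  apply: int_le.
  - by move=> x; exact: sqr_ge0.
  - by apply: measurable_funX; apply: measurable_funB; exact: measurable_funD.
  - by apply: measurable_funD; exact: measurable_funM.
  by move=> x; rewrite opprD addrACA; exact: sqr_add_le.
rewrite int_add; last 4 first.
- by move=> x; rewrite mulr_ge0// sqr_ge0.
- by move=> x; rewrite mulr_ge0// sqr_ge0.
- exact: measurable_funM.
- exact: measurable_funM.
rewrite !int_scale//; try by move=> x; exact: sqr_ge0.
rewrite [leRHS](_ : _ = 2%:E * (e / 4)%:E + 2%:E * (e / 4)%:E)%E.
  by apply: leeD; apply: lee_wpmul2l.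
by rewrite -!EFinM -EFinD; congr EFin; field.
Qed.

Lemma approximable_scale f (c : R) : approximable_fun f ->
  approximable_fun (fun x => c * f x).
Proof.
move=> [mf H]; split; first exact: measurable_funM.
move=> e e0.
have c1 : 0 < c ^+ 2 + 1 by rewrite ltr_wpDl// sqr_ge0.
have [g [mg ug ig]] := H _ (divr_gt0 e0 c1).
exists (fun x => c * g x); split; first exact: measurable_funM.
- move=> r r0; have cn : 0 < `|c| + 1 by rewrite ltr_wpDl.
  have [s s0 Hs] := ug _ (divr_gt0 r0 cn); exists s => // x y /Hs h.
  rewrite -mulrBr normrM; rewrite ler_pdivlMr// in h.
  by apply: le_trans h; rewrite mulrC ler_wpM2l// lerDl.
have m1 : measurable_fun setT (fun x => (f x - g x) ^+ 2).
  by apply: measurable_funX; exact: measurable_funB.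
rewrite (eq_integral (fun x => (c ^+ 2 * (f x - g x) ^+ 2)%:E)); last first.
  by move=> x _; rewrite -mulrBr exprMn.
rewrite int_scale ?sqr_ge0//; last by move=> x; exact: sqr_ge0.
apply: (@le_trans _ _ ((c ^+ 2)%:E * (e / (c ^+ 2 + 1))%:E)%E).
  by apply: lee_wpmul2l => //; rewrite lee_fin sqr_ge0.
rewrite -EFinM lee_fin mulrCA; apply: ler_piMr; first exact: ltW.
by rewrite ler_pdivrMr// mul1r lerDl.
Qed.

Lemma approximable_simple (phi : {nnsfun (d.-tuple R) >-> R}) :
  approximable_fun phi.
Proof.
have -> : (phi : d.-tuple R -> R) = (fun x => \sum_(y <- fset_set (range phi))
     y * \1_(phi @^-1` [set y]) x).
  by apply/funext => x; rewrite fimfunE fsbig_finite.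
elim: (enum_fset (fset_set (range phi))) => [|y s IH].
  under eq_fun do rewrite big_nil.
  rewrite [X in approximable_fun X](_ : _ = \1_set0).
    exact: approximable_indic.
  by apply/funext => x; rewrite indicE in_set0.
under eq_fun do rewrite big_cons.
apply: approximable_add => //; apply: approximable_scale.
exact: approximable_indic.
Qed.

Let approximable_nonneg f : measurable_fun setT f -> (forall x, 0 <= f x) ->
  mu.-integrable setT (fun x => (f x ^+ 2)%:E) -> approximable_fun f.
Proof.
move=> mf f0 i2; apply: approximable_limit => // e e0.
have mEf : measurable_fun [set: d.-tuple R] (EFin \o f) by exact/measurable_EFinP.
pose phi := nnsfun_approx (@measurableT _ _) mEf.
have phi0 n x : 0 <= phi n x by exact: fun_ge0.
have cvphi x : (fun n => (phi n x)%:E) @ \oo --> (f x)%:E.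
  by apply: (cvg_nnsfun_approx measurableT mEf) => // y _; rewrite lee_fin.
have ndphi x : {homo (fun n => phi n x) : n m / (n <= m)%N >-> n <= m}.
  by move=> n m nm; move/lefP: (nd_nnsfun_approx measurableT mEf nm); exact.
have lephi n x : phi n x <= f x.
  have /fine_cvgP[_ c1] := cvphi x.
  have /cvg_lim <- // := c1.
  apply: (@nondecreasing_cvgn_le _ (fun n => phi n x)); first exact: ndphi.
  by apply/cvg_ex; exists (f x).
have mD n : measurable_fun setT (fun x => (f x - phi n x) ^+ 2).
  by apply: measurable_funX; exact: measurable_funB.
have pt x : (fun n => ((f x - phi n x) ^+ 2)%:E) @ \oo --> 0%E.
  have c1 : (fun n => phi n x) @ \oo --> f x.
    by have /fine_cvgP[_] := cvphi x.
  have c2 : (fun n => (f x - phi n x) ^+ 2) @ \oo --> (f x - f x) ^+ 2.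
    rewrite expr2; under eq_fun do rewrite expr2.
    by apply: cvgM; apply: cvgB => //; exact: cvg_cst.
  by rewrite subrr expr0n /= in c2; apply: cvg_EFin => //; apply: nearW.
have [_ _ cv] : [/\ mu.-integrable setT (cst 0%E),
   [sequence (\int[mu]_x `|((f x - phi n x) ^+ 2)%:E - cst 0 x|)%E]_n @ \oo --> 0%E
   & [sequence (\int[mu]_x ((f x - phi n x) ^+ 2)%:E)%E]_n @ \oo -->
     (\int[mu]_x cst 0 x)%E].
  apply: (@dominated_convergence _ _ _ mu setT measurableT
    (fun n x => ((f x - phi n x) ^+ 2)%:E) (cst 0%E) (fun x => (f x ^+ 2)%:E)) => //.
  - by move=> n; apply/measurable_EFinP.
  - by apply: aeW => x _; exact: pt.
  - apply: aeW => x n _; rewrite gee0_abs ?lee_fin ?sqr_ge0//.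
    have := lephi n x; have := phi0 n x => a b.
    by rewrite lerXn2r ?nnegrE ?subr_ge0// gerBl.
rewrite integral0 in cv.
have /fine_cvgP[fin cvf] := cv.
have /cvgrPdist_le/(_ _ e0) near2 := cvf.
near \oo => n; exists (phi n); first exact: approximable_simple.
have fn : (\int[mu]_x ((f x - phi n x) ^+ 2)%:E)%E \is a fin_num by near: n.
rewrite -(fineK fn) lee_fin.
have : `|0 - fine (\int[mu]_x ((f x - phi n x) ^+ 2)%:E)%E| <= e by near: n.
by rewrite sub0r normrN; apply: le_trans; exact: ler_norm.
Unshelve. all: by end_near. Qed.

(** The sets whose indicator is approximable form a sigma-algebra that contains
the coordinate half-spaces, hence all Borel sets; simple functions, and then
monotone limits of them, follow. *)
Lemma square_integrable_approximable f : measurable_fun setT f ->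
  mu.-integrable setT (fun x => (f x ^+ 2)%:E) -> approximable_fun f.
Proof.
move=> mf i2.
have part (s : R) : `|s| = 1 -> approximable_fun (fun x => Num.max (s * f x) 0).
  move=> s1.
  have msf : measurable_fun setT (fun x => s * f x) by exact: measurable_funM.
  have mm : measurable_fun setT (fun x => Num.max (s * f x) 0).
    exact: measurable_maxr.
  apply: approximable_nonneg => //; first by move=> x; rewrite le_max lexx orbT.
  apply: (le_integrable measurableT _ _ i2).
    by apply/measurable_EFinP; exact: measurable_funX.
  move=> x _ /=; rewrite lee_fin !ger0_norm ?sqr_ge0//.
  have s2 : s ^+ 2 = 1 by rewrite -(real_normK (num_real s)) s1 expr1n.
  have [h|h] := lerP (s * f x) 0; last by rewrite exprMn s2 mul1r.
  by rewrite expr0n /= sqr_ge0.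
have -> : f = (fun x => Num.max (1 * f x) 0 + - 1 * Num.max (- 1 * f x) 0).
  apply/funext => x; rewrite mul1r !mulN1r.
  by have [h|h] := lerP (f x) 0; have [h'|h'] := lerP (- f x) 0; lra.
apply: approximable_add; first by apply: part; rewrite normr1.
by apply: approximable_scale; apply: part; rewrite normrN normr1.
Qed.

End uniform_approximation.

(** * Cubes *)

Section cubes.
Context (R : realType) (d : nat).
Implicit Types (x y p : d.-tuple R) (A : set (d.-tuple R)) (h r : R).

Lemma orthonormal_entry_le1 (U : 'M[R]_d) (k l : 'I_d) :
  U *m U^T = 1%:M -> `|U k l| <= 1.
Proof.
move=> H; have : (U *m U^T) k k = 1 by rewrite H mxE eqxx.
rewrite mxE (bigD1 l)//= !mxE -expr2 => E.
have s0 : 0 <= \sum_(i < d | i != l) U k i * U^T i k.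
  by apply: sumr_ge0 => i _; rewrite mxE -expr2 sqr_ge0.
have : `|U k l| ^+ 2 <= 1 by rewrite real_normK ?num_real//; lra.
by rewrite expr_le1.
Qed.

Lemma frame_coordB (U : 'M[R]_d) x y (k : 'I_d) :
  frame_coord U x k - frame_coord U y k =
  \sum_(l < d) U k l * (tnth x l - tnth y l).
Proof.
by rewrite /frame_coord -sumrB; apply: eq_bigr => l _; rewrite mulrBr.
Qed.

(** The factor [d] is crude, but lets every distance be measured coordinate by
coordinate. *)
Lemma frame_coord_le (U : 'M[R]_d) x y (k : 'I_d) (e : R) :
  U *m U^T = 1%:M -> (forall l, `|tnth x l - tnth y l| <= e) ->
  `|frame_coord U x k - frame_coord U y k| <= d%:R * e.
Proof.
move=> HU H; rewrite frame_coordB; apply: (le_trans (ler_norm_sum _ _ _)).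
rewrite mulr_natl -[d in leRHS]card_ord -sumr_const; apply: ler_sum => l _.
rewrite normrM -[leRHS]mul1r; apply: ler_pM => //.
exact: orthonormal_entry_le1.
Qed.

Definition frame_point (U : 'M[R]_d) (a : 'I_d -> R) : d.-tuple R :=
  [tuple \sum_(k < d) U k l * a k | l < d].

Lemma frame_pointK (U : 'M[R]_d) (a : 'I_d -> R) (k : 'I_d) :
  U *m U^T = 1%:M -> frame_coord U (frame_point U a) k = a k.
Proof.
move=> HU; rewrite /frame_coord.
under eq_bigr do rewrite tnth_mktuple mulr_sumr.
rewrite exchange_big /=.
have E (j : 'I_d) : \sum_(i < d) U k i * (U j i * a j) = (k == j)%:R * a j.
  have <- : (U *m U^T) k j = (k == j)%:R by rewrite HU mxE.
  rewrite mxE mulr_suml; apply: eq_bigr => i _.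
  by rewrite mxE mulrA.
under eq_bigr do rewrite E.
rewrite (bigD1 k)//= eqxx mul1r big1 ?addr0// => j jk.
by rewrite eq_sym (negbTE jk) mul0r.
Qed.

Lemma frame_coordK (U : 'M[R]_d) x : U *m U^T = 1%:M ->
  frame_point U (frame_coord U x) = x.
Proof.
move=> HU; have HU' := mulmx1C HU.
apply: eq_from_tnth => l; rewrite tnth_mktuple /frame_coord.
under eq_bigr do rewrite mulr_sumr.
rewrite exchange_big /=.
have E (j : 'I_d) : \sum_(k < d) U k l * (U k j * tnth x j) = (l == j)%:R * tnth x j.
  have <- : (U^T *m U) l j = (l == j)%:R by rewrite HU' mxE.
  rewrite mxE mulr_suml; apply: eq_bigr => i _.
  by rewrite mxE mulrA.
under eq_bigr do rewrite E.
rewrite (bigD1 l)//= eqxx mul1r big1 ?addr0// => j jk.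
by rewrite eq_sym (negbTE jk) mul0r.
Qed.

Lemma cube_diameter h A x y (k : 'I_d) : is_cube h A -> A x -> A y ->
  `|tnth x k - tnth y k| <= d%:R * h.
Proof.
move=> [U [a [HU _ sub]]] /sub xA /sub yA.
rewrite -(frame_coordK x HU) -(frame_coordK y HU) !tnth_mktuple -sumrB.
apply: (le_trans (ler_norm_sum _ _ _)).
rewrite mulr_natl -[d in leRHS]card_ord -sumr_const; apply: ler_sum => l _.
rewrite -mulrBr normrM -[leRHS]mul1r; apply: ler_pM => //.
  exact: orthonormal_entry_le1.
have /andP[x1 x2] := xA l; have /andP[y1 y2] := yA l.
by rewrite ler_norml; apply/andP; split; lra.
Qed.

(** A distance [h / (4 * d)] in each coordinate becomes at most [h / 4] in the
frame, less than the half-edge [h / 2]. *)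
Lemma cube_center h A : (0 < d)%N -> 0 < h -> is_cube h A -> exists p,
  forall x, (forall k, `|tnth x k - tnth p k| <= h / (4 * d%:R)) -> A x.
Proof.
move=> d0 h0 [U [a [HU sub _]]].
have d1 : 0 < d%:R :> R by rewrite ltr0n.
exists (frame_point U (fun k => a k + h / 2)) => x H.
apply: sub => k.
have := frame_coord_le k HU H; rewrite frame_pointK//.
have -> : d%:R * (h / (4 * d%:R)) = h / 4 by field; rewrite lt0r_neq0.
by rewrite ler_norml => /andP[h1 h2]; apply/andP; split; lra.
Qed.

(** A packing argument, which needs no volume of rotated cubes. Every cell
contains all points close to its center, so that two centers never lie in the
same cell of an axis-parallel grid of mesh [h / (4 * d)]; the centers of the
cells that meet the box thus inject into the cells of such a grid. *)
Lemma card_cells_meeting_box h r (A : nat -> set (d.-tuple R)) (N : nat)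
    (J : {set 'I_N}) : (0 < d)%N -> 0 < h -> h <= 1 -> 0 <= r ->
  (forall j, is_cube h (A j)) -> trivIset setT A ->
  (forall j, j \in J -> exists x, A j x /\ forall k, `|tnth x k| <= r) ->
  #|J|%:R * h ^+ d <= (8 * d%:R * (r + d%:R) + 1) ^+ d.
Proof.
move=> d0 h0 h1 r0 cA tA HJ.
have d1 : 0 < d%:R :> R by rewrite ltr0n.
have /choice[p Hp] := fun j => cube_center d0 h0 (cA j).
pose rho := h / (4 * d%:R); have rho0 : 0 < rho by rewrite divr_gt0// mulr_gt0.
pose b := r + d%:R * h; have b0 : 0 <= b by rewrite addr_ge0// mulr_ge0// ltW.
have pA j : A j (p j) by apply: Hp => k; rewrite subrr normr0 ltW.
have pb (j : 'I_N) k : j \in J -> - b <= tnth (p j) k <= b.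
  move=> /HJ[x [xA xr]]; have := cube_diameter k (cA j) (pA j) xA.
  have := xr k; rewrite !ler_norml => /andP[? ?] /andP[? ?].
  by apply/andP; split; rewrite /b; lra.
pose cell j k := Num.truncn ((tnth (p j) k + b) / rho).
pose K := (Num.truncn (2 * b / rho)).+1.
have z0 (j : 'I_N) k : j \in J -> 0 <= (tnth (p j) k + b) / rho.
  by move=> /pb - /(_ k) /andP[? ?]; rewrite divr_ge0// ?(ltW rho0)//; lra.
have cellK (j : 'I_N) k : j \in J -> (cell j k < K)%N.
  move=> jJ; rewrite ltnS /cell; apply: le_truncn.
  rewrite ler_pM2r ?invr_gt0//.
  by have /andP[? ?] := pb _ k jJ; lra.
pose F (j : 'I_N) : {ffun 'I_d -> 'I_K} := [ffun k => inord (cell j k)].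
have Finj : {in J &, injective F}.
  move=> i j iJ jJ /ffunP FE.
  have ceq k : cell i k = cell j k.
    have := FE k; rewrite !ffunE => /(congr1 val) /=.
    by rewrite !inordK ?cellK.
  have close k : `|tnth (p i) k - tnth (p j) k| <= h / (4 * d%:R).
    rewrite -/rho; have /andP[i1 i2] := truncn_itv (z0 _ k iJ).
    have /andP[j1 j2] := truncn_itv (z0 _ k jJ).
    rewrite -/(cell i k) ceq in i1 i2; rewrite -/(cell j k) in j1 j2.
    rewrite ler_pdivlMr// in i1; rewrite ler_pdivlMr// in j1.
    rewrite ltr_pdivrMr// -natr1 mulrDl mul1r in i2.
    rewrite ltr_pdivrMr// -natr1 mulrDl mul1r in j2.
    by rewrite ler_norml; apply/andP; split; lra.
  have Aj : A j (p i) by apply: Hp => k; exact: close.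
  have ij : (i : nat) = j.
    by apply: (tA i j I I); exists (p i); split.
  exact: val_inj.
have cardJ : (#|J| <= K ^ d)%N.
  rewrite -(card_in_imset Finj) -[K in (_ <= K ^ _)%N]card_ord -[d in (_ <= _ ^ d)%N]card_ord.
  by rewrite -card_ffun; exact: max_card.
apply: (@le_trans _ _ ((K%:R * h) ^+ d)).
  rewrite exprMn; apply: ler_wpM2r; first by nneg.
  by rewrite -natrX ler_nat.
rewrite lerXn2r ?nnegrE//.
- by rewrite mulr_ge0// ltW.
- by nneg.
rewrite /K -natr1 mulrDl mul1r; apply: lerD => //.
have zb : 0 <= 2 * b / rho by nneg.
have /andP[t1 _] := truncn_itv zb.
apply: (le_trans (ler_wpM2r (ltW h0) t1)).
have -> : 2 * b / rho * h = 8 * d%:R * b.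
  by rewrite /rho; field; rewrite !lt0r_neq0.
rewrite ler_wpM2l//.
by rewrite /b lerD2l; apply: ler_piMr.
Qed.

End cubes.

(** * Partitions and the error of piecewise constant functions *)

Section one_partition.
Context (R : realType) (dT : measure_display) (T : measurableType dT).
Variable mu : probability T R.
Variables (A : nat -> set T) (m : T -> R).
Hypothesis mA : forall j, measurable (A j).
Hypothesis tA : trivIset setT A.
Hypothesis mm : measurable_fun setT m.
Hypothesis i2 : mu.-integrable setT (fun x => (m x ^+ 2)%:E).

Definition cell_mass j : R := fine (mu (A j)).
Definition cell_int j : R := \int[mu]_(x in A j) m x.
Definition cell_int2 j : R := \int[mu]_(x in A j) (m x ^+ 2).
(** The squared distance in the cell between [m] and its mean over the cell; it
vanishes on a null cell, where the quotient is zero. *)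
Definition cell_variance j : R :=
  cell_int2 j - cell_int j ^+ 2 / cell_mass j.

Definition uncovered N : set T := ~` \big[setU/set0]_(j < N) A j.

Lemma measurable_uncovered N : measurable (uncovered N).
Proof. by apply: measurableC; apply: bigsetU_measurable. Qed.

Lemma cell_mass_ge0 j : 0 <= cell_mass j.
Proof. exact: fine_ge0. Qed.

Lemma cell_int2_ge0 j : 0 <= cell_int2 j.
Proof. by apply: Rintegral_ge0 => x _; exact: sqr_ge0. Qed.

Lemma cell_massE j : mu (A j) = (cell_mass j)%:E.
Proof. by rewrite fineK// fin_num_measure. Qed.

Lemma cell_int2E j : (\int[mu]_(x in A j) (m x ^+ 2)%:E = (cell_int2 j)%:E)%E.
Proof. exact: (int_EFin_Rintegral (g := fun x => m x ^+ 2)). Qed.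

Lemma cell_sqr_sub j c : (\int[mu]_(x in A j) ((m x - c) ^+ 2)%:E =
  (cell_int2 j - 2 * c * cell_int j + c ^+ 2 * cell_mass j)%:E)%E.
Proof. exact: int_sqr_sub. Qed.

Lemma cell_sqr_sub_ge0 j c :
  0 <= cell_int2 j - 2 * c * cell_int j + c ^+ 2 * cell_mass j.
Proof. exact: Rintegral_sqr_sub_ge0. Qed.

(** The mean over the cell minimises the quadratic. *)
Lemma cell_variance_le j c :
  cell_variance j <= cell_int2 j - 2 * c * cell_int j + c ^+ 2 * cell_mass j.
Proof.
rewrite /cell_variance; have := cell_mass_ge0 j; rewrite le_eqVlt.
case/orP => [/eqP p0|p0].
  rewrite -p0 invr0 !mulr0 subr0 addr0.
  (* On a null cell the integral vanishes, as the quadratic is nonnegative for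
     every constant. *)
  suff -> : cell_int j = 0 by rewrite mulr0 subr0.
  apply/eqP/negPn/negP => v0.
  have := cell_sqr_sub_ge0 j ((cell_int2 j + 1) / (2 * cell_int j)).
  rewrite -p0 mulr0 addr0 (_ : 2 * _ * _ = cell_int2 j + 1); last by field.
  lra.
rewrite -subr_ge0.
have -> : cell_int2 j - 2 * c * cell_int j + c ^+ 2 * cell_mass j -
   (cell_int2 j - cell_int j ^+ 2 / cell_mass j) =
   cell_mass j * (c - cell_int j / cell_mass j) ^+ 2.
  by field; rewrite lt0r_neq0.
by rewrite mulr_ge0 ?sqr_ge0// ltW.
Qed.

Lemma cell_variance_ge0 j : 0 <= cell_variance j.
Proof.
have := cell_sqr_sub_ge0 j (cell_int j / cell_mass j).
have := cell_mass_ge0 j; rewrite le_eqVlt => /orP[/eqP p0|p0].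
  by rewrite -p0 invr0 !mulr0 mul0r subr0 addr0 /cell_variance -p0 invr0 mulr0 subr0.
have -> // : cell_int2 j - 2 * (cell_int j / cell_mass j) * cell_int j +
   (cell_int j / cell_mass j) ^+ 2 * cell_mass j = cell_variance j.
by rewrite /cell_variance; field; rewrite lt0r_neq0.
Qed.

Lemma sum_int_cells (N : nat) (g : T -> R) (J : pred nat) :
  measurable_fun setT g -> (forall x, 0 <= g x) ->
  (\sum_(j < N | J j) \int[mu]_(x in A j) (g x)%:E =
   \int[mu]_(x in \big[setU/set0]_(j < N | J j) A j) (g x)%:E)%E.
Proof.
move=> mg g0.
rewrite -(big_mkord J (fun j => \int[mu]_(x in A j) (g x)%:E)%E).
rewrite -(big_mkord J A) -!(big_filter _ J).
rewrite ge0_integral_bigsetU//.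
- by rewrite filter_uniq// iota_uniq.
- by apply: sub_trivIset tA.
- by apply/measurable_EFinP; exact: measurable_funTS.
- by move=> x _; rewrite lee_fin.
Qed.

Lemma sum_int_all_cells (N : nat) (g : T -> R) :
  measurable_fun setT g -> (forall x, 0 <= g x) ->
  (\sum_(j < N) \int[mu]_(x in A j) (g x)%:E =
   \int[mu]_(x in \big[setU/set0]_(j < N) A j) (g x)%:E)%E.
Proof. exact: (@sum_int_cells N g xpredT). Qed.

Lemma measurable_bigcells (N : nat) (J : pred nat) :
  measurable (\big[setU/set0]_(j < N | J j) A j).
Proof. by apply: bigsetU_measurable. Qed.

Lemma sum_int_cells_le (N : nat) (g : T -> R) :
  measurable_fun setT g -> (forall x, 0 <= g x) ->
  (\sum_(j < N) \int[mu]_(x in A j) (g x)%:E <= \int[mu]_x (g x)%:E)%E.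
Proof.
move=> mg g0; rewrite sum_int_all_cells//; apply: ge0_subset_integral => //.
- exact: bigsetU_measurable.
- exact/measurable_EFinP.
- by move=> x _; rewrite lee_fin.
Qed.

Lemma sum_cell_mass_le (N : nat) : \sum_(j < N) cell_mass j <= 1.
Proof.
rewrite -lee_fin -sumEFin.
apply: (@le_trans _ _ (\int[mu]_x (1 : R)%:E)%E); last by rewrite int_cst.
apply: (le_trans _ (@sum_int_cells_le N (fun=> 1) _ _)) => //.
apply: lee_sum => j _; rewrite integral_cst// mul1e -cell_massE; exact: lexx.
Qed.

(** An estimate that is constant on cells enters its error only through finitely
many values, one quadratic polynomial for each cell; all that is random in the
error is in these values. *)
Lemma int_sqr_sub_cells (N : nat) (q : nat -> R) :
  \bigcup_j A j = setT -> (forall j, (N <= j)%N -> q j = 0) ->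
  (\int[mu]_x ((m x - q (xget 0%N [set j | A j x])) ^+ 2)%:E =
   \int[mu]_(x in uncovered N) (m x ^+ 2)%:E +
   (\sum_(j < N) (cell_int2 j - 2 * q j * cell_int j +
                  q j ^+ 2 * cell_mass j))%:E)%E.
Proof.
move=> covA q0.
pose idx x := xget 0%N [set j | A j x].
have idxP x : A (idx x) x.
  have [j _ Aj] : (\bigcup_j A j) x by rewrite covA.
  exact: (@xgetPex _ 0%N [set j | A j x] (ex_intro _ j Aj)).
have idxE j x : A j x -> idx x = j.
  by move=> Aj; apply: (tA I I); exists x; split => //; exact: idxP.
have mi : measurable_fun setT (fun x => q (idx x)).
  move=> _ B mB; rewrite setTI.
  have -> : (fun x => q (idx x)) @^-1` B =
      \bigcup_(j in [set j | B (q j)]) A j.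
    apply/seteqP; split => x /=.
      by move=> Bq; exists (idx x).
    by move=> [j /= Bj Aj]; rewrite (idxE _ _ Aj).
  exact: bigcup_measurable.
have mF : measurable_fun setT (fun x => (m x - q (idx x)) ^+ 2).
  by apply: measurable_funX; exact: measurable_funB.
rewrite -(setvU (\big[setU/set0]_(j < N) A j)) ge0_integral_setU//; last 5 first.
- exact: measurable_uncovered.
- exact: bigsetU_measurable.
- by apply/measurable_EFinP; exact: measurable_funTS.
- by move=> x _; rewrite lee_fin sqr_ge0.
- by apply/disj_set2P; rewrite setICl.
congr (_ + _)%E.
  apply: eq_integral => x; rewrite inE => Ux; rewrite -/(idx x) q0 ?subr0//.
  rewrite leqNgt; apply/negP => lt; apply: Ux.
  by rewrite -bigcup_mkord; exists (idx x).
rewrite -(sum_int_all_cells N mF); last by move=> x; exact: sqr_ge0.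
rewrite -sumEFin; apply: eq_bigr => j _; rewrite -cell_sqr_sub.
by apply: eq_integral => x; rewrite inE => Ax; rewrite -/(idx x) (idxE _ _ Ax).
Qed.

End one_partition.

Section partition_sequence.
Context (R : realType) (d : nat).
Variable mu : probability (d.-tuple R) R.
Variables (A : nat -> nat -> set (d.-tuple R)) (m : d.-tuple R -> R).
Variables (h : nat -> R) (N : nat -> nat).
Hypothesis d_gt0 : (0 < d)%N.
Hypothesis mA : forall n j, measurable (A n j).
Hypothesis tA : forall n, trivIset setT (A n).
Hypothesis cubeA : forall n j, is_cube (h n) (A n j).
Hypothesis h_gt0 : forall n, 0 < h n.
Hypothesis h_cvg : h @ \oo --> 0.
Hypothesis mm : measurable_fun setT m.
Hypothesis i2 : mu.-integrable setT (fun x => (m x ^+ 2)%:E).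

(** The cell means are the best approximation of [m] by a function constant on
cells, so they do at least as well as the values, at one point of each cell, of
a uniformly continuous function close to [m]. *)
Lemma sum_cell_variance_cvg0 (e : R) : 0 < e -> \forall n \near \oo,
  \sum_(j < N n) cell_variance mu (A n) m j <= e.
Proof.
move=> e0; have e4 : 0 < e / 4 by rewrite divr_gt0.
have [_ /(_ _ e4)[g [mg ug ig]]] := square_integrable_approximable mm i2.
pose s := Num.sqrt (e / 4); have s0 : 0 < s by rewrite sqrtr_gt0.
have s2 : s ^+ 2 = e / 4 by rewrite sqr_sqrtr// ltW.
have [r r0 Hr] := ug _ s0.
have d1 : 0 < d%:R :> R by rewrite ltr0n.
near=> n.
have hn : d%:R * h n <= r.
  have : `|0 - h n| <= r / d%:R.
    near: n; move/cvgrPdist_le: h_cvg; apply; exact: divr_gt0.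
  by rewrite sub0r normrN gtr0_norm// ler_pdivlMr// mulrC.
have /choice[c Hc] j : exists c, forall x, A n j x -> `|g x - c| <= s.
  have [p Hp] := cube_center d_gt0 (h_gt0 n) (cubeA n j).
  exists (g p) => x Ax; apply: Hr => k; apply: le_trans hn.
  apply: (cube_diameter k (cubeA n j)) => //; apply: Hp => l.
  by rewrite subrr normr0 divr_ge0// ?mulr_ge0// ltW.
have mD : measurable_fun setT (fun x => (m x - g x) ^+ 2).
  by apply: measurable_funX; exact: measurable_funB.
rewrite -lee_fin -sumEFin.
apply: (@le_trans _ _ (\sum_(j < N n) \int[mu]_(x in A n j)
    (2 * (m x - g x) ^+ 2 + 2 * s ^+ 2)%:E)%E).
  apply: lee_sum => j _.
  apply: (@le_trans _ _ (\int[mu]_(x in A n j) ((m x - c j) ^+ 2)%:E)%E).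
    rewrite (cell_sqr_sub (mA n) mm i2) lee_fin.
    exact: (cell_variance_le (mA n) mm i2).
  apply: ge0_le_integral => //.
  - by move=> x _; rewrite lee_fin sqr_ge0.
  - apply/measurable_EFinP/measurable_funTS.
    by apply: measurable_funX; exact: measurable_funB.
  - apply/measurable_EFinP/measurable_funTS.
    by apply: measurable_funD => //; exact: measurable_funM.
  move=> x Ax; rewrite lee_fin.
  have := Hc j x Ax; rewrite ler_norml => /andP[a b].
  have : (g x - c j) ^+ 2 <= s ^+ 2 by nra.
  have := sqr_ge0 ((m x - g x) - (g x - c j)); nra.
pose G x := 2 * (m x - g x) ^+ 2 + 2 * s ^+ 2.
have := @sum_int_cells_le _ _ _ mu (A n) (mA n) (@tA n) (N n) G.
move=> /(_ _ _)/le_trans; apply.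
- by apply: measurable_funD => //; exact: measurable_funM.
- by move=> x; rewrite addr_ge0// mulr_ge0// sqr_ge0.
rewrite int_add//; last 3 first.
- by move=> x; rewrite mulr_ge0// sqr_ge0.
- by move=> x; rewrite mulr_ge0// sqr_ge0.
- exact: measurable_funM.
rewrite int_scale//; last by move=> x; exact: sqr_ge0.
rewrite int_cst s2.
apply: (@le_trans _ _ (2%:E * (e / 4)%:E + (2 * (e / 4))%:E)%E).
  by apply: leeD => //; apply: lee_wpmul2l.
by rewrite -EFinM -EFinD lee_fin; lra.
Unshelve. all: by end_near. Qed.

Lemma int_uncovered_cvg0 (e : R) : 0 < e ->
  (forall x, \forall n \near \oo, exists2 j, (j < N n)%N & A n j x) ->
  \forall n \near \oo,
    (\int[mu]_(x in uncovered (A n) (N n)) (m x ^+ 2)%:E <= e%:E)%E.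
Proof.
move=> e0 cov; have [r r0 Hr] := int_sqr_small i2 e0.
have r2 : 0 < r / 2 by rewrite divr_gt0.
have mU n := measurable_uncovered (mA n) (N n).
have := @eventually_small _ _ _ mu (fun n => uncovered (A n) (N n)) _ r2 mU.
move=> H; apply: filterS (H _) => [n le|x].
  apply: Hr => //; apply: (le_lt_trans le); rewrite lte_fin; lra.
apply: filterS (cov x) => n [j jN Aj]; apply; rewrite -bigcup_mkord.
by exists j.
Qed.

(** Cells of mass at most a small multiple of their volume carry little: by the
packing bound those that meet a large box have small total mass, and outside
the box there is little mass anyway. *)
Lemma int_light_cells_cvg0 (c : nat -> R) (e : R) : 0 < e ->
  (forall n, 0 < c n) -> c @ \oo --> 0 ->
  \forall n \near \oo, \sum_(j < N n | cell_mass mu (A n) j <= 2 * (c n * h n ^+ d))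
    cell_int2 mu (A n) m j <= e.
Proof.
move=> e0 c_gt0 c_cvg; have [r r0 Hr] := int_sqr_small i2 e0.
have r4 : 0 < r / 4 by rewrite divr_gt0.
pose out (n : nat) := [set x : d.-tuple R | exists k, n%:R < `|tnth x k|].
have mout n : measurable (out n).
  have -> : out n = \bigcup_(k in [set: 'I_d]) [set x | n%:R < `|tnth x k|].
    by apply/seteqP; split => x /= [k]; [exists k|move=> _ ?; exists k].
  apply: fin_bigcup_measurable; first exact: finite_finset.
  move=> k _; have mt : measurable_fun setT (fun x : d.-tuple R => `|tnth x k|).
    by apply: measurableT_comp => //; exact: measurable_tnth.
  have := mt measurableT `]n%:R, +oo[%classic (measurable_itv _).
  by rewrite setTI; congr measurable; apply/seteqP; split => x /=; rewrite in_itv/= andbT.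
have out0 x : \forall n \near \oo, ~ out n x.
  pose b := \sum_(k < d) `|tnth x k|.
  have b0 : 0 <= b by exact: sumr_ge0.
  exists (Num.truncn b).+1 => // n /= bn [k].
  apply/negP; rewrite -leNgt.
  have /andP[_ /ltW b1] := truncn_itv b0.
  apply: (@le_trans _ _ b); first by rewrite /b (bigD1 k)//= lerDl sumr_ge0.
  by apply: (le_trans b1); rewrite ler_nat.
have [n0 _ /(_ _ (leqnn _)) Hn0] := eventually_small mu r4 mout out0.
pose C : R := (8 * d%:R * (n0%:R + d%:R) + 1) ^+ d.
have C0 : 0 < C by rewrite exprn_gt0// ltr_wpDl// mulr_ge0// addr_ge0.
near=> n.
have hn1 : h n <= 1.
  have : `|0 - h n| <= 1 by near: n; move/cvgrPdist_le: h_cvg; exact.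
  by rewrite sub0r normrN gtr0_norm.
have cn : C * (2 * c n) <= r / 4.
  have : `|0 - c n| <= r / 4 / (2 * C).
    by near: n; move/cvgrPdist_le: c_cvg; apply; rewrite divr_gt0// mulr_gt0.
  rewrite sub0r normrN gtr0_norm// ler_pdivlMr ?mulr_gt0//; lra.
pose t := c n * h n ^+ d.
pose light j := cell_mass mu (A n) j <= 2 * t.
pose B := \big[setU/set0]_(j < N n | light j) A n j.
have mB : measurable B by exact: measurable_bigcells.
have -> : \sum_(j < N n | cell_mass mu (A n) j <= 2 * (c n * h n ^+ d))
    cell_int2 mu (A n) m j = \sum_(j < N n | light j) cell_int2 mu (A n) m j by [].
rewrite -lee_fin -sumEFin.
under eq_bigr do rewrite -(cell_int2E (mA n) i2).
have mm2 : measurable_fun setT (fun x => m x ^+ 2) by exact: measurable_funX.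
rewrite (@sum_int_cells _ _ _ mu (A n) (mA n) (@tA n) (N n) (fun x => m x ^+ 2) light)//;
  last by move=> x; exact: sqr_ge0.
apply: Hr => //; rewrite -/B.
pose inJ j := light j && `[< exists x, A n j x /\ forall k, `|tnth x k| <= n0%:R >].
pose J : {set 'I_(N n)} := [set j : 'I_(N n) | inJ j]%SET.
have sub : B `<=` out n0 `|` \big[setU/set0]_(j < N n | inJ j) A n j.
  move=> x; rewrite /B -bigcup_seq_cond => -[j /= /andP[_ lj] Ax].
  have [xo|xo] := pselect (out n0 x); [by left|right].
  rewrite -bigcup_seq_cond; exists j => //=.
  rewrite mem_index_enum /=; apply/andP; split => //.
  apply/asboolP; exists x; split=> // k.
  by rewrite leNgt; apply/negP => lt; apply: xo; exists k.
have mJ : measurable (\big[setU/set0]_(j < N n | inJ j) A n j).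
  exact: bigsetU_measurable.
apply: (@le_lt_trans _ _ ((r / 4)%:E + (r / 4)%:E)%E); last first.
  by rewrite -EFinD lte_fin; lra.
apply: (le_trans (le_measure mu _ _ sub)); rewrite ?inE//.
  exact: measurableU.
apply: (le_trans (measureU2 mu _ _)) => //; apply: leeD => //.
apply: (@le_trans _ _ (\sum_(j < N n | inJ j) mu (A n j))%E).
  rewrite le_eqVlt; apply/orP; left; apply/eqP.
  transitivity (\sum_(j < N n | inJ j) \int[mu]_(x in A n j) (1 : R)%:E)%E.
    apply/esym; transitivity (\int[mu]_(x in \big[setU/set0]_(j < N n | inJ j) A n j)
       (1 : R)%:E)%E.
      exact: (@sum_int_cells _ _ _ mu (A n) (mA n) (@tA n) (N n) (fun=> 1) inJ).
    by rewrite integral_cst// mul1e.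
  by apply: eq_bigr => j _; rewrite integral_cst// mul1e.
apply: (@le_trans _ _ (\sum_(j < N n | inJ j) (2 * t)%:E)%E).
  apply: lee_sum => j /andP[lj _].
  by rewrite (cell_massE mu (mA n)) lee_fin.
rewrite (eq_bigl (fun j : 'I_(N n) => j \in J)); last by move=> j; rewrite inE.
rewrite sumEFin lee_fin sumr_const -[_ *+ #|_|]mulr_natl.
have card := @card_cells_meeting_box R d (h n) n0%:R (A n) (N n) J d_gt0 (h_gt0 n)
  hn1 (ler0n _ _) (cubeA n) (@tA n).
have {}card : #|J|%:R * h n ^+ d <= C.
  by apply: card => j; rewrite inE => /andP[_ /asboolP].
apply: le_trans cn.
have -> : #|J|%:R * (2 * t) = (#|J|%:R * h n ^+ d) * (2 * c n) by rewrite /t; ring.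
by apply: ler_wpM2r => //; rewrite mulr_ge0// ltW.
Unshelve. all: by end_near. Qed.

End partition_sequence.

Section cell_error.
Context (R : realType).
Implicit Types (p v w q : R).

(** For a cell of mass [p], [v] and [vL] stand for the integrals of the response
and of the truncated response, [U] for that of the squared residual, [mun] for
the empirical mass, [mut] and [nut] for the private averages, [r] and [s] for the
empirical means of the residual and of its square. The error is the variance of
the regression function in the cell plus [p * (q - v / p) ^ 2], and [q - v / p]
goes through [vL / p]. All deviations are measured against the threshold [t], and
[t <= mut] turns them into relative ones. The two hypotheses that quantify over
[c] are Cauchy-Schwarz inequalities. *)
Lemma selected_cell_error p v w vL U s r t delta l mut nut mun :
  0 < t -> 0 <= delta -> delta <= 1 / 4 -> 0 <= l -> 0 <= r -> 0 <= U ->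
  t <= mut -> `|mut - p| <= 2 * delta * t -> `|mut - mun| <= delta * t ->
  `|nut - vL| <= 2 * delta * t + r -> `|vL| <= l * p ->
  (forall c, 2 * c * r <= s + c ^+ 2 * mun) ->
  (forall c, 2 * c * (v - vL) <= U + c ^+ 2 * p) ->
  w - 2 * (nut / mut) * v + (nut / mut) ^+ 2 * p <=
  (w - v ^+ 2 / p) + 2 * U + 16 * (delta * (1 + l)) ^+ 2 * p + 16 * s.
Proof.
move=> t0 d0 d1 l0 r0 U0 tm Hmp Hmm Hn HvL Hr HU.
have m0 : 0 < mut by lra.
have dt : delta * t <= t / 4 by nra.
move: Hmp; rewrite ler_norml => /andP[mp1 mp2].
have dtm : delta * t <= delta * mut by exact: ler_wpM2l.
have p0 : 0 < p by nra.
have pm : p <= 2 * mut by nra.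
have mm : mun <= 2 * mut.
  by move: Hmm; rewrite ler_norml => /andP[? ?]; nra.
set q := nut / mut; set a := vL / p; set b := v / p.
have r2 : r ^+ 2 <= 2 * mut * s.
  have := Hr (r / (2 * mut)).
  have -> : 2 * (r / (2 * mut)) * r = r ^+ 2 / mut by field; rewrite lt0r_neq0.
  have -> : (r / (2 * mut)) ^+ 2 * mun = r ^+ 2 / mut * (mun / (4 * mut)).
    by field; rewrite lt0r_neq0.
  have h1 : mun / (4 * mut) <= 1 / 2 by rewrite ler_pdivrMr; lra.
  have h2 : 0 <= r ^+ 2 / mut by rewrite divr_ge0 ?sqr_ge0// ltW.
  move=> h3; have h4 : r ^+ 2 / mut <= 2 * s by nra.
  by move: h4; rewrite ler_pdivrMr//; lra.
have Uab : p * (b - a) ^+ 2 <= U.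
  have := HU (b - a); have -> : v - vL = p * (b - a).
    by rewrite /a /b; field; rewrite lt0r_neq0.
  by nra.
have al : `|a| <= l.
  by rewrite /a normrM normfV (gtr0_norm p0) ler_pdivrMr.
have qa : `|q - a| <= 2 * delta * (1 + l) + r / mut.
  have -> : q - a = (nut - vL) / mut + a * ((p - mut) / mut).
    by rewrite /q /a; field; rewrite !lt0r_neq0.
  have tm1 : t / mut <= 1 by rewrite ler_pdivrMr// mul1r.
  have h1 : `|(nut - vL) / mut| <= 2 * delta + r / mut.
    rewrite normrM normfV (gtr0_norm m0) ler_pdivrMr// mulrDl divfK ?lt0r_neq0//.
    by apply: (le_trans Hn); rewrite lerD2r; lra.
  have h2 : `|(p - mut) / mut| <= 2 * delta.
    rewrite normrM normfV (gtr0_norm m0) ler_pdivrMr// ler_norml.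
    by apply/andP; split; nra.
  apply: (le_trans (ler_normD _ _)); rewrite [X in _ + X]normrM.
  have h3 := ler_pM (normr_ge0 _) (normr_ge0 _) al h2.
  apply: (le_trans (lerD h1 h3)).
  rewrite le_eqVlt; apply/orP; left; apply/eqP; ring.
have e1 : p * (q - a) ^+ 2 <= 8 * (delta * (1 + l)) ^+ 2 * p + 8 * s.
  have h0 : 0 <= r / mut by rewrite divr_ge0// ltW.
  have h1 : (q - a) ^+ 2 <= (2 * (delta * (1 + l)) + r / mut) ^+ 2.
    rewrite -(real_normK (num_real (q - a))) lerXn2r ?nnegrE//.
      by rewrite addr_ge0// !mulr_ge0// addr_ge0.
    by move: qa; rewrite mulrA.
  have h2 : p * (r / mut) ^+ 2 <= 4 * s.
    have -> : p * (r / mut) ^+ 2 = p * r ^+ 2 / mut ^+ 2 by field; rewrite lt0r_neq0.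
    rewrite ler_pdivrMr ?exprn_gt0//.
    have rr := sqr_ge0 r.
    have : p * r ^+ 2 <= (2 * mut) * (2 * mut * s) by apply: ler_pM => //; exact: ltW.
    by have -> : 4 * s * mut ^+ 2 = (2 * mut) * (2 * mut * s) by ring.
  move: h1 h2; set D := delta * (1 + l); set z := r / mut => h1 h2.
  have h3 : (q - a) ^+ 2 <= 8 * D ^+ 2 + 2 * z ^+ 2.
    by have := sqr_ge0 (2 * D - z); nra.
  have := ler_wpM2l (ltW p0) h3; nra.
have -> : w - 2 * q * v + q ^+ 2 * p = (w - v ^+ 2 / p) + p * (q - b) ^+ 2.
  by rewrite /b; field; rewrite lt0r_neq0.
have e2 : p * (q - b) ^+ 2 <= 2 * (p * (q - a) ^+ 2) + 2 * (p * (b - a) ^+ 2).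
  have h : (q - b) ^+ 2 <= 2 * (q - a) ^+ 2 + 2 * (b - a) ^+ 2.
    by have := sqr_ge0 ((q - a) + (b - a)); nra.
  have := ler_wpM2l (ltW p0) h; nra.
lra.
Qed.

End cell_error.

(** * Rates *)

Section rates.
Context (R : realType).
Variables (h c : nat -> R) (d : nat).
Hypothesis h_gt0 : forall n, 0 < h n.
Hypothesis c_gt0 : forall n, 0 < c n.
Hypothesis c_cvg : c @ \oo --> 0.
Hypothesis h_cvg : h @ \oo --> 0.
Hypothesis rate_cvg :
  (fun n => ln n%:R ^+ 3 / (n%:R * c n ^+ 2 * h n ^+ (2 * d))) @ \oo --> (0 : R).

Definition threshold n : R := c n * h n ^+ d.

Lemma threshold_gt0 n : 0 < threshold n.
Proof. by rewrite mulr_gt0// exprn_gt0. Qed.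

Lemma threshold_small (e : R) : 0 < e -> \forall n \near \oo, threshold n <= e.
Proof.
move=> e0; near=> n.
have h1 : `|0 - h n| <= 1 by near: n; move/cvgrPdist_le: h_cvg; apply.
have h2 : `|0 - c n| <= e by near: n; move/cvgrPdist_le: c_cvg; apply.
rewrite sub0r normrN gtr0_norm// in h1.
rewrite sub0r normrN gtr0_norm// in h2.
apply: le_trans h2; rewrite /threshold; apply: ler_piMr; first exact: ltW.
by rewrite exprn_ile1// ltW.
Unshelve. all: by end_near. Qed.

Lemma ln_ge1_near : \forall n \near \oo, (1 : R) <= ln n%:R.
Proof.
near=> n.
have e1 : expR 1 <= n%:R :> R by near: n; exact: nbhs_infty_ger.
rewrite -[leLHS]expRK ler_ln ?posrE ?expR_gt0//.
exact: lt_le_trans (expR_gt0 1) e1.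
Unshelve. all: by end_near. Qed.

Lemma threshold_rate (K : R) : 0 < K ->
  \forall n \near \oo, K * ln n%:R <= n%:R * threshold n ^+ 2.
Proof.
move=> K0; near=> n.
have l1 : (1 : R) <= ln n%:R by near: n; exact: ln_ge1_near.
have n0 : (0 : R) < n%:R.
  rewrite ltr0n; near: n; exact: nbhs_infty_gt.
have : `|0 - ln n%:R ^+ 3 / (n%:R * c n ^+ 2 * h n ^+ (2 * d))| <= K^-1.
  by near: n; move/cvgrPdist_le: rate_cvg; apply; rewrite invr_gt0.
have -> : n%:R * c n ^+ 2 * h n ^+ (2 * d) = n%:R * threshold n ^+ 2.
  by rewrite /threshold exprMn mulnC exprM -mulrA.
have t0 := threshold_gt0 n.
have nt : 0 < n%:R * threshold n ^+ 2 by rewrite mulr_gt0// exprn_gt0.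
have l3 : 0 <= ln n%:R ^+ 3 :> R by rewrite exprn_ge0//; lra.
rewrite sub0r normrN ger0_norm; last by rewrite divr_ge0// ltW.
rewrite ler_pdivrMr// mulrC ler_pdivlMr// => H.
apply: le_trans H; rewrite mulrC ler_wpM2r ?(ltW K0)//.
set l := ln n%:R in l1 *; nra.
Unshelve. all: by end_near. Qed.

(** Deviation probabilities at the scale of the threshold decrease faster than
every power of [n]. *)
Lemma exp_rate (kappa : R) (k : nat) : 0 < kappa ->
  \forall n \near \oo, expR (- (n%:R * threshold n ^+ 2 * kappa)) <= n%:R ^- k.
Proof.
move=> k0; near=> n.
have n0 : (0 : R) < n%:R.
  rewrite ltr0n; near: n; exact: nbhs_infty_gt.
have l1 : (1 : R) <= ln n%:R by near: n; exact: ln_ge1_near.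
have H : (k.+1%:R / kappa) * ln n%:R <= n%:R * threshold n ^+ 2.
  by near: n; apply: threshold_rate; rewrite divr_gt0.
rewrite -[n%:R in leRHS]lnK ?posrE// -expRM_natl -expRN ler_expR lerN2.
rewrite mulrAC ler_pdivrMr// in H; apply: le_trans H.
by rewrite mulrC mulr_natr -mulr_natl ler_wpM2r// ?ler_nat//; lra.
Unshelve. all: by end_near. Qed.

End rates.

(** * The private estimate *)

Section truncation.
Context (R : realType).
Implicit Types (y r : R) (M : \bar R).

Lemma truncationP r y : 0 < r -> let T := truncation r%:E y in
  [\/ y <= - r /\ T = - r, - r <= y <= r /\ T = y | r <= y /\ T = r].
Proof.
move=> r0 /=; have [h1|h1] := lerP y (- r).
  by constructor 1; split => //; rewrite min_r//; lra.
have [h2|h2] := lerP r y; first by constructor 3.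
by constructor 2; split => //; rewrite !ltW.
Qed.

Lemma truncation_norm_le r y : 0 < r -> `|truncation r%:E y| <= r.
Proof.
move=> r0; rewrite ler_norml.
by case: (truncationP y r0) => /= -[h ->]; apply/andP; split; lra.
Qed.

Lemma truncation_contract M y : (0 < M)%E -> `|truncation M y| <= `|y|.
Proof.
case: M => [r| |]//; rewrite lte_fin => r0.
have := ler_norm y; have := ler_norm (- y); rewrite normrN => a b.
by rewrite ler_norml; case: (truncationP y r0) => /= -[h ->];
  apply/andP; split; lra.
Qed.

Lemma truncation_close M r y : 0 < r -> (r%:E <= M)%E ->
  `|truncation M y - truncation r%:E y| <= `|y - truncation r%:E y|.
Proof.
case: M => [s| |]//; rewrite lee_fin => r0 rs.
have s0 : 0 < s by lra.
have a := ler_norm (y - truncation r%:E y).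
have b := ler_norm (- (y - truncation r%:E y)); rewrite normrN in b.
move: a b; rewrite ler_norml; case: (truncationP y r0) => /= -[h ->] a b;
  case: (truncationP y s0) => /= -[h' ->]; apply/andP; split; lra.
Qed.

Lemma measurable_truncation r : measurable_fun setT (truncation r%:E : R -> R).
Proof.
apply: measurable_minr => //; apply: measurable_maxr => //.
Qed.

Lemma truncation_id r y : 0 < r -> `|y| <= r -> truncation r%:E y = y.
Proof.
move=> r0; rewrite ler_norml => /andP[a b].
by case: (truncationP y r0) => /= -[h ->]; lra.
Qed.

End truncation.

Section private_estimate_error.
Context (R : realType) (d : nat) (dO : measure_display).
Context (Omega : measurableType dO).
Variable P : probability Omega R.
Variables (X : {RV P >-> d.-tuple R}) (Y : {RV P >-> R}) (m : d.-tuple R -> R).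
Variables (Xs : nat -> {RV P >-> d.-tuple R}) (Ys : nat -> {RV P >-> R}).
Variables (eps zeta : nat -> nat -> {RV P >-> R}) (sigmaZ sigmaW : R).
Variables (h c : nat -> R) (M : nat -> \bar R).
Variables (A : nat -> nat -> set (d.-tuple R)) (N : nat -> nat).
Hypothesis d_gt0 : (0 < d)%N.
Hypothesis sigmaZ_gt0 : 0 < sigmaZ.
Hypothesis sigmaW_gt0 : 0 < sigmaW.
Hypothesis iY2 : P.-integrable setT (fun w => (Y w ^+ 2)%:E).
Hypothesis hm : is_regression_function X Y m.
Hypothesis data_law : forall i,
  same_law P (fun w => (Xs i w, Ys i w)) (fun w => (X w, Y w)).
Hypothesis data_indep : mutually_independent P (fun i w => (Xs i w, Ys i w)).
Hypothesis eps_law : forall i j, laplace_distributed (eps i j).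
Hypothesis eps_indep :
  mutually_independent P (fun ij : nat * nat => eps ij.1 ij.2).
Hypothesis zeta_law : forall i j, laplace_distributed (zeta i j).
Hypothesis zeta_indep :
  mutually_independent P (fun ij : nat * nat => zeta ij.1 ij.2).
Hypothesis h_gt0 : forall n, 0 < h n.
Hypothesis c_gt0 : forall n, 0 < c n.
Hypothesis M_gt0 : forall n, (0 < M n)%E.
Hypothesis mA : forall n j, measurable (A n j).
Hypothesis tA : forall n, trivIset setT (A n).
Hypothesis cubeA : forall n j, is_cube (h n) (A n j).
Hypothesis covA : forall n, \bigcup_j A n j = setT.
Hypothesis covN : forall x, \forall n \near \oo, exists2 j, (j < N n)%N & A n j x.
Hypothesis c_cvg : c @ \oo --> 0.
Hypothesis h_cvg : h @ \oo --> 0.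
Hypothesis M_cvg : M @ \oo --> +oo%E.
Hypothesis rate_cvg :
  (fun n => ln n%:R ^+ 3 / (n%:R * c n ^+ 2 * h n ^+ (2 * d))) @ \oo --> (0 : R).

Local Notation mu := (distribution P X).
Local Notation t := (threshold h c d).
Local Notation p n j := (cell_mass mu (A n) j).
Local Notation v n j := (cell_int mu (A n) m j).
Local Notation w2 n j := (cell_int2 mu (A n) m j).

(** The level [l + 1] at which the responses are truncated in the analysis, and
the relative precision asked of all averages; the latter is so small compared
with the former that truncated averages become precise as [l] grows. *)
Definition level (l : nat) : R := l.+1%:R.
Definition precision (l : nat) : R := (4 * level l ^+ 2)^-1.
Definition trunc (l : nat) (y : R) : R := truncation (level l)%:E y.
Definition residual (l : nat) (y : R) : R := y - trunc l y.

Definition cell_trunc (l n j : nat) : R :=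
  \int[P]_(w in X @^-1` A n j) trunc l (Y w).
Definition cell_residual2 (l n j : nat) : R :=
  \int[P]_(w in X @^-1` A n j) (residual l (Y w) ^+ 2).
Definition mean_residual2 (l : nat) : R :=
  \int[P]_(w in setT) (residual l (Y w) ^+ 2).

Definition avg (n : nat) (f : nat -> R) : R := n%:R^-1 * \sum_(i < n) f i.

(** The tolerance is [precision l * t n] for each contribution to the private
averages, so that those of the noise are divided by its scale. The events are
written for sums, the form of the concentration bounds. *)
Definition bad_set (l n j : nat) : set Omega :=
  [set w | n%:R * (precision l * t n / sigmaW) < `|\sum_(i < n) zeta i j w|] `|`
  [set w | n%:R * (precision l * t n / sigmaZ) < `|\sum_(i < n) eps i j w|] `|`
  [set w | n%:R * (precision l * t n) <
    `|\sum_(i < n) \1_(A n j) (Xs i w) - n%:R * p n j|] `|`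
  [set w | n%:R * (precision l * t n) <
    `|\sum_(i < n) trunc l (Ys i w) * \1_(A n j) (Xs i w)
      - n%:R * cell_trunc l n j|].

(** Up to a constant, the most that the bad cells can contribute to the error:
where the estimate is not zero, its denominator is at least the threshold, and
its numerator is at most an average of responses plus noise. *)
Definition bad_weight (l n : nat) (w : Omega) : R :=
  \sum_(j < N n) \1_(bad_set l n j) w *
    (w2 n j + p n j * ((1 + avg n (fun i => eps i j w) ^+ 2) / t n ^+ 2)).

Let mY : measurable_fun setT Y. Proof. exact: measurable_funPT. Qed.
Let mm : measurable_fun setT m. Proof. by case: hm. Qed.
Let m2i : mu.-integrable setT (fun x => (m x ^+ 2)%:E).
Proof. exact: regression_sqr_integrable hm. Qed.
Let mpair i : measurable_fun setT (fun w => (Xs i w, Ys i w)).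
Proof. by apply: measurable_fun_pair; exact: measurable_funPT. Qed.
Let mpairXY : measurable_fun setT (fun w => (X w, Y w)).
Proof. exact: measurable_fun_pair. Qed.
Let mtrunc l : measurable_fun setT (trunc l).
Proof. exact: measurable_truncation. Qed.
Let mres l : measurable_fun setT (residual l).
Proof. exact: measurable_funB. Qed.
Let mXA n j : measurable (X @^-1` A n j).
Proof. exact: measurable_preRV. Qed.
Let m1A n j : measurable_fun setT (\1_(A n j) : d.-tuple R -> R).
Proof. exact: measurable_indicT. Qed.
Let mXs1 n j i : measurable_fun setT (fun w => \1_(A n j) (Xs i w) : R).
Proof. exact: (measurableT_comp (m1A n j) (measurable_funPT (Xs i))). Qed.

Lemma level_ge1 l : 1 <= level l. Proof. by rewrite /level ler1n. Qed.

Lemma level_gt0 l : 0 < level l. Proof. by rewrite /level ltr0n. Qed.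

Lemma precision_gt0 l : 0 < precision l.
Proof. by rewrite invr_gt0 mulr_gt0// exprn_gt0// level_gt0. Qed.

Lemma precision_le l : precision l <= 1 / 4.
Proof.
have l1 := level_ge1 l.
rewrite /precision div1r lef_pV2 ?posrE//; first by nra.
by rewrite mulr_gt0// exprn_gt0// level_gt0.
Qed.

Lemma precision_level l : (precision l * (1 + level l)) ^+ 2 <= (4 * level l)^-1.
Proof.
have l1 := level_ge1 l; have l0 := level_gt0 l.
have h1 : precision l * (1 + level l) <= (2 * level l)^-1.
  rewrite /precision -ler_pdivlMl ?invr_gt0 ?mulr_gt0 ?exprn_gt0// invrK.
  have -> : 4 * level l ^+ 2 / (2 * level l) = 2 * level l.
    by field; rewrite lt0r_neq0.
  lra.
have h0 : 0 <= precision l * (1 + level l).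
  by rewrite mulr_ge0 ?(ltW (precision_gt0 l))//; lra.
have : (precision l * (1 + level l)) ^+ 2 <= (2 * level l)^-1 ^+ 2.
  by rewrite lerXn2r ?nnegrE// invr_ge0 mulr_ge0// ltW.
move/le_trans; apply; rewrite exprVn exprMn.
rewrite lef_pV2 ?posrE ?mulr_gt0 ?exprn_gt0//; nra.
Qed.

Lemma residual_norm_le l y : `|residual l y| <= `|y|.
Proof.
rewrite /residual /trunc; have l0 := level_gt0 l.
have := ler_norm y; have := ler_norm (- y); rewrite normrN => a b.
by rewrite ler_norml; case: (truncationP y l0) => /= -[h1 ->];
  apply/andP; split; lra.
Qed.

Let ires2 l : P.-integrable setT (fun w => (residual l (Y w) ^+ 2)%:E).
Proof.
apply: (le_integrable measurableT _ _ iY2).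
  apply/measurable_EFinP/measurable_funX.
  exact: (measurableT_comp (mres l) mY).
move=> w _ /=; rewrite lee_fin !ger0_norm ?sqr_ge0//.
rewrite -(real_normK (num_real (Y w))) -[leLHS]real_normK ?num_real//.
by rewrite lerXn2r ?nnegrE// residual_norm_le.
Qed.

Let itrunc l : P.-integrable setT (fun w => (trunc l (Y w))%:E).
Proof.
apply: (@le_integrable _ _ _ P setT measurableT _ (cst (level l)%:E)).
- by apply/measurable_EFinP; exact: (measurableT_comp (mtrunc l) mY).
- move=> w _ /=; rewrite lee_fin (ger0_norm (ltW (level_gt0 l))).
  exact: truncation_norm_le (level_gt0 l).
- exact: finite_measure_integrable_cst.
Qed.

Lemma cell_trunc_le l n j : `|cell_trunc l n j| <= level l * p n j.
Proof.
have iS : P.-integrable (X @^-1` A n j) (EFin \o (fun w => trunc l (Y w))).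
  exact: (integrableS measurableT (mXA n j) _ (itrunc l)).
apply: (le_trans (le_normr_Rintegral _ iS)) => //.
rewrite (_ : p n j = fine (P (X @^-1` A n j)))// -Rintegral_cst//.
apply: le_Rintegral => //.
- exact: (integrable_norm iS).
- apply: (integrableS measurableT) => //; exact: finite_measure_integrable_cst.
- move=> w _; exact: truncation_norm_le (level_gt0 l).
Qed.

(** Cauchy-Schwarz for the residual over the cell. *)
Lemma cell_trunc_close l n j r :
  2 * r * (v n j - cell_trunc l n j) <= cell_residual2 l n j + r ^+ 2 * p n j.
Proof.
have mrY : measurable_fun setT (fun w => residual l (Y w)).
  exact: (measurableT_comp (mres l) mY).
have := Rintegral_sqr_sub_ge0 mrY (ires2 l) r (mXA n j).
have -> : \int[P]_(w in X @^-1` A n j) residual l (Y w) =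
    v n j - cell_trunc l n j.
  have iY := integrable_of_sqr mY iY2.
  rewrite RintegralB//; last 2 first.
  - exact: (integrableS measurableT).
  - exact: (integrableS measurableT (mXA n j) _ (itrunc l)).
  by congr (_ - _); rewrite /cell_int /Rintegral; case: hm => _ _ ->.
by rewrite addrAC subr_ge0.
Qed.

Lemma sum_cell_residual2_le l n :
  \sum_(j < N n) cell_residual2 l n j <= mean_residual2 l.
Proof.
rewrite -lee_fin -sumEFin.
have mr2 : measurable_fun setT (fun w => residual l (Y w) ^+ 2).
  by apply: measurable_funX; exact: (measurableT_comp (mres l) mY).
have tXA : trivIset setT (fun j => X @^-1` A n j).
  apply/trivIsetP => i j _ _ ij; rewrite -preimage_setI.
  by have /trivIsetP -> := @tA n.
have := @sum_int_cells_le _ _ _ P (fun j => X @^-1` A n j) (mXA n) tXA (N n)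
  (fun w => residual l (Y w) ^+ 2) mr2 (fun w => sqr_ge0 _).
rewrite (int_EFin_Rintegral (g := fun w => residual l (Y w) ^+ 2))//.
apply: le_trans; apply: lee_sum => j _.
rewrite (int_EFin_Rintegral (g := fun w => residual l (Y w) ^+ 2))//.
all: exact: ires2.
Qed.

Let measurable_gt (f : Omega -> R) (a : R) : measurable_fun setT f ->
  measurable [set w | a < `|f w|].
Proof.
move=> mf; have mN : measurable_fun setT (fun w => `|f w|) by exact: measurableT_comp.
have := mN measurableT `]a, +oo[%classic (measurable_itv _).
by rewrite setTI; congr measurable; apply/seteqP; split => w /=; rewrite in_itv/= andbT.
Qed.

Let mbad l n j : measurable (bad_set l n j).
Proof.
apply: measurableU; first apply: measurableU; first apply: measurableU.
- by apply: measurable_gt; apply: measurable_sum => i.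
- by apply: measurable_gt; apply: measurable_sum => i.
- by apply: measurable_gt; apply: measurable_funB => //; apply: measurable_sum.
- apply: measurable_gt; apply: measurable_funB => //; apply: measurable_sum => i.
  by apply: measurable_funM => //; exact: (measurableT_comp (mtrunc l)).
Qed.

Let tail_near (a kappa : R) : 0 < a -> 0 < kappa -> \forall n \near \oo,
  2 * expR (- (n%:R * (a * t n) ^+ 2 * kappa)) <= 2 * n%:R ^- 6.
Proof.
move=> a0 k0; have a2k : 0 < a ^+ 2 * kappa by rewrite mulr_gt0// exprn_gt0.
have := exp_rate h_gt0 c_gt0 rate_cvg 6 a2k.
apply: filterS => n; rewrite ler_pM2l//; apply: le_trans.
rewrite ler_expR lerN2 le_eqVlt; apply/orP; left; apply/eqP.
by ring.
Qed.

Lemma prob_bad_set l : \forall n \near \oo, forall j,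
  (P (bad_set l n j) <= (8 * n%:R ^- 6)%:E)%E.
Proof.
have [kl [u0 [C [kl0 u00 HL]]]] := laplace_average P.
have [kb kb0 HB] := bounded_average P (level_gt0 l).
have [Heps _] := HL eps eps_law eps_indep.
have [Hzeta _] := HL zeta zeta_law zeta_indep.
have d0 := precision_gt0 l.
pose aW := precision l / sigmaW; have aW0 : 0 < aW by rewrite divr_gt0.
pose aZ := precision l / sigmaZ; have aZ0 : 0 < aZ by rewrite divr_gt0.
near=> n => j.
have t0 : 0 < t n by exact: threshold_gt0.
have rew a : precision l * t n / a = precision l / a * t n by rewrite mulrAC.
have small a : 0 < a -> t n <= u0 / a -> a * t n <= u0.
  by move=> a0; rewrite ler_pdivlMr// mulrC.
have b1 : (P [set w | (n%:R * (precision l * t n / sigmaW) <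
    `|\sum_(i < n) zeta i j w|)%R] <= (2 * n%:R ^- 6)%:E)%E.
  rewrite rew; apply: (le_trans (Hzeta j n _ _ _)); first exact: mulr_gt0.
    apply: small => //; near: n; apply: threshold_small => //.
    exact: divr_gt0.
  by rewrite lee_fin; near: n; exact: tail_near.
have b2 : (P [set w | (n%:R * (precision l * t n / sigmaZ) <
    `|\sum_(i < n) eps i j w|)%R] <= (2 * n%:R ^- 6)%:E)%E.
  rewrite rew; apply: (le_trans (Heps j n _ _ _)); first exact: mulr_gt0.
    apply: small => //; near: n; apply: threshold_small => //.
    exact: divr_gt0.
  by rewrite lee_fin; near: n; exact: tail_near.
have t1 : t n <= 1 by near: n; exact: threshold_small.
have pt : precision l * t n <= level l.
  apply: (le_trans _ (level_ge1 l)); apply: (le_trans (ler_piMr (ltW d0) t1)).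
  by apply: (le_trans (precision_le l)); rewrite ler_pdivrMr// mul1r ler1n.
have tail : (2 * expR (- (n%:R * (precision l * t n) ^+ 2 * kb)) <=
    2 * n%:R ^- 6).
  by near: n; exact: tail_near.
pose f1 (x : d.-tuple R * R) : R := \1_(A n j) x.1.
pose f2 (x : d.-tuple R * R) : R := trunc l x.2 * \1_(A n j) x.1.
have mf1 : measurable_fun setT f1.
  exact: (measurableT_comp (m1A n j) measurable_fst).
have mf2 : measurable_fun setT f2.
  apply: measurable_funM => //.
  exact: (measurableT_comp (mtrunc l) measurable_snd).
have f1b x : `|f1 x| <= level l.
  apply: le_trans (level_ge1 l); rewrite /f1 indicE ger0_norm//.
  by rewrite lern1 leq_b1.
have f2b x : `|f2 x| <= level l.
  rewrite /f2 normrM -[leRHS]mulr1; apply: ler_pM => //.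
    exact: truncation_norm_le (level_gt0 l).
  by rewrite indicE ger0_norm// lern1 leq_b1.
have E1 : (\int[P]_w (f1 (X w, Y w))%:E = (p n j)%:E)%E.
  rewrite -(cell_massE mu (mA n)).
  transitivity (\int[P]_w (\1_(X @^-1` A n j) w)%:E)%E => //.
  by rewrite int_indic.
have E2 : (\int[P]_w (f2 (X w, Y w))%:E = (cell_trunc l n j)%:E)%E.
  rewrite -(int_EFin_Rintegral (mXA n j) (itrunc l)) [RHS]int_setE.
  by apply: eq_integral => w _; rewrite /f2 mulrC.
have b3 : (P [set w | (n%:R * (precision l * t n) <
    `|\sum_(i < n) \1_(A n j) (Xs i w) - n%:R * p n j|)%R] <= (2 * n%:R ^- 6)%:E)%E.
  apply: (le_trans (HB _ _ (fun i w => (Xs i w, Ys i w)) (fun w => (X w, Y w))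
    f1 _ mpair mpairXY data_indep data_law mf1 f1b E1 n _ (mulr_gt0 d0 t0) pt)).
  by rewrite lee_fin.
have b4 : (P [set w | (n%:R * (precision l * t n) <
    `|\sum_(i < n) trunc l (Ys i w) * \1_(A n j) (Xs i w)
      - n%:R * cell_trunc l n j|)%R] <= (2 * n%:R ^- 6)%:E)%E.
  apply: (le_trans (HB _ _ (fun i w => (Xs i w, Ys i w)) (fun w => (X w, Y w))
    f2 _ mpair mpairXY data_indep data_law mf2 f2b E2 n _ (mulr_gt0 d0 t0) pt)).
  by rewrite lee_fin.
rewrite (_ : 8 * n%:R ^- 6 = 2 * n%:R ^- 6 + 2 * n%:R ^- 6 + 2 * n%:R ^- 6
   + 2 * n%:R ^- 6); last by ring.
rewrite 3!EFinD /bad_set.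
have mu2 (B1 B2 : set Omega) (r1 r2 : R) : measurable B1 -> measurable B2 ->
    (P B1 <= r1%:E)%E -> (P B2 <= r2%:E)%E -> (P (B1 `|` B2) <= r1%:E + r2%:E)%E.
  by move=> m1 m2 h1 h2; apply: (le_trans (measureU2 P m1 m2)); exact: leeD.
have ms1 : measurable_fun setT (fun w => \sum_(i < n) zeta i j w).
  by apply: measurable_sum => i.
have ms2 : measurable_fun setT (fun w => \sum_(i < n) eps i j w).
  by apply: measurable_sum => i.
have ms3 : measurable_fun setT
    (fun w => \sum_(i < n) \1_(A n j) (Xs i w) - n%:R * p n j).
  by apply: measurable_funB => //; apply: measurable_sum.
have ms4 : measurable_fun setT (fun w =>
    \sum_(i < n) trunc l (Ys i w) * \1_(A n j) (Xs i w) - n%:R * cell_trunc l n j).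
  apply: measurable_funB => //; apply: measurable_sum => i.
  by apply: measurable_funM => //; exact: (measurableT_comp (mtrunc l)).
have g1 := measurable_gt (n%:R * (precision l * t n / sigmaW)) ms1.
have g2 := measurable_gt (n%:R * (precision l * t n / sigmaZ)) ms2.
have g3 := measurable_gt (n%:R * (precision l * t n)) ms3.
have g4 := measurable_gt (n%:R * (precision l * t n)) ms4.
have m12 := measurableU _ _ g1 g2; have m123 := measurableU _ _ m12 g3.
by apply: (mu2) => //; apply: (mu2) => //; exact: mu2.
Unshelve. all: by end_near. Qed.

(** Here [x] is the sample size, [B] the indicator of the bad event, [e] the noise
and [a] the squared threshold. The inequality between arithmetic and geometric
means separates [B], whose expectation is tiny, from the fourth power of the
noise, whose expectation is bounded. *)
Let bad_term (x B a w p e : R) : 1 <= x -> 0 <= w -> 0 <= p -> B = 0 \/ B = 1 ->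
  0 < a -> 1 <= x * a ->
  B * (w + p * ((1 + e ^+ 2) / a)) <=
  (w + 2 * x ^+ 4 * p) * B + (p * x ^- 2) * e ^+ 4.
Proof.
move=> x1 w0 p0 B01 a0 xa; have x0 : 0 < x by lra.
have e4 : 0 <= e ^+ 4 by rewrite exprn_even_ge0.
have xV : 0 <= x ^- 2 by rewrite invr_ge0 sqr_ge0.
case: B01 => ->.
  by rewrite mul0r mulr0 add0r; apply: mulr_ge0 => //; exact: mulr_ge0.
rewrite mul1r mulr1 -addrA lerD2l.
have h1 : (1 + e ^+ 2) / a <= x * (1 + e ^+ 2).
  by rewrite ler_pdivrMr//; have := sqr_ge0 e; nra.
have h2 : x * e ^+ 2 <= x ^+ 4 + x ^- 2 * e ^+ 4.
  have y : x ^- 2 * e ^+ 4 = (x^-1 * e ^+ 2) ^+ 2 by field; rewrite lt0r_neq0.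
  have z : x * e ^+ 2 = x ^+ 2 * (x^-1 * e ^+ 2) by field; rewrite lt0r_neq0.
  rewrite y z; move: (x^-1 * e ^+ 2) => u.
  by have := sqr_ge0 (x ^+ 2 - u); have := sqr_ge0 (x ^+ 2 + u); nra.
have h3 : x <= x ^+ 4 by rewrite -[leLHS]expr1; exact: ler_weXn2l.
have h4 : (1 + e ^+ 2) / a <= 2 * x ^+ 4 + x ^- 2 * e ^+ 4.
  by apply: (le_trans h1); rewrite mulrDr mulr1; move: h2 h3; lra.
apply: (le_trans (ler_wpM2l p0 h4)); rewrite le_eqVlt; apply/orP; left.
by apply/eqP; ring.
Qed.

(** Bad cells do not matter: their expected weight is the product of a
probability below any power of [n] with polynomially growing costs. *)
Lemma bad_weight_cvg0 l : {ae P, forall w, (fun n => bad_weight l n w) @ \oo --> (0 : R)}.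
Proof.
have [kl [u0 [C [_ _ /(_ eps eps_law eps_indep)[_ HC]]]]] := laplace_average P.
pose W : R := \int[mu]_(x in setT) (m x ^+ 2).
have W0 : 0 <= W by apply: Rintegral_ge0 => x _; exact: sqr_ge0.
have C0 : 0 <= C.
  rewrite -lee_fin; apply: le_trans (HC 0%N 2%N isT).
  by apply: int_ge0 => w; rewrite exprn_even_ge0.
have mavg n j : measurable_fun setT (fun w => avg n (fun i => eps i j w)).
  by apply: measurable_funM => //; apply: measurable_sum => i.
have m1bad n j : measurable_fun setT (\1_(bad_set l n j) : Omega -> R).
  exact: measurable_indicT.
have near_all : \forall n \near \oo, (2 <= n)%N /\ 1 <= n%:R * t n ^+ 2 /\
    (forall j, (P (bad_set l n j) <= (8 * n%:R ^- 6)%:E)%E).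
  near=> n; split; first by near: n; exact: nbhs_infty_ge.
  split; last by near: n; exact: prob_bad_set.
  have l1 : (1 : R) <= ln n%:R by near: n; exact: ln_ge1_near.
  apply: (le_trans l1); rewrite -[leLHS]mul1r.
  by near: n; exact: threshold_rate.
have [n0 _ Hn0] := near_all.
apply: (@ae_cvg0_inv_sq _ _ _ P _ (8 * W + 16 + C) n0).
- move=> n; apply: measurable_sum => j; apply: measurable_funM => //.
  apply: measurable_funD => //; apply: measurable_funM => //.
  apply: measurable_funM => //; apply: measurable_funD => //.
  exact: measurable_funX.
- move=> n w; apply: sumr_ge0 => j _; apply: mulr_ge0 => //.
  apply: addr_ge0; first exact: cell_int2_ge0.
  apply: mulr_ge0; first exact: cell_mass_ge0.
  by rewrite divr_ge0 ?sqr_ge0// addr_ge0// sqr_ge0.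
- by rewrite !addr_ge0// mulr_ge0.
move=> n /Hn0/= [n2 [nt Pb]].
set x : R := n%:R in nt Pb *.
have x1 : 1 <= x by rewrite ler1n; exact: ltnW.
have x0 : 0 < x by apply: lt_le_trans x1.
have t2 : 0 < t n ^+ 2 by rewrite exprn_gt0// threshold_gt0.
pose F (j : nat) w := (w2 n j + 2 * x ^+ 4 * p n j) * \1_(bad_set l n j) w +
  (p n j * x ^- 2) * avg n (fun i => eps i j w) ^+ 4.
have a0 j : 0 <= w2 n j + 2 * x ^+ 4 * p n j.
  apply: addr_ge0; first exact: cell_int2_ge0.
  apply: mulr_ge0; last exact: cell_mass_ge0.
  by rewrite mulr_ge0// exprn_ge0// ltW.
have b0 j : 0 <= p n j * x ^- 2.
  by apply: mulr_ge0; [exact: cell_mass_ge0|rewrite invr_ge0 sqr_ge0].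
have e40 j w : 0 <= avg n (fun i => eps i j w) ^+ 4 by rewrite exprn_even_ge0.
have F10 j w : 0 <= (w2 n j + 2 * x ^+ 4 * p n j) * \1_(bad_set l n j) w.
  exact: mulr_ge0.
have F20 j w : 0 <= (p n j * x ^- 2) * avg n (fun i => eps i j w) ^+ 4.
  exact: mulr_ge0.
have me4 j : measurable_fun setT (fun w => avg n (fun i => eps i j w) ^+ 4).
  exact: measurable_funX.
have mF1 j : measurable_fun setT
    (fun w => (w2 n j + 2 * x ^+ 4 * p n j) * \1_(bad_set l n j) w).
  exact: measurable_funM.
have mF2 j : measurable_fun setT
    (fun w => (p n j * x ^- 2) * avg n (fun i => eps i j w) ^+ 4).
  exact: measurable_funM.
apply: (@le_trans _ _ (\int[P]_w (\sum_(j < N n) F j w)%:E)%E).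
  apply: int_le.
  - move=> w; apply: sumr_ge0 => j _; apply: mulr_ge0 => //.
    apply: addr_ge0; first exact: cell_int2_ge0.
    apply: mulr_ge0; first exact: cell_mass_ge0.
    by rewrite divr_ge0 ?sqr_ge0// addr_ge0// sqr_ge0.
  - apply: measurable_sum => j; apply: measurable_funM => //.
    apply: measurable_funD => //; apply: measurable_funM => //.
    apply: measurable_funM => //; apply: measurable_funD => //.
    exact: measurable_funX.
  - by apply: measurable_sum => j; exact: measurable_funD.
  move=> w; apply: ler_sum => j _; apply: bad_term => //.
  - exact: cell_int2_ge0.
  - exact: cell_mass_ge0.
  - by rewrite indicE; case: (w \in _); [right|left].
rewrite int_sum; last 2 first.
- by move=> j w; exact: addr_ge0.
- by move=> j; exact: measurable_funD.
apply: (@le_trans _ _ (\sum_(j < N n) ((w2 n j + 2 * x ^+ 4 * p n j) * (8 * x ^- 6) +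
    (p n j * x ^- 2) * C)%:E)%E).
  apply: lee_sum => j _; rewrite /F int_add// int_scale// int_scale//.
  rewrite int_indic// [leRHS]EFinD.
  apply: leeD; rewrite [leRHS]EFinM; apply: lee_wpmul2l.
  - by rewrite lee_fin.
  - exact: Pb.
  - by rewrite lee_fin.
  - exact: HC.
rewrite sumEFin lee_fin.
have sw : \sum_(j < N n) w2 n j <= W.
  rewrite -lee_fin -sumEFin.
  have mm2 : measurable_fun setT (fun x => m x ^+ 2) by exact: measurable_funX.
  have := @sum_int_cells_le _ _ _ mu (A n) (mA n) (@tA n) (N n)
    (fun x => m x ^+ 2) mm2 (fun x => sqr_ge0 _).
  rewrite (int_EFin_Rintegral (g := fun x => m x ^+ 2))//.
  by apply: le_trans; apply: lee_sum => j _; rewrite (cell_int2E (mA n) m2i).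
have sp : \sum_(j < N n) p n j <= 1 by exact: sum_cell_mass_le (mA n) (@tA n) _.
have -> : \sum_(j < N n) ((w2 n j + 2 * x ^+ 4 * p n j) * (8 * x ^- 6) +
    p n j * x ^- 2 * C) =
    8 * x ^- 6 * (\sum_(j < N n) w2 n j) +
    (16 + C) * x ^- 2 * (\sum_(j < N n) p n j).
  rewrite !mulr_sumr -big_split /=; apply: eq_bigr => j _.
  by field; rewrite lt0r_neq0.
move: sw sp; move: (\sum_(j < N n) w2 n j) (\sum_(j < N n) p n j) => sw sp.
move: W W0 C C0 x x1 x0 {HC a0 b0 e40 F F10 F20 me4 mF1 mF2 nt Pb}.
move=> {}W W0 {}C C0 x x1 x0 swW sp1.
have x26 : x ^- 6 <= x ^- 2.
  by rewrite lef_pV2 ?posrE ?exprn_gt0//; exact: ler_weXn2l.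
have x20 : 0 <= x ^- 2 by rewrite invr_ge0 sqr_ge0.
have x60 : 0 <= x ^- 6 by rewrite invr_ge0 exprn_ge0// ltW.
have h1 : 8 * x ^- 6 * sw <= 8 * x ^- 2 * W.
  rewrite -!mulrA ler_wpM2l//.
  apply: (le_trans (ler_wpM2l x60 swW)); exact: ler_wpM2r.
have h2 : (16 + C) * x ^- 2 * sp <= (16 + C) * x ^- 2.
  by apply: ler_piMr => //; rewrite mulr_ge0// addr_ge0.
by move: h1 h2; lra.
Unshelve. all: by end_near. Qed.

Let avgB n (f : nat -> R) (a u : R) : (0 < n)%N ->
  `|\sum_(i < n) f i - n%:R * a| <= n%:R * u -> `|avg n f - a| <= u.
Proof.
move=> n0; have n1 : (0 : R) < n%:R by rewrite ltr0n.
have -> : avg n f - a = n%:R^-1 * (\sum_(i < n) f i - n%:R * a).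
  by rewrite /avg mulrBr mulKf ?lt0r_neq0.
by rewrite normrM normfV (gtr0_norm n1) ler_pdivrMl.
Qed.

Let avg_le n (f g : nat -> R) : (forall i, f i <= g i) -> avg n f <= avg n g.
Proof. by move=> H; apply: ler_wpM2l; [rewrite invr_ge0|exact: ler_sum]. Qed.

Let avg_ge0 n (f : nat -> R) : (forall i, 0 <= f i) -> 0 <= avg n f.
Proof. by move=> H; rewrite mulr_ge0 ?invr_ge0// sumr_ge0. Qed.

Let avg_norm n (f : nat -> R) : `|avg n f| <= avg n (fun i => `|f i|).
Proof.
rewrite /avg normrM ger0_norm ?invr_ge0//.
by apply: ler_wpM2l; [rewrite invr_ge0|exact: ler_norm_sum].
Qed.

Let avgD n (f g : nat -> R) : avg n (fun i => f i + g i) = avg n f + avg n g.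
Proof. by rewrite /avg big_split mulrDr. Qed.

Let avgZ n (a : R) (f : nat -> R) : avg n (fun i => a * f i) = a * avg n f.
Proof. by rewrite /avg -mulr_sumr mulrCA. Qed.

(** The crude bound [(y - q) ^ 2 <= 2 * y ^ 2 + 2 * q ^ 2], integrated. *)
Let bad_cell (p w v q K s e a nut mut : R) : 0 < a -> 0 <= s -> 0 <= w -> 0 <= p ->
  0 <= w + 2 * q * v + q ^+ 2 * p ->
  q = 0 \/ [/\ q = nut / mut, a <= mut & `|nut| <= K + s * `|e|] ->
  w - 2 * q * v + q ^+ 2 * p <=
  (2 + 4 * (K ^+ 2 + s ^+ 2)) * (w + p * ((1 + e ^+ 2) / a ^+ 2)).
Proof.
move=> a0 s0 w0 p0 ge q0.
have a2 : 0 < a ^+ 2 by rewrite exprn_gt0.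
have C0 : 0 <= 4 * (K ^+ 2 + s ^+ 2).
  by rewrite mulr_ge0// addr_ge0// sqr_ge0.
have F0 : 0 <= (1 + e ^+ 2) / a ^+ 2 by rewrite divr_ge0 ?(ltW a2)// addr_ge0// sqr_ge0.
have q2 : 2 * q ^+ 2 <= 4 * (K ^+ 2 + s ^+ 2) * ((1 + e ^+ 2) / a ^+ 2).
  case: q0 => [->|[-> am nK]]; first by rewrite expr0n /= mulr0 mulr_ge0.
  have m0 : 0 < mut by apply: lt_le_trans am.
  have n2 : nut ^+ 2 <= 2 * (K ^+ 2 + s ^+ 2) * (1 + e ^+ 2).
    have hKe : nut ^+ 2 <= (K + s * `|e|) ^+ 2.
      rewrite -(real_normK (num_real nut)) lerXn2r ?nnegrE//.
      exact: le_trans nK.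
    have ee : `|e| ^+ 2 = e ^+ 2 by rewrite real_normK ?num_real.
    apply: (le_trans hKe); rewrite -ee.
    have := sqr_ge0 (K - s * `|e|); have := sqr_ge0 s; have := sqr_ge0 K.
    have := sqr_ge0 `|e|; have := sqr_ge0 (K * `|e|).
    by rewrite exprMn; nra.
  have am2 : a ^+ 2 <= mut ^+ 2 by rewrite lerXn2r ?nnegrE// ltW.
  have -> : 2 * (nut / mut) ^+ 2 = 2 * nut ^+ 2 / mut ^+ 2.
    by field; rewrite lt0r_neq0.
  rewrite ler_pdivrMr ?exprn_gt0// [X in _ <= X * _]mulrA.
  have -> : 4 * (K ^+ 2 + s ^+ 2) * (1 + e ^+ 2) / a ^+ 2 * mut ^+ 2 =
    2 * (2 * (K ^+ 2 + s ^+ 2) * (1 + e ^+ 2)) * (mut ^+ 2 / a ^+ 2).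
    by field; rewrite !lt0r_neq0.
  apply: (@le_trans _ _ (2 * (2 * (K ^+ 2 + s ^+ 2) * (1 + e ^+ 2)))).
    by rewrite ler_wpM2l.
  apply: ler_peMr; last by rewrite ler_pdivlMr// mul1r.
  by rewrite !mulr_ge0// addr_ge0// sqr_ge0.
have h1 := ler_wpM2l p0 q2.
move: ((1 + e ^+ 2) / a ^+ 2) F0 h1 {q2} => F F0 h1.
move: (4 * (K ^+ 2 + s ^+ 2)) C0 h1 => C C0 h1.
have h2 := mulr_ge0 p0 F0; have h3 := mulr_ge0 C0 w0.
have h4 := mulr_ge0 p0 (sqr_ge0 q); nra.
Qed.

Let light_of_unselected (a D mt q0 : R) : D <= 1 / 4 -> mt < a ->
  `|mt - q0| <= 2 * D * a -> 0 < a -> q0 <= 2 * a.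
Proof. by move=> D1 m1; rewrite ler_norml => /andP[m2 m3] a0; nra. Qed.

Definition cell_estimate n (w : Omega) j : R :=
  if (c n * h n ^+ d <= mu_tilde Xs zeta sigmaW A N n j w) && (j < N n)%N
  then nu_tilde Xs Ys eps sigmaZ M A N n j w /
       mu_tilde Xs zeta sigmaW A N n j w else 0.

Let mu_tildeE n j w : (j < N n)%N -> mu_tilde Xs zeta sigmaW A N n j w =
  avg n (fun i => \1_(A n j) (Xs i w)) + sigmaW * avg n (fun i => zeta i j w).
Proof.
move=> jN; rewrite -avgZ -avgD /mu_tilde /avg; congr (_ * _).
by apply: eq_bigr => i _; rewrite jN mulr1.
Qed.

Let nu_tildeE n j w : (j < N n)%N -> nu_tilde Xs Ys eps sigmaZ M A N n j w =
  avg n (fun i => truncation (M n) (Ys i w) * \1_(A n j) (Xs i w)) +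
  sigmaZ * avg n (fun i => eps i j w).
Proof.
move=> jN; rewrite -avgZ -avgD /nu_tilde /avg; congr (_ * _).
by apply: eq_bigr => i _; rewrite jN mulr1.
Qed.

Definition cell_avg_residual2 l n j w : R :=
  avg n (fun i => \1_(A n j) (Xs i w) * residual l (Ys i w) ^+ 2).

(** Either an average is off, and the last term pays for it; or all averages are
precise. Then a cell that misses the threshold is light, and for one that reaches
it [selected_cell_error] applies. *)
Lemma cell_error_bound l n j w K : (j < N n)%N -> (0 < n)%N ->
  ((level l)%:E <= M n)%E -> avg n (fun i => `|Ys i w|) <= K ->
  forall q, q = cell_estimate n w j ->
  w2 n j - 2 * q * v n j + q ^+ 2 * p n j <=
  cell_variance mu (A n) m j + 2 * cell_residual2 l n j
  + 16 * (precision l * (1 + level l)) ^+ 2 * p n j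
  + 16 * cell_avg_residual2 l n j w
  + (if p n j <= 2 * (c n * h n ^+ d) then w2 n j else 0)
  + (2 + 4 * (K ^+ 2 + sigmaZ ^+ 2)) * (\1_(bad_set l n j) w *
      (w2 n j + p n j * ((1 + avg n (fun i => eps i j w) ^+ 2) / t n ^+ 2))).
Proof.
move=> jN n0 lM HK q qdef.
have t0 : 0 < t n by exact: threshold_gt0.
have ge := cell_sqr_sub_ge0 (mA n) mm m2i j (- q).
have w0 : 0 <= w2 n j := cell_int2_ge0 mu (A n) m j.
have p0 : 0 <= p n j := cell_mass_ge0 mu (A n) j.
have var0 := cell_variance_ge0 (mA n) mm m2i j.
have U0 : 0 <= cell_residual2 l n j.
  by apply: Rintegral_ge0 => x _; exact: sqr_ge0.
have s0 : 0 <= cell_avg_residual2 l n j w.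
  by apply: avg_ge0 => i; rewrite mulr_ge0// sqr_ge0.
have D0 : 0 <= (precision l * (1 + level l)) ^+ 2 by exact: sqr_ge0.
set mut := mu_tilde Xs zeta sigmaW A N n j w.
set nut := nu_tilde Xs Ys eps sigmaZ M A N n j w.
have qE : mut < t n /\ q = 0 \/ t n <= mut /\ q = nut / mut.
  rewrite qdef /cell_estimate jN andbT -/mut -/nut -/(threshold h c d n).
  by case: lerP => h1; [right|left].
have nutb : `|nut| <= K + sigmaZ * `|avg n (fun i => eps i j w)|.
  rewrite /nut nu_tildeE//; apply: (le_trans (ler_normD _ _)); apply: lerD.
    apply: le_trans HK; apply: (le_trans (avg_norm _ _)); apply: avg_le => i.
    rewrite normrM -[leRHS]mulr1; apply: ler_pM => //.
      exact: truncation_contract.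
    by rewrite indicE ger0_norm// lern1 leq_b1.
  by rewrite normrM (gtr0_norm sigmaZ_gt0).
have C0 : 0 <= 2 + 4 * (K ^+ 2 + sigmaZ ^+ 2).
  by rewrite addr_ge0// mulr_ge0// addr_ge0// sqr_ge0.
have L0 : 0 <= if p n j <= 2 * (c n * h n ^+ d) then w2 n j else 0.
  by case: ifP.
have rest0 : 0 <= cell_variance mu (A n) m j + 2 * cell_residual2 l n j
  + 16 * (precision l * (1 + level l)) ^+ 2 * p n j
  + 16 * cell_avg_residual2 l n j w.
  apply: addr_ge0; last exact: mulr_ge0.
  apply: addr_ge0; last by apply: mulr_ge0 => //; exact: mulr_ge0.
  by apply: addr_ge0 => //; exact: mulr_ge0.
have [wbad|wbad] := pselect (bad_set l n j w).
  rewrite indicE mem_set// mul1r.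
  apply: (@le_trans _ _ ((2 + 4 * (K ^+ 2 + sigmaZ ^+ 2)) *
     (w2 n j + p n j * ((1 + avg n (fun i => eps i j w) ^+ 2) / t n ^+ 2)))).
    apply: (@bad_cell _ _ _ _ _ _ _ _ nut mut) => //.
    - exact: ltW.
    - by move: ge; rewrite sqrrN mulrN mulNr opprK.
    - by case: qE => [[_ ->]|[h1 ->]]; [left|right].
  by rewrite lerDr addr_ge0.
rewrite indicE memNset// mul0r mulr0 addr0.
have {wbad} [g1 g2 g3 g4] : [/\
    `|\sum_(i < n) zeta i j w| <= n%:R * (precision l * t n / sigmaW),
    `|\sum_(i < n) eps i j w| <= n%:R * (precision l * t n / sigmaZ),
    `|\sum_(i < n) \1_(A n j) (Xs i w) - n%:R * p n j| <= n%:R * (precision l * t n) &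
    `|\sum_(i < n) trunc l (Ys i w) * \1_(A n j) (Xs i w)
      - n%:R * cell_trunc l n j| <= n%:R * (precision l * t n)].
  split; rewrite leNgt; apply/negP => H; apply: wbad.
  - by left; left; left.
  - by left; left; right.
  - by left; right.
  - by right.
have tol0 : 0 <= precision l * t n by rewrite mulr_ge0 ?ltW// precision_gt0.
have noise (s : R) (f : nat -> R) : 0 < s ->
    `|\sum_(i < n) f i| <= n%:R * (precision l * t n / s) ->
    `|s * avg n f| <= precision l * t n.
  move=> s1 H; have := @avgB n f 0 (precision l * t n / s) n0.
  rewrite mulr0 !subr0 => /(_ H); rewrite ler_pdivlMr// (normrM s) (gtr0_norm s1).
  by rewrite mulrC.
have {g1} g1 := noise _ (fun i => zeta i j w) sigmaW_gt0 g1.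
have {noise g2} g2 := noise _ (fun i => eps i j w) sigmaZ_gt0 g2.
have {g3} g3 := avgB n0 (f := fun i => \1_(A n j) (Xs i w)) g3.
have {g4} g4 := avgB n0 (f := fun i => trunc l (Ys i w) * \1_(A n j) (Xs i w)) g4.
set mun := avg n _ in g3; set nun := avg n _ in g4.
have mutE : mut = mun + sigmaW * avg n (fun i => zeta i j w) by exact: mu_tildeE.
have nutE := nu_tildeE w jN.
have h1 : `|mut - mun| <= precision l * t n by rewrite mutE addrAC subrr add0r.
have h2 : `|mut - p n j| <= 2 * precision l * t n.
  rewrite -(subrKA mun) -mulrA mulr_natl mulr2n.
  by apply: (le_trans (ler_normD _ _)); exact: lerD.
have d1 := precision_le l; have d0 := ltW (precision_gt0 l).
case: qE => [[mt ->]|[tm ->]].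
  rewrite mulr0 mul0r subr0 expr0n /= mul0r addr0 ifT ?lerDr//.
  exact: light_of_unselected d1 mt h2 t0.
apply: (@le_trans _ _ (cell_variance mu (A n) m j + 2 * cell_residual2 l n j
  + 16 * (precision l * (1 + level l)) ^+ 2 * p n j
  + 16 * cell_avg_residual2 l n j w)); last by rewrite lerDl.
pose r := avg n (fun i => \1_(A n j) (Xs i w) * `|residual l (Ys i w)|).
apply: (@selected_cell_error _ _ _ _ (cell_trunc l n j) _ _ r (t n) _ _ _ _ mun) => //.
- by apply: avg_ge0 => i; rewrite mulr_ge0.
- rewrite /nut nutE -/nun.
  set nuM := avg n _.
  have e1 : `|nuM - nun| <= r.
    rewrite /nuM /nun -[- avg _ _]mulN1r -avgZ -avgD.
    apply: (le_trans (avg_norm _ _)); apply: avg_le => i.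
    rewrite mulN1r -mulrBl normrM mulrC ger0_norm// ler_wpM2l//.
    exact: truncation_close (level_gt0 l) lM.
  rewrite (_ : nuM + _ - _ = (nuM - nun) + (nun - cell_trunc l n j) +
     sigmaZ * avg n (fun i => eps i j w)); last by ring.
  rewrite (_ : _ + r = r + precision l * t n + precision l * t n); last by ring.
  apply: (le_trans (ler_normD _ _)); apply: lerD => //.
  by apply: (le_trans (ler_normD _ _)); exact: lerD.
- exact: cell_trunc_le.
- move=> k; rewrite /r /cell_avg_residual2 /mun -!avgZ -avgD.
  apply: avg_le => i.
  rewrite mulrCA [k ^+ 2 * _]mulrC -mulrDr; apply: ler_wpM2l => //.
  rewrite -(real_normK (num_real (residual l (Ys i w)))) -subr_ge0.
  have -> : `|residual l (Ys i w)| ^+ 2 + k ^+ 2 - 2 * k * `|residual l (Ys i w)| =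
    (`|residual l (Ys i w)| - k) ^+ 2 by ring.
  exact: sqr_ge0.
- by move=> k; exact: cell_trunc_close.
Qed.

Let sum_indic_le1 n (x : d.-tuple R) : \sum_(j < N n) \1_(A n j) x <= 1 :> R.
Proof.
have [[i Ai]|no] := pselect (exists i : 'I_(N n), A n i x).
  rewrite (bigD1 i)//= indicE mem_set// big1 ?addr0// => k ki.
  rewrite indicE memNset// => Ak; move/eqP: ki; apply; apply: val_inj.
  by apply: (@tA n k i I I); exists x.
rewrite big1// => i _; rewrite indicE memNset// => Ai.
by apply: no; exists i.
Qed.

Lemma sum_cell_avg_residual2_le l n w :
  \sum_(j < N n) cell_avg_residual2 l n j w <=
  avg n (fun i => residual l (Ys i w) ^+ 2).
Proof.
rewrite /cell_avg_residual2 /avg -mulr_sumr exchange_big /=.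
apply: ler_wpM2l; first by rewrite invr_ge0.
apply: ler_sum => i _; rewrite -mulr_suml ler_piMl ?sqr_ge0//.
exact: sum_indic_le1.
Qed.

Let split_sum K (a b q s li bw : nat -> R) (k1 k2 k3 k4 : R) :
  \sum_(j < K) (a j + k1 * b j + k2 * q j + k3 * s j + li j + k4 * bw j) =
  \sum_(j < K) a j + k1 * \sum_(j < K) b j + k2 * \sum_(j < K) q j +
  k3 * \sum_(j < K) s j + \sum_(j < K) li j + k4 * \sum_(j < K) bw j.
Proof. by rewrite !big_split /= !mulr_sumr. Qed.

Lemma error_bound l n w K : (0 < n)%N -> ((level l)%:E <= M n)%E ->
  avg n (fun i => `|Ys i w|) <= K ->
  (\int[mu]_x ((m x - m_tilde Xs Ys eps zeta sigmaZ sigmaW h c M A N n w x)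
      ^+ 2)%:E <=
   \int[mu]_(x in uncovered (A n) (N n)) (m x ^+ 2)%:E +
   (\sum_(j < N n) cell_variance mu (A n) m j + 2 * mean_residual2 l
    + 16 * (precision l * (1 + level l)) ^+ 2
    + 16 * avg n (fun i => residual l (Ys i w) ^+ 2)
    + \sum_(j < N n | p n j <= 2 * (c n * h n ^+ d)) w2 n j
    + (2 + 4 * (K ^+ 2 + sigmaZ ^+ 2)) * bad_weight l n w)%:E)%E.
Proof.
move=> n0 lM HK.
have q0 j : (N n <= j)%N -> cell_estimate n w j = 0.
  by move=> Nj; rewrite /cell_estimate ltnNge Nj andbF.
have := int_sqr_sub_cells (mA n) (@tA n) mm m2i (covA n) q0.
rewrite [X in X = _ -> _](_ : _ = \int[mu]_x ((m x -
  m_tilde Xs Ys eps zeta sigmaZ sigmaW h c M A N n w x) ^+ 2)%:E)%E// => ->.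
apply: leeD => //; rewrite lee_fin.
apply: (le_trans (ler_sum _ (fun j _ => cell_error_bound (ltn_ord j) n0 lM HK erefl))).
rewrite (split_sum (N n) (fun j => cell_variance mu (A n) m j)
  (fun j => cell_residual2 l n j) (fun j => p n j)
  (fun j => cell_avg_residual2 l n j w)
  (fun j => if p n j <= 2 * (c n * h n ^+ d) then w2 n j else 0)
  (fun j => \1_(bad_set l n j) w *
    (w2 n j + p n j * ((1 + avg n (fun i => eps i j w) ^+ 2) / t n ^+ 2)))).
rewrite -big_mkcond /=.
have sp : \sum_(j < N n) p n j <= 1 by exact: sum_cell_mass_le (mA n) (@tA n) _.
apply: lerD => //; apply: lerD => //.
apply: lerD; last by rewrite ler_wpM2l// sum_cell_avg_residual2_le.
apply: lerD; last first.
  by apply: ler_piMr => //; rewrite mulr_ge0// sqr_ge0.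
by rewrite lerD2l ler_wpM2l// sum_cell_residual2_le.
Qed.

(** The residual vanishes unless the response exceeds the level. *)
Lemma mean_residual2_cvg0 (e : R) : 0 < e ->
  \forall l \near \oo, mean_residual2 l <= e.
Proof.
move=> e0; have [r r0 Hr] := int_sqr_small iY2 e0.
have r2 : 0 < r / 2 by rewrite divr_gt0.
pose B l := [set w | level l < `|Y w|].
have mB l : measurable (B l) by exact: measurable_gt.
have B0 w : \forall l \near \oo, ~ B l w.
  exists (Num.truncn `|Y w|) => // l /= tl; apply/negP; rewrite -leNgt.
  have /andP[_ /ltW Yt] := truncn_itv (normr_ge0 (Y w)).
  by apply: (le_trans Yt); rewrite ler_nat ltnS.
have := eventually_small P r2 mB B0; apply: filterS => l Bl.
have mr2 : measurable_fun setT (fun w => residual l (Y w) ^+ 2).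
  by apply: measurable_funX; exact: (measurableT_comp (mres l) mY).
have mY2 : measurable_fun setT (fun w => Y w ^+ 2) by exact: measurable_funX.
rewrite -lee_fin /mean_residual2.
rewrite -(int_EFin_Rintegral (g := fun w => residual l (Y w) ^+ 2)) //;
  last exact: ires2.
have Bl' : (P (B l) < r%:E)%E.
  by apply: (le_lt_trans Bl); rewrite lte_fin ltr_pdivrMr// ltr_pMr// ltr1n.
apply: le_trans (Hr _ (mB l) Bl'); rewrite [leRHS]int_setE; apply: int_le.
- by move=> w; exact: sqr_ge0.
- exact: mr2.
- by apply: measurable_funM.
move=> w; rewrite indicE; case: (boolP (w \in B l)) => wB.
  rewrite mul1r -(real_normK (num_real (Y w))) -[leLHS]real_normK ?num_real//.
  by rewrite lerXn2r ?nnegrE// residual_norm_le.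
rewrite mul0r /residual /trunc truncation_id ?level_gt0 ?subrr ?expr0n//.
by rewrite leNgt; apply/negP => H; move/negP: wB; apply; rewrite inE.
Qed.

Let average_sqr_ae (g : R -> R) (v0 a : R) : measurable_fun setT g ->
  (\int[P]_w (g (Y w) ^+ 2)%:E = v0%:E)%E -> 0 < a ->
  {ae P, forall w, \forall n \near \oo,
    avg n (fun i => g (Ys i w) ^+ 2) <= 2 * (v0 + a)}.
Proof.
move=> mg Ev a0.
apply: (@average_ae_bounded _ _ _ P _ _ (fun i w => (Xs i w, Ys i w))
  (fun w => (X w, Y w)) mpair mpairXY data_indep data_law
  (fun x : d.-tuple R * R => g x.2 ^+ 2)) => //.
- by apply: measurable_funX; exact: (measurableT_comp mg measurable_snd).
- by move=> x; exact: sqr_ge0.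
Qed.

(** With [D <= l1 / 4] and [av <= 2 * (U + l1)], the total factors of [U] and of
[l1] are 34 and 36; 272 and 288 are eight times these. *)
Let final_sum (e U l1 D vr un av li bw C : R) : 0 < e ->
  U <= e / 272 -> l1 <= e / 288 -> D <= l1 / 4 ->
  vr <= e / 8 -> un <= e / 8 -> av <= 2 * (U + l1) -> li <= e / 8 ->
  C * bw <= e / 8 ->
  un + (vr + 2 * U + 16 * D + 16 * av + li + C * bw) <= e.
Proof. by move=> *; lra. Qed.

(** The level [l] is chosen first, to make the residuals and the tolerance
small; the sample size is taken large for that level. *)
Lemma private_estimate_consistent :
  {ae P, forall w,
    (fun n => \int[mu]_x
       ((m x - m_tilde Xs Ys eps zeta sigmaZ sigmaW h c M A N n w x) ^+ 2)%:E)%E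
      @ \oo --> 0%E}.
Proof.
pose EY2 : R := \int[P]_(w in setT) (Y w ^+ 2).
have EY2E : (\int[P]_w (Y w ^+ 2)%:E = EY2%:E)%E.
  exact: (int_EFin_Rintegral (g := fun w => Y w ^+ 2)).
have aeY := average_sqr_ae (@measurable_id _ _ setT) EY2E ltr01.
have aeU : {ae P, forall w, forall l, \forall n \near \oo,
    avg n (fun i => residual l (Ys i w) ^+ 2) <=
    2 * (mean_residual2 l + (level l)^-1)}.
  apply: ae_foralln => l; apply: average_sqr_ae => //.
    apply: (int_EFin_Rintegral (g := fun w => residual l (Y w) ^+ 2)) => //.
    exact: ires2.
  by rewrite invr_gt0 level_gt0.
have aeB : {ae P, forall w, forall l,
    (fun n => bad_weight l n w) @ \oo --> (0 : R)}.
  by apply: ae_foralln => l; exact: bad_weight_cvg0.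
apply: filterS3 aeY aeU aeB => w wY wU wB.
(* As [y <= 1 + y ^ 2], this eventually bounds the mean absolute response. *)
pose K := 1 + 2 * (EY2 + 1); pose C := 2 + 4 * (K ^+ 2 + sigmaZ ^+ 2).
have C0 : 0 < C.
  by rewrite /C ltr_pwDl// mulr_ge0// addr_ge0// sqr_ge0.
set I_ := fun n => _.
have I0 n : (0 <= I_ n)%E by apply: int_ge0 => x; exact: sqr_ge0.
have main (e : R) : 0 < e -> \forall n \near \oo, (I_ n <= e%:E)%E.
  move=> e0.
  have e272 : 0 < e / 272 by rewrite divr_gt0.
  have e288 : 0 < e / 288 by rewrite divr_gt0.
  have e8 : 0 < e / 8 by rewrite divr_gt0.
  have [l [lU ll]] : exists l, mean_residual2 l <= e / 272 /\ (level l)^-1 <= e / 288.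
    near \oo => l; exists l; split; first by near: l; exact: mean_residual2_cvg0.
    rewrite -[leRHS]invrK lef_pV2 ?posrE ?level_gt0 ?invr_gt0//.
    apply: (@le_trans _ _ l%:R); last by rewrite /level ler_nat.
    by near: l; exact: nbhs_infty_ger.
  near=> n.
  have n0 : (0 < n)%N by near: n; exact: nbhs_infty_gt.
  have lM : ((level l)%:E <= M n)%E.
    by near: n; move/cvgeyPge: M_cvg; apply.
  have HK : avg n (fun i => `|Ys i w|) <= K.
    apply: (@le_trans _ _ (1 + avg n (fun i => Ys i w ^+ 2))).
      apply: (@le_trans _ _ (avg n (fun i => 1 + Ys i w ^+ 2))).
        apply: avg_le => i; rewrite -(real_normK (num_real (Ys i w))).
        move: (`|Ys i w|) => y; have := sqr_ge0 (y - 1); nra.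
      rewrite avgD lerD2r /avg sumr_const card_ord mulVf//.
      by rewrite pnatr_eq0 -lt0n.
    by rewrite /K lerD2l; near: n; exact: wY.
  apply: (le_trans (error_bound n0 lM HK)).
  apply: (@le_trans _ _ ((e / 8)%:E + (\sum_(j < N n) cell_variance mu (A n) m j
    + 2 * mean_residual2 l + 16 * (precision l * (1 + level l)) ^+ 2
    + 16 * avg n (fun i => residual l (Ys i w) ^+ 2)
    + \sum_(j < N n | p n j <= 2 * (c n * h n ^+ d)) w2 n j
    + (2 + 4 * (K ^+ 2 + sigmaZ ^+ 2)) * bad_weight l n w)%:E)%E).
    by apply: leeD => //; near: n; exact: int_uncovered_cvg0.
  rewrite -EFinD lee_fin; apply: (final_sum (l1 := (level l)^-1)) => //.
  - by apply: (le_trans (precision_level l)); rewrite invfM mulrC.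
  - by near: n; exact: (sum_cell_variance_cvg0 N d_gt0 mA tA cubeA h_gt0 h_cvg mm m2i).
  - by near: n; exact: wU.
  - near: n; exact: (int_light_cells_cvg0 N d_gt0 mA tA cubeA h_gt0 h_cvg mm m2i).
  rewrite -/C mulrC -ler_pdivlMr//.
  have : `|0 - bad_weight l n w| <= e / 8 / C.
    by near: n; move/cvgrPdist_le: (wB l); apply; rewrite divr_gt0.
  by rewrite sub0r normrN; apply: le_trans; exact: ler_norm.
apply/fine_cvgP; split.
  have := main 1 ltr01; apply: filterS => n In.
  by rewrite ge0_fin_numE//; apply: (le_lt_trans In); exact: ltry.
apply/cvgrPdist_le => e e0; have := main e e0; apply: filterS => n In /=.
rewrite sub0r normrN ger0_norm ?fine_ge0//.
by rewrite -lee_fin fineK// ge0_fin_numE//; apply: (le_lt_trans In); exact: ltry.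
Unshelve. all: by end_near. Qed.

End private_estimate_error.

Theorem theorem2 (R : realType) (d : nat) (hd : (1 <= d)%N)
  (sigmaZ sigmaW : R) (hsigmaZ : 0 < sigmaZ) (hsigmaW : 0 < sigmaW)
  (dO : measure_display) (Omega : measurableType dO) (P : probability Omega R)
  (X : {RV P >-> d.-tuple R}) (Y : {RV P >-> R})
  (hY2 : ('E_P[(fun w => Y w ^+ 2)%R] < +oo)%E)
  (m : d.-tuple R -> R) (hm : is_regression_function X Y m)
  (Xs : nat -> {RV P >-> d.-tuple R}) (Ys : nat -> {RV P >-> R})
  (hdata_law : forall i,
     same_law P (fun w => (Xs i w, Ys i w)) (fun w => (X w, Y w)))
  (hdata_indep : mutually_independent P (fun i w => (Xs i w, Ys i w)))
  (eps zeta : nat -> nat -> {RV P >-> R})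
  (heps_law : forall i j, laplace_distributed (eps i j))
  (heps_indep : mutually_independent P (fun ij : nat * nat => eps ij.1 ij.2))
  (hzeta_law : forall i j, laplace_distributed (zeta i j))
  (hzeta_indep : mutually_independent P (fun ij : nat * nat => zeta ij.1 ij.2))
  (hindep : independent3 P
     (sigma_of_family (fun i w => (Xs i w, Ys i w)))
     (sigma_of_family (fun ij : nat * nat => eps ij.1 ij.2))
     (sigma_of_family (fun ij : nat * nat => zeta ij.1 ij.2)))
  (h c : nat -> R) (M : nat -> \bar R) (S : nat -> set (d.-tuple R))
  (h_gt0 : forall n, 0 < h n) (c_gt0 : forall n, 0 < c n)
  (M_gt0 : forall n, (0 < M n)%E) (S_ball : forall n, origin_ball (S n))
  (Q : R -> set (set (d.-tuple R)))
  (hQ : forall r, 0 < r -> cubic_partition r (Q r))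
  (A : nat -> nat -> set (d.-tuple R)) (N : nat -> nat)
  (hA : forall n, set_bij [set: nat] (Q (h n)) (A n))
  (N_gt0 : forall n, (0 < N n)%N)
  (hN : forall n j, A n j `&` S n !=set0 <-> (j < N n)%N)
  (S_incr : forall n, S n `<=` S n.+1)
  (S_cover : \bigcup_n S n = [set: d.-tuple R])
  (c_cvg : c @ \oo --> 0)
  (h_cvg : h @ \oo --> 0)
  (M_cvg : M @ \oo --> +oo%E)
  (rate_cvg : (fun n => ln n%:R ^+ 3 / (n%:R * c n ^+ 2 * h n ^+ (2 * d)))
                @ \oo --> (0 : R)) :
  {ae P, forall w,
    (fun n => \int[distribution P X]_x
       ((m x - m_tilde Xs Ys eps zeta sigmaZ sigmaW h c M A N n w x) ^+ 2)%:E)%E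
      @ \oo --> 0%E}.
Proof.
have mA n j : measurable (A n j).
  have [cells _ _] := hQ _ (h_gt0 n).
  by have [fA _ _] := hA n; have [] := cells _ (fA j I).
have cubeA n j : is_cube (h n) (A n j).
  have [cells _ _] := hQ _ (h_gt0 n).
  by have [fA _ _] := hA n; have [] := cells _ (fA j I).
have tA n : trivIset setT (A n).
  have [_ disj _] := hQ _ (h_gt0 n); have [fA injA _] := hA n.
  move=> i j _ _ meet; apply: injA; rewrite ?inE//.
  by apply: disj; [exact: fA|exact: fA|].
have covA n : \bigcup_j A n j = setT.
  have [_ _ cov] := hQ _ (h_gt0 n); have [_ _ surjA] := hA n.
  apply/seteqP; split => // x _.
  have [B QB Bx] : (\bigcup_(B in Q (h n)) B) x by rewrite cov.
  by have [j _ AjB] := surjA B QB; exists j => //; rewrite AjB.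
have covN x : \forall n \near \oo, exists2 j, (j < N n)%N & A n j x.
  have [n0 _ Sx] : (\bigcup_n S n) x by rewrite S_cover.
  exists n0 => // n /= n0n.
  have {}Sx : S n x.
    rewrite -(subnKC n0n); elim: (n - n0)%N => [|k IH]; first by rewrite addn0.
    by rewrite addnS; exact: S_incr.
  have [j _ Ax] : (\bigcup_j A n j) x by rewrite covA.
  by exists j => //; apply/hN; exists x.
have iY2 : P.-integrable setT (fun w => (Y w ^+ 2)%:E).
  apply/integrableP; split.
    by apply/measurable_EFinP; apply: measurable_funX.
  move: hY2; rewrite unlock; apply: le_lt_trans.
  rewrite le_eqVlt; apply/orP; left; apply/eqP; apply: eq_integral => w _ /=.
  by rewrite ger0_norm// sqr_ge0.
exact: (private_estimate_consistent hd hsigmaZ hsigmaW iY2 hm hdata_law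
  hdata_indep heps_law heps_indep hzeta_law hzeta_indep h_gt0 c_gt0 M_gt0
  mA tA cubeA covA covN c_cvg h_cvg M_cvg rate_cvg).
Qed.
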